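(* Let $g:\mathbb{R}\to\mathbb{R}$ be a continuous function, let $G(t)=\int_0^tg(\tau)\,d\tau$, and let $\Phi:X\to\mathbb{R}$ be the $C^1(X,\mathbb{R})$ functional $$\Phi(u)=\frac12\|u\|_X^2-\int_0^1G(u)\,dx .$$ Suppose that $g$ satisfies one of the following two growth conditions: (subcritical) $\displaystyle\lim_{|t|\to\infty}\frac{|g(t)|}{\exp(\alpha t^2)}=0$ for all $\alpha>0$; or (critical) there exists $\alpha_0>0$ such that $\displaystyle\lim_{|t|\to\infty}\frac{|g(t)|}{\exp(\alpha t^2)}$ equals $\infty$ if $0<\alpha<\alpha_0$ and equals $0$ if $\alpha>\alpha_0$. Suppose that $0$ is a local minimum of $\Phi$ in $C_\delta^0([0,1])$, that is, there exists $r_1>0$ such that $$\Phi(0)\le\Phi(z)\quad\text{for all }z\in X\cap C_\delta^0([0,1])\text{ with }\|z\|_{0,\delta}\le r_1 .$$ Then $0$ is a local minimum of $\Phi$ in $X$, that is, there exists $r_2>0$ such that $$\Phi(0)\le\Phi(z)\quad\text{for all }z\in X\text{ with }\|z\|_X\le r_2 .$$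
   Context: $X=\{u\in H^{1/2}(\mathbb{R}):u=0\text{ in }\mathbb{R}\setminus(0,1)\}$, with inner product $\langle u,v\rangle_X=\int_{\mathbb{R}^2}\frac{(u(x)-u(y))(v(x)-v(y))}{|x-y|^2}\,dx\,dy$ and norm $\|u\|_X=\langle u,u\rangle_X^{1/2}$. Let $\delta(x)=\mathrm{dist}(x,\mathbb{R}\setminus(0,1))$ for $x\in[0,1]$. $C_\delta^0([0,1])$ is the space of $u\in C^0([0,1])$ such that $u/\delta^{1/2}$ has a continuous extension to $[0,1]$, with norm $\|u\|_{0,\delta}=\|u/\delta^{1/2}\|_{L^\infty(0,1)}$. *)

(* Defs.v *)
(* MathComp-Analysis, over an arbitrary [R : realType]. *)
From HB Require Import structures.
From mathcomp Require Import all_boot all_order all_algebra.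
From mathcomp Require Import all_classical all_reals all_analysis.

Set Implicit Arguments.
Unset Strict Implicit.
Unset Printing Implicit Defensive.
Import Order.TTheory GRing.Theory Num.Theory.
Import numFieldNormedType.Exports.

Local Open Scope classical_set_scope.
Local Open Scope ring_scope.

Section Definitions.
Variable R : realType.
Implicit Types (u v w z g : R -> R).

Local Notation mu := (@lebesgue_measure R).

(* On the diagonal, a null set, the integrand is [0 / 0 = 0]. *)
Definition gagliardo_integrand u v (p : R * R) : R :=
  (u p.1 - u p.2) * (v p.1 - v p.2) / `|p.1 - p.2| ^+ 2.

(* H^{1/2}(R); elements of function spaces are represented by measurable
   functions R -> R, not quotiented by almost everywhere equality. *)
Definition H12 : set (R -> R) :=
  [set u : R -> R | u \in Lfun mu 2%:E /\
    (mu \x mu)%E.-integrable setT (EFin \o gagliardo_integrand u u)].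

Definition X : set (R -> R) :=
  [set u : R -> R | H12 u /\ {ae mu, forall x, ~ `]0, 1[%classic x -> u x = 0}].

Definition innerX u v : R :=
  Rintegral (mu \x mu)%E setT (gagliardo_integrand u v).

Definition normX u : R := Num.sqrt (innerX u u).

Definition delta (x : R) : R :=
  inf [set `|x - y| | y in ~` `]0, 1[%classic].

(* A condition on the restriction of [u] to [0, 1]; [w] is the continuous
   extension of u / delta^{1/2}, which is defined on ]0, 1[. *)
Definition C0delta : set (R -> R) :=
  [set u : R -> R | {within `[0 : R, 1], continuous u} /\
    exists2 w : R -> R, {within `[0 : R, 1], continuous w} &
      forall x : R, x \in `]0, 1[ -> w x = u x / Num.sqrt (delta x)].

Definition norm0delta u : \bar R :=
  Lnorm (mrestr mu (measurable_itv `]0, 1[)) +oo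
    (fun x => (u x / Num.sqrt (delta x))%:E).

(* The oriented integral of [g] from 0 to [t]. *)
Definition primitive g (t : R) : R :=
  if 0 <= t then \int[mu]_(s in `[0, t]) g s
  else - \int[mu]_(s in `[t, 0]) g s.

Definition Phi g u : R :=
  2^-1 * normX u ^+ 2 - \int[mu]_(x in `[0, 1]) primitive g (u x).

(* The filter of |t| -> oo. *)
Definition abs_infty : set_system R :=
  filter_from setT (fun M : R => [set t : R | M < `|t|]).

Definition growth_ratio g (alpha t : R) : R :=
  `|g t| / expR (alpha * t ^+ 2).

Definition subcritical g : Prop :=
  forall alpha : R, 0 < alpha -> growth_ratio g alpha @ abs_infty --> 0.

Definition critical g : Prop :=
  exists2 alpha0 : R, 0 < alpha0 &
    forall alpha : R,
      (0 < alpha < alpha0 -> growth_ratio g alpha @ abs_infty --> +oo) /\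
      (alpha0 < alpha -> growth_ratio g alpha @ abs_infty --> 0).

End Definitions.

Arguments abs_infty R : clear implicits.

#[global] Instance abs_infty_filter (R : realType) :
  ProperFilter (abs_infty R).
Proof.
apply: filter_from_proper; last first.
  move=> M _; exists (`|M| + 1) => /=.
  by rewrite ger0_norm ?addr_ge0// ltr_pwDr// ler_norm.
apply: filter_from_filter; first by exists 0.
move=> M N _ _; exists (Num.max M N) => // t /=.
by rewrite gt_max => /andP[].
Qed.

(* Main.v *)
Require Import Defs.
From mathcomp Require Import all_boot all_order all_algebra.
From mathcomp Require Import all_classical all_reals all_analysis.
From mathcomp Require Import measurable_realfun ess_sup_inf lebesgue_integral_differentiation.
From mathcomp Require Import ring lra.
Set Implicit Arguments.
Unset Strict Implicit.
Unset Printing Implicit Defensive.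
Import Order.TTheory GRing.Theory Num.Theory.
Import numFieldNormedType.Exports.
Local Open Scope classical_set_scope.
Local Open Scope ring_scope.

(** A function [z] of small energy is truncated twice, and neither step
    increases [Phi].  Truncating at a constant [s] gains energy at least
    [(s / a) * \int v], where [v] is the part cut off and [a] bounds the measure
    of [|z| > s / 2], so the factor is large; a Moser-Trudinger estimate,
    obtained from the decay of the measures of the level sets of [z], bounds the
    change of the integral of [G] by a constant times [\int v].  Truncating
    next at [k * barrier], with [barrier] the square root of [d / (1 - d)] for
    [d] the distance to the boundary, gains at least [k * \int v], because
    [barrier] is a strict supersolution of the half-Laplacian; this is enough
    if [|g| <= k / 2] on [[-s, s]], and [g 0 = 0] is forced by the
    minimality.  The outcome is at most [r1 * sqrt d], and Steklov averages of
    its soft thresholds lie in the given ball of [C0delta], have no more energy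
    and converge almost everywhere, so that [Phi] is nonnegative at it. *)

(** Small energy controls neither the supremum of [z] nor its decay at the end points, while the
    hypothesis only concerns functions bounded by a multiple of [sqrt d]. The truncations come in
    this order because the second one needs [|g| <= k / 2] on the whole range of the function, which
    only the first can secure. The barrier has a conformal origin. The Moebius map
    [x |-> x / (1 - x)] sends the interval onto the half-line, where the square root is harmonic for
    the half-Laplacian; [odds], its pullback, is half-harmonic on []0, 1[] and singular at 1. The
    barrier is the minimum of [odds x] and [odds (1 - x)], and a minimum of two solutions is a
    supersolution, here with a quantitative margin. The obstacle is the principal value: the
    positive and negative parts of the half-Laplacian of the barrier both diverge at the diagonal. A
    window around the diagonal is removed which is multiplicative in [odds]; the remaining integrals
    are elementary, and the window is closed only after the divergent parts have cancelled. *)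

Section measurability.
Context d {T : measurableType d} {R : realType}.
Implicit Types (D : set T) (f g : T -> R).

Lemma measurable_funV D f : measurable_fun D f ->
  measurable_fun D (fun x => (f x)^-1).
Proof.
move=> mf.
(* The power function is an inverse on nonnegative bases, hence the square; zeros of [f] are
   harmless since [0^-1 = 0]. *)
rewrite (_ : (fun x => _) = fun x => f x * (f x ^+ 2) `^ (-1)).
  apply: measurable_funM => //.
  apply: (measurableT_comp (@measurable_powR R (-1))).
  exact: measurable_funX.
apply/funext => x; rewrite powR_inv1 ?sqr_ge0//.
have [->|fx0] := eqVneq (f x) 0; first by rewrite invr0 mul0r.
by field.
Qed.

Lemma measurable_sqrt : measurable_fun setT (@Num.sqrt R).
Proof. exact: continuous_measurable_fun (@sqrt_continuous R). Qed.

Lemma measurable_set_gtr f (t : R) : measurable_fun setT f ->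
  measurable [set x | t < f x].
Proof.
move=> mf; rewrite -[X in measurable X]setTI.
exact: (measurable_fun_ltr (measurable_cst _) mf) measurableT [set true] I.
Qed.

End measurability.

Ltac measure_tac := repeat first
  [ assumption | exact: measurable_cst | exact: measurable_fst
  | exact: measurable_snd | exact: measurable_id
  | apply: measurable_funX | apply: measurable_funV
  | apply: measurable_funB | apply: measurable_funD
  | apply: measurable_funM | apply: measurable_funN
  | apply: measurable_maxr | apply: measurable_minr
  | apply: (measurableT_comp (@normr_measurable _ setT))
  | apply: (measurableT_comp measurable_sqrt)
  | apply: (measurableT_comp (@measurable_expR _)) ].

(** * The Gagliardo energy as an extended real *)

Section energy.
Context {R : realType}.
Local Notation mu := (@lebesgue_measure R).
Implicit Types (u v w z : R -> R) (x y : R).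

Lemma ae_weaken (P Q : R -> Prop) : (forall x, P x -> Q x) ->
  {ae mu, forall x, P x} -> {ae mu, forall x, Q x}.
Proof. exact: (@filterS _ _ (ae_filter_ringOfSetsType mu)). Qed.

Lemma le_lebesgue (A B : set R) : measurable A -> measurable B ->
  A `<=` B -> (mu A <= mu B)%E.
Proof. by move=> mA mB AB; apply: le_measure; rewrite ?inE. Qed.

Lemma integral_scaled (c : R) (f : R -> R) : 0 <= c ->
  measurable_fun setT f -> (forall x, 0 <= f x) ->
  (\int[mu]_x (c * f x)%:E = c%:E * \int[mu]_x (f x)%:E)%E.
Proof.
move=> c0 mf f0; under eq_integral do rewrite EFinM.
rewrite ge0_integralZl_EFin//; first by move=> x _; rewrite lee_fin.
exact/measurable_EFinP.
Qed.

Lemma integral_scaled_indic (c : R) (A : set R) : 0 <= c -> measurable A ->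
  (\int[mu]_x (c * \1_A x)%:E = c%:E * mu A)%E.
Proof.
move=> c0 mA; under eq_integral do rewrite EFinM.
rewrite ge0_integralZl_EFin//; last exact/measurable_EFinP.
by rewrite integral_indic// setIT.
Qed.

Definition kern x y : R := (`|x - y| ^+ 2)^-1.

(** The square of [normX] when finite. In [\bar R], truncations and averages can be compared before
    their energy is known to be finite. *)
Definition energy u : \bar R :=
  (\int[(mu \x mu)%E]_p ((u p.1 - u p.2) ^+ 2 * kern p.1 p.2)%:E)%E.

Lemma kern_ge0 x y : 0 <= kern x y.
Proof. by rewrite invr_ge0 sqr_ge0. Qed.

Lemma kernC x y : kern x y = kern y x.
Proof. by rewrite /kern distrC. Qed.

Lemma kern_xx x : kern x x = 0.
Proof. by rewrite /kern subrr normr0 expr0n/= invr0. Qed.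

Lemma measurable_comp_fst u : measurable_fun setT u ->
  measurable_fun setT (fun p : R * R => u p.1).
Proof. by move=> mu_; exact: measurableT_comp measurable_fst. Qed.

Lemma measurable_comp_snd u : measurable_fun setT u ->
  measurable_fun setT (fun p : R * R => u p.2).
Proof. by move=> mu_; exact: measurableT_comp measurable_snd. Qed.

Lemma measurable_kern : measurable_fun setT (fun p : R * R => kern p.1 p.2).
Proof. by rewrite /kern; measure_tac. Qed.

Lemma measurable_kernr x : measurable_fun setT (kern x).
Proof. by rewrite /kern; measure_tac. Qed.

Lemma measurable_energy_integrand u : measurable_fun setT u ->
  measurable_fun setT
    (fun p : R * R => ((u p.1 - u p.2) ^+ 2 * kern p.1 p.2)%:E).
Proof.
move=> mu_; apply/measurable_EFinP; have ? := measurable_comp_fst mu_.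
have ? := measurable_comp_snd mu_; have ? := measurable_kern.
by measure_tac.
Qed.

Lemma energy_ge0 u : (0 <= energy u)%E.
Proof.
by apply: integral_ge0 => p _; rewrite lee_fin mulr_ge0 ?sqr_ge0 ?kern_ge0.
Qed.

(** Truncation, soft threshold and absolute value enter through this: each is 1-Lipschitz in the
    values of the function. *)
Lemma le_energy u v : measurable_fun setT u -> measurable_fun setT v ->
  (forall x y, `|u x - u y| <= `|v x - v y|) -> (energy u <= energy v)%E.
Proof.
move=> mu_ mv uv; apply: ge0_le_integral => //.
- by move=> p _; rewrite lee_fin mulr_ge0 ?sqr_ge0 ?kern_ge0.
- exact: measurable_energy_integrand.
- exact: measurable_energy_integrand.
move=> p _; rewrite lee_fin ler_wpM2r ?kern_ge0//.
by rewrite -[leLHS]real_normK ?num_real// -[leRHS]real_normK ?num_real//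
  ler_sqr ?nnegrE.
Qed.

Lemma gagliardo_energy u :
  (\int[(mu \x mu)%E]_p (gagliardo_integrand u u p)%:E = energy u)%E.
Proof.
by apply: eq_integral => p _; rewrite /gagliardo_integrand -expr2.
Qed.

Lemma energy_normX u : (energy u < +oo)%E -> energy u = (normX u ^+ 2)%:E.
Proof.
move=> fu; rewrite /normX sqr_sqrtr /innerX /Rintegral gagliardo_energy.
  by rewrite fineK// ge0_fin_numE ?energy_ge0.
exact/fine_ge0/energy_ge0.
Qed.

Lemma X_measurable u : X u -> measurable_fun setT u.
Proof.
by case=> -[/sub_Lfun_mfun + _] _; rewrite inE.
Qed.

Lemma X_energy u : X u -> energy u = (normX u ^+ 2)%:E.
Proof.
case=> -[_ /integrableP[_ fu]] _; apply: energy_normX.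
apply: le_lt_trans fu; rewrite -gagliardo_energy le_eqVlt; apply/orP; left.
apply/eqP; apply: eq_integral => p _ /=.
rewrite ger0_norm// /gagliardo_integrand -expr2.
by rewrite divr_ge0 ?sqr_ge0.
Qed.

Lemma X_ae0 u : X u -> {ae mu, forall x, ~ `]0, 1[%classic x -> u x = 0}.
Proof. by case. Qed.

Lemma bounded_X (C : R) u : measurable_fun setT u -> (forall x, `|u x| <= C) ->
  {ae mu, forall x, ~ `]0, 1[%classic x -> u x = 0} -> (energy u < +oo)%E ->
  X u.
Proof.
move=> mu_ uC u0 fu; split => //; split.
  rewrite inE; apply/andP; split; rewrite inE//=.
  rewrite /finite_norm unlock poweR_lty//.
  have -> : (\int[mu]_x `|(EFin \o u) x| `^ 2 = \int[mu]_x (`|u x| ^+ 2)%:E)%E.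
    by apply: eq_integral => x _ /=; rewrite powR_mulrn.
  apply: (@le_lt_trans _ _ (\int[mu]_x (C ^+ 2 * \1_`]0, 1[ x)%:E)%E).
    apply: ae_ge0_le_integral => //.
    - by apply/measurable_EFinP; measure_tac.
    - by move=> x _; rewrite lee_fin mulr_ge0 ?sqr_ge0.
    - by apply/measurable_EFinP; apply: measurable_funM.
    apply: ae_weaken u0 => x + _; rewrite lee_fin indicE => ux.
    have [xI|xI] := boolP (x \in `]0, 1[%classic); last first.
      by rewrite ux ?mulr0 ?normr0 ?expr0n//; move/mem_set; apply/negP.
    by rewrite mulr1 ler_sqr ?nnegrE ?(le_trans _ (uC x)).
  by rewrite integral_scaled_indic ?sqr_ge0//= lebesgue_measure_itv/= lte_fin ltr01 -EFinB
    -EFinM ltry.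
apply/integrableP; split.
  apply/measurable_EFinP; rewrite /gagliardo_integrand.
  have ? := measurable_comp_fst mu_; have ? := measurable_comp_snd mu_.
  by measure_tac.
rewrite (le_lt_trans _ fu)// -gagliardo_energy le_eqVlt; apply/orP; left.
apply/eqP; apply: eq_integral => p _ /=.
by rewrite ger0_norm// /gagliardo_integrand -expr2 divr_ge0 ?sqr_ge0.
Qed.

End energy.

(** * Level sets and the Moser-Trudinger estimate *)

Section kernel_lower_bound.
Context {R : realType}.
Local Notation mu := (@lebesgue_measure R).
Implicit Types (f z : R -> R) (A : set R) (a b h t x y : R).

Lemma kern_ge a x y : 0 < a -> y != x -> x - a < y < x + a ->
  a ^- 2 <= kern x y.
Proof.
move=> a0 yx /andP[y1 y2]; rewrite /kern lef_pV2 ?posrE ?exprn_gt0//; last first.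
  by rewrite normr_gt0 subr_eq0 eq_sym.
rewrite ler_sqr ?nnegrE ?(ltW a0)// ler_norml; apply/andP; split; lra.
Qed.

(* Any set of measure at most [a] misses measure [a] of the ball of radius [a]
   around [x]. *)
Lemma integral_kern_setC_ge A a x : measurable A -> (mu A <= a%:E)%E -> 0 < a ->
  (a^-1%:E <= \int[mu]_(y in ~` A) (kern x y)%:E)%E.
Proof.
move=> mA Aa a0.
pose I : set R := `]x - a, x + a[%classic.
(* The centre is removed because [kern x x] is 0, below the bound [a ^- 2]; being null, it costs no
   measure. *)
pose B := I `\` (A `|` [set x]).
have mA1 : measurable (A `|` [set x]) by exact: measurableU.
have mI : measurable I by exact: measurable_itv.
have mB : measurable B by exact: measurableD.
have BA : B `<=` ~` A by move=> y [_ /not_orP[]].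
apply: (@le_trans _ _ (\int[mu]_(y in B) (kern x y)%:E)%E); last first.
  apply: ge0_subset_integral => //; first exact: measurableC.
    apply/measurable_EFinP; apply: measurable_funTS; exact: measurable_kernr.
  by move=> y _; rewrite lee_fin kern_ge0.
apply: (@le_trans _ _ (\int[mu]_(y in B) (a ^- 2)%:E)%E); last first.
  apply: ge0_le_integral => //.
  - by move=> y _; rewrite lee_fin invr_ge0 sqr_ge0.
  - apply/measurable_EFinP; apply: measurable_funTS; exact: measurable_kernr.
  move=> y [/= yI /not_orP[_ /eqP yx]]; rewrite lee_fin kern_ge//.
rewrite integral_cst//.
have muI : mu I = (a + a)%:E.
  rewrite /I lebesgue_measure_itv/= lte_fin ifT; last lra.
  by rewrite -EFinB; congr EFin; lra.
have muA1 : (mu (A `|` [set x]) <= a%:E)%E.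
  rewrite (le_trans (measureU2 _ _ _))//=.
  by rewrite [X in (_ + X)%E](lebesgue_measure_set1 x) adde0.
have : ((a + a)%:E <= mu B + a%:E)%E.
  rewrite -muI; apply: (@le_trans _ _ (mu (B `|` (A `|` [set x])))).
    apply: le_measure; rewrite ?inE//; first exact: measurableU.
    by move=> y Iy; have [|] := pselect ((A `|` [set x]) y); [right|left].
  by rewrite (le_trans (measureU2 _ _ _))//=; rewrite leeD2l.
rewrite EFinD leeD2rE// => aB.
rewrite (_ : a^-1%:E = ((a ^- 2)%:E * a%:E)%E); last first.
  by rewrite -EFinM; congr EFin; field; rewrite gt_eqF.
by rewrite lee_wpmul2l// lee_fin invr_ge0 sqr_ge0.
Qed.

(** The mechanism behind all lower bounds on the energy by level sets: every point interacts with
    the complement of a small set with strength at least [a^-1]. *)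
Lemma integral_rect_kern_ge f A a : measurable_fun setT f ->
  (forall x, 0 <= f x) -> measurable A -> (mu A <= a%:E)%E -> 0 < a ->
  (a^-1%:E * \int[mu]_x (f x)%:E <=
   \int[(mu \x mu)%E]_p (f p.1 * \1_(~` A) p.2 * kern p.1 p.2)%:E)%E.
Proof.
move=> mf f0 mA Aa a0.
have mC : measurable (~` A) by exact: measurableC.
have m1 : measurable_fun setT (\1_(~` A) : R -> R) by exact: measurable_indic.
have mF : measurable_fun setT
    (fun p : R * R => (f p.1 * \1_(~` A) p.2 * kern p.1 p.2)%:E).
  apply/measurable_EFinP; have ? := measurable_comp_fst mf.
  have ? := measurable_comp_snd m1; have ? := @measurable_kern R.
  by measure_tac.
have F0 (p : R * R) : (0 <= (f p.1 * \1_(~` A) p.2 * kern p.1 p.2)%:E)%E.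
  by rewrite lee_fin mulr_ge0 ?kern_ge0// mulr_ge0.
rewrite fubini_tonelli1// -ge0_integralZl//; last 3 first.
- exact/measurable_EFinP.
- by move=> x _; rewrite lee_fin.
- by rewrite lee_fin invr_ge0 ltW.
apply: ge0_le_integral => //.
- by move=> x _; rewrite -EFinM lee_fin mulr_ge0// invr_ge0 ltW.
- by apply/measurable_EFinP; measure_tac.
- exact: (measurable_fun_fubini_tonelli_F (m2 := mu)).
move=> x _; rewrite /fubini_F/=.
have -> : (\int[mu]_y (f x * \1_(~` A) y * kern x y)%:E =
    (f x)%:E * \int[mu]_(y in ~` A) (kern x y)%:E)%E.
  rewrite [in RHS]integral_mkcond -ge0_integralZl//.
  - apply: eq_integral => y _; rewrite /= patchE indicE.
    by case: ifPn => _; rewrite ?mulr1// mulr0 mul0r mule0.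
  - apply/(measurable_restrictT _ mC)/measurable_funTS/measurable_EFinP.
    exact: measurable_kernr.
  - by move=> y _; rewrite patchE; case: ifPn => //; rewrite lee_fin kern_ge0.
  - by rewrite lee_fin.
by rewrite muleC lee_wpmul2l ?lee_fin// integral_kern_setC_ge.
Qed.

Lemma energy_ge_rect z f A a : measurable_fun setT z ->
  measurable_fun setT f ->
  (forall x, 0 <= f x) -> measurable A -> (mu A <= a%:E)%E -> 0 < a ->
  (forall x y, ~ A y -> f x <= (z x - z y) ^+ 2) ->
  (a^-1%:E * \int[mu]_x (f x)%:E <= energy z)%E.
Proof.
move=> mz mf f0 mA Aa a0 fz; apply: le_trans (integral_rect_kern_ge _ _ mA _ _) _ => //.
have mC : measurable (~` A) by exact: measurableC.
have m1 : measurable_fun setT (\1_(~` A) : R -> R) by exact: measurable_indic.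
apply: ge0_le_integral => //.
- by move=> p _; rewrite lee_fin mulr_ge0 ?kern_ge0// mulr_ge0.
- apply/measurable_EFinP; have ? := measurable_comp_fst mf.
  have ? := measurable_comp_snd m1; have ? := @measurable_kern R.
  by measure_tac.
- exact: measurable_energy_integrand.
move=> [x y] _ /=; rewrite lee_fin ler_wpM2r ?kern_ge0// indicE.
have [yA|] := boolP (y \in ~` A); last by rewrite mulr0 sqr_ge0.
by rewrite mulr1 fz//; move: yA; rewrite inE.
Qed.

End kernel_lower_bound.

Section levels.
Context {R : realType}.
Local Notation mu := (@lebesgue_measure R).
Implicit Types (z : R -> R) (b h t x y : R).

Definition level z t : set R := [set x | t < `|z x|].

Lemma measurable_level z t : measurable_fun setT z -> measurable (level z t).
Proof. by move=> mz; apply: measurable_set_gtr; measure_tac. Qed.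

Lemma level_le z s t : s <= t -> level z t `<=` level z s.
Proof. by move=> st x; rewrite /level/=; exact: le_lt_trans. Qed.

Lemma level0_le1 z : measurable_fun setT z ->
  {ae mu, forall x, ~ `]0, 1[%classic x -> z x = 0} -> (mu (level z 0) <= 1)%E.
Proof.
move=> mz [N [mN N0 zN]].
apply: (@le_trans _ _ (mu (`]0, 1[%classic `|` N))).
  apply: le_measure; rewrite ?inE//.
  - exact: measurable_level.
  - exact: measurableU.
  move=> x; rewrite /level/= normr_gt0 => zx.
  have [|xI] := pselect (`]0, 1[%classic x); [by left|right].
  by apply: zN => /= /(_ xI); apply/eqP.
rewrite (le_trans (measureU2 _ _ _))//=.
by rewrite lebesgue_measure_itv/= lte_fin ltr01 N0 adde0 -EFinB subr0.
Qed.

(** The reference points are the zeros of [z]: they miss a set of measure at most 1, and a point of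
    the level set differs from them by more than [t]. *)
Lemma chebyshev_energy z t : measurable_fun setT z ->
  {ae mu, forall x, ~ `]0, 1[%classic x -> z x = 0} -> 0 <= t ->
  ((t ^+ 2)%:E * mu (level z t) <= energy z)%E.
Proof.
move=> mz z0 t0.
have mt := measurable_level t mz; have m0 := measurable_level 0 mz.
have := @energy_ge_rect _ z (fun x => t ^+ 2 * \1_(level z t) x) (level z 0) 1.
rewrite invr1 mul1e.
rewrite integral_scaled_indic ?sqr_ge0//; apply => //.
- by apply: measurable_funM => //; exact: measurable_indic.
- by move=> x; rewrite mulr_ge0 ?sqr_ge0.
- exact: level0_le1.
move=> x y /negP; rewrite -leNgt normr_le0 => /eqP ->.
rewrite subr0 indicE; have [|] := boolP (x \in _); last by rewrite mulr0 sqr_ge0.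
rewrite inE /level/= mulr1 => tz.
by rewrite -[leRHS]real_normK ?num_real// ler_sqr ?nnegrE// ltW.
Qed.

End levels.

(** * Gaussian decay of the level sets and exponential integrability *)

Section moser_trudinger.
Context {R : realType}.
Local Notation mu := (@lebesgue_measure R).
Implicit Types (z : R -> R) (b h t x y p q E beta : R) (n i j : nat).

Let crossing p q b h j : bool :=
  (b + j.+1%:R * h < p) && (q <= b + j%:R * h).

(** The crossed intervals are disjoint, of length [h], and lie between [q] and [p]. The minimum with
    the last level is what the induction carries: a new crossing sits above all earlier ones. *)
Let crossing_sum p q b h n : 0 <= h ->
  h * (\sum_(j < n) crossing p q b h j)%:R <=
    Num.max 0 (Num.min p (b + n%:R * h) - q).
Proof.
move=> h0; elim: n => [|n IH]; first by rewrite big_ord0 mulr0 le_max lexx.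
rewrite big_ord_recr/= natrD mulrDr.
case: (boolP (crossing p q b h n)) => [/andP[bp qb]|_]; last first.
  rewrite mulr0 addr0 (le_trans IH)// le_max2// lerB// le_min2//.
  by rewrite lerD2l ler_wpM2r// ler_nat.
have bb : b + n.+1%:R * h = b + n%:R * h + h by rewrite mulrSr mulrDl mul1r addrA.
rewrite mulr1 le_max; apply/orP; right.
rewrite (_ : Num.min p (b + n.+1%:R * h) = b + n.+1%:R * h); last first.
  by apply/min_idPr/ltW.
have : h * (\sum_(i < n) crossing p q b h i)%:R <= b + n%:R * h - q.
  apply: le_trans IH _; rewrite ge_max subr_ge0 qb/= lerB//.
  by rewrite ge_min lexx orbT.
rewrite bb; lra.
Qed.

(* Each level interval crossed between [y] and [x] contributes [h ^+ 2]; the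
   number of crossings is at most its square. *)
Let crossing_sqr z b h n x y : 0 <= h ->
  h ^+ 2 * (\sum_(j < n) crossing `|z x| `|z y| b h j)%:R <= (z x - z y) ^+ 2.
Proof.
move=> h0; have := crossing_sum `|z x| `|z y| b n h0.
set c := (\sum_(j < n) _)%N => hc.
have {hc} : h * c%:R <= `|z x - z y|.
  apply: le_trans hc _; rewrite ge_max normr_ge0/=.
  apply: le_trans (lerB_dist _ _); rewrite lerB//.
  by rewrite ge_min lexx.
move=> hc; apply: (@le_trans _ _ ((h * c%:R) ^+ 2)).
  rewrite exprMn ler_wpM2l ?sqr_ge0// -natrX ler_nat.
  by case: c {hc} => // c; rewrite expnS expn1 leq_pmulr.
by rewrite -[leRHS]real_normK ?num_real// ler_sqr ?nnegrE// mulr_ge0.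
Qed.

(** With [m j] the measure of the [j]-th level set, pairs with [x] above level [j + 1] and [y] not
    above level [j] contribute at least [h ^+ 2 * m j.+1 / m j] to the energy. So the sum of these
    ratios is bounded, their product telescopes to [m n / m 0], and the inequality of arithmetic and
    geometric means links the two. *)
Lemma measure_level_decay z E b h n : measurable_fun setT z ->
  (energy z <= E%:E)%E -> (mu (level z b) < +oo)%E -> 0 < h -> (0 < n)%N ->
  (mu (level z (b + n%:R * h)) <=
     mu (level z b) * ((E / (h ^+ 2 * n%:R)) ^+ n)%:E)%E.
Proof.
move=> mz zE bfin h0 n0.
pose lev j := level z (b + j%:R * h).
have mlev j : measurable (lev j) by exact: measurable_level.
have levS j k : (j <= k)%N -> lev k `<=` lev j.
  by move=> jk; apply: level_le; rewrite lerD2l ler_wpM2r ?ler_nat// ltW.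
have lev0 : lev 0%N = level z b by rewrite /lev mul0r addr0.
have levfin j : mu (lev j) \is a fin_num.
  rewrite ge0_fin_numE ?measure_ge0//; apply: le_lt_trans bfin.
  by rewrite -lev0; apply: le_lebesgue => //; exact: levS.
pose m j := fine (mu (lev j)).
have mE j : mu (lev j) = (m j)%:E by rewrite /m fineK.
have m_ge0 j : 0 <= m j by rewrite fine_ge0.
have m_le j k : (j <= k)%N -> m k <= m j.
  move=> jk; rewrite -lee_fin -!mE; apply: le_lebesgue => //.
  exact: levS.
have E0 : 0 <= E by rewrite -lee_fin (le_trans (energy_ge0 z)).
rewrite -/(lev n) -lev0 !mE -EFinM lee_fin.
(* Once the last level is not null, no ratio has a zero denominator. *)
have [mn0|mn0] := leP (m n) 0.
  by rewrite (le_trans mn0)// mulr_ge0// exprn_ge0// divr_ge0// mulr_ge0 ?sqr_ge0.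
have mj0 j : (j <= n)%N -> 0 < m j by move=> jn; rewrite (lt_le_trans mn0)// m_le.
have sumE : h ^+ 2 * \sum_(j < n) m j.+1 / m j <= E.
  rewrite -lee_fin; apply: le_trans zE.
  pose F j (p : R * R) : \bar R :=
    (h ^+ 2 * \1_(lev j.+1) p.1 * \1_(~` lev j) p.2 * kern p.1 p.2)%:E.
  have mC j : measurable (~` lev j) by exact: measurableC.
  have mF j : measurable_fun setT (F j).
    apply/measurable_EFinP.
    have ? : measurable_fun setT (fun p : R * R => \1_(lev j.+1) p.1 : R).
      by apply: measurable_comp_fst; exact: measurable_indic.
    have ? : measurable_fun setT (fun p : R * R => \1_(~` lev j) p.2 : R).
      by apply: measurable_comp_snd; exact: measurable_indic.
    by have ? := @measurable_kern R; measure_tac.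
  have F0 j (p : R * R) : (0 <= F j p)%E.
    by rewrite lee_fin mulr_ge0 ?kern_ge0// mulr_ge0// mulr_ge0 ?sqr_ge0.
  apply: (@le_trans _ _ (\int[(mu \x mu)%E]_p (\sum_(j < n) F j p))%E); last first.
    apply: ge0_le_integral => //.
    - by move=> p _; apply: sume_ge0.
    - by apply: emeasurable_sum => j; exact: mF.
    - exact: measurable_energy_integrand.
    move=> [x y] _; rewrite /F/= sumEFin lee_fin -mulr_suml.
    rewrite ler_wpM2r ?kern_ge0//; apply: le_trans (crossing_sqr _ b n _ _ (ltW h0)).
    rewrite natr_sum mulr_sumr; apply: ler_sum => j _.
    rewrite -mulrA ler_wpM2l ?sqr_ge0// !indicE -natrM ler_nat.
    rewrite in_setC /lev /level/crossing.
    rewrite (_ : (x \in _) = (b + j.+1%:R * h < `|z x|)); last first.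
      by apply/idP/idP; rewrite inE.
    rewrite (_ : (y \in _) = (b + j%:R * h < `|z y|)); last first.
      by apply/idP/idP; rewrite inE.
    by rewrite -leNgt mulnb.
  rewrite ge0_integral_sum//; last by move=> j; exact: mF.
  rewrite mulr_sumr -sumEFin; apply: lee_sum => j _.
  apply: (@le_trans _ _ ((m j)^-1%:E *
      \int[mu]_x (h ^+ 2 * \1_(lev j.+1) x)%:E)%E); last first.
    apply: integral_rect_kern_ge => //.
    - by apply: measurable_funM => //; exact: measurable_indic.
    - by move=> x; rewrite mulr_ge0 ?sqr_ge0.
    - by rewrite mE.
    - by apply: mj0; exact: ltnW.
  rewrite integral_scaled_indic ?sqr_ge0// mE -!EFinM lee_fin le_eqVlt.
  by apply/orP; left; apply/eqP; ring.
have prodm k : (k <= n)%N -> m k = m 0%N * \prod_(j < k) (m j.+1 / m j).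
  elim: k => [_|k IH kn]; first by rewrite big_ord0 mulr1.
  rewrite big_ord_recr/= mulrA -IH; last exact: ltnW.
  by rewrite mulrC divfK// gt_eqF// mj0// ltnW.
rewrite (prodm n)// ler_wpM2l//.
have /leif_le := @leif_AGM R 'I_n predT (fun j : 'I_n => m j.+1 / m j)
  (fun (j : 'I_n) _ => divr_ge0 (m_ge0 _) (m_ge0 _)).
rewrite card_ord => /le_trans; apply.
rewrite lerXn2r ?nnegrE//.
- by rewrite divr_ge0// sumr_ge0// => j _; rewrite divr_ge0.
- by rewrite divr_ge0// mulr_ge0 ?sqr_ge0.
have h20 : 0 < h ^+ 2 by rewrite exprn_gt0.
by rewrite invfM mulrA ler_wpM2r ?invr_ge0// ler_pdivlMr// mulrC.
Qed.

(** The number of steps in [measure_level_decay] is free; taken proportional to [i ^ 2], it makes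
    the base of the power constant and the exponent quadratic. *)
Lemma measure_level_gauss b (k : R) : 0 < b -> exists2 E, 0 < E &
  forall z, measurable_fun setT z -> (energy z <= E%:E)%E ->
    (mu (level z b) < +oo)%E ->
    forall i, (mu (level z (i.+1%:R * b)) <=
      mu (level z b) * (expR (- (k * i%:R ^+ 2)))%:E)%E.
Proof.
move=> b0.
have [K kK] : exists K : nat, k <= K.+1%:R.
  exists (Num.truncn `|k|).
  by rewrite (le_trans (ler_norm _))// ltW// truncnS_gt.
(* With [K.+1 * i ^ 2] steps from [b] to [i.+1 * b], the ratio [E / (h ^+ 2 * n)] is
   [E * K.+1 / b ^+ 2]; this [E] makes it [expR (-1)]. *)
exists (b ^+ 2 / (K.+1%:R * expR 1)).
  by rewrite divr_gt0 ?exprn_gt0// mulr_gt0 ?expR_gt0.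
move=> z mz zE bfin [|i].
  by rewrite mul1r expr0n/= mulr0 oppr0 expR0 mule1.
pose n := (K.+1 * i.+1 ^ 2)%N.
have n0 : (0 < n)%N by rewrite muln_gt0 expn_gt0.
pose h := i.+1%:R * b / n%:R.
have h0 : 0 < h by rewrite divr_gt0 ?ltr0n// mulr_gt0.
have nh : b + n%:R * h = i.+2%:R * b.
  rewrite /h mulrC divfK ?pnatr_eq0 -?lt0n// [in RHS]mulrSr; ring.
have := measure_level_decay mz zE bfin h0 n0.
rewrite nh => /le_trans; apply.
rewrite lee_wpmul2l//.
rewrite (_ : _ / (h ^+ 2 * n%:R) = expR (-1)); last first.
  rewrite expRN /h /n natrM natrX; field.
  by rewrite !gt_eqF ?expR_gt0// ?ltr0n// ?addr_gt0//.
rewrite -expRM_natr lee_fin ler_expR mulN1r lerN2 /n natrM natrX.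
by rewrite ler_wpM2r ?sqr_ge0.
Qed.

(** The level set is cut into layers between consecutive multiples of [b]. The bound is proportional
    to the measure of the level set, as truncation requires an estimate that is linear in the part
    cut off. *)
Lemma expR_level_integral beta b : 0 <= beta -> 0 < b ->
  exists2 E, 0 < E & exists2 C, 0 <= C &
  forall z, measurable_fun setT z -> (energy z <= E%:E)%E ->
    (mu (level z b) < +oo)%E ->
    (\int[mu]_(x in level z b) (expR (beta * z x ^+ 2))%:E <=
       C%:E * mu (level z b))%E.
Proof.
move=> beta0 b0; pose k := 5 * (beta * b ^+ 2) + 1.
have [E E0 HE] := measure_level_gauss k b0.
pose C := 2 * expR (4 * (beta * b ^+ 2)).
have C0 : 0 <= C by rewrite mulr_ge0// expR_ge0.
exists E => //; exists C => // z mz zE bfin.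
have mD := measurable_level b mz.
pose lev i := level z (i.+1%:R * b).
have mlev i : measurable (lev i) by exact: measurable_level.
pose c i := expR (beta * (i.+2%:R * b) ^+ 2).
have c0 i : 0 <= c i by exact: expR_ge0.
pose F i x := (c i * \1_(lev i) x)%:E.
have mFT i : measurable_fun setT (F i).
  apply/measurable_EFinP.
  by apply: measurable_funM => //; exact: measurable_indic.
have mF i : measurable_fun (level z b) (F i) by exact: measurable_funTS.
have F0 i x : (0 <= F i x)%E by rewrite lee_fin mulr_ge0.
apply: (@le_trans _ _ (\int[mu]_(x in level z b) (\sum_(i <oo) F i x))%E).
  apply: ge0_le_integral => //.
  - by apply/measurable_EFinP/measurable_funTS; measure_tac.
  - by apply: (ge0_emeasurable_sum (h := F) (P := predT)) => i *; [exact: F0|exact: mF].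
  move=> x bx.
  have exn : exists n, `|z x| <= n%:R * b.
    exists (Num.truncn (`|z x| / b)).+1.
    by rewrite -ler_pdivrMr// ltW// truncnS_gt.
  (* The least such [n] locates the layer of [x]; it is at least 2, whence the [i.+2] in [c]. *)
  case: (ex_minnP exn) => n zn nmin.
  have n1 : (1 < n)%N.
    rewrite ltnNge; apply/negP => n1; move: bx; rewrite /level/=.
    apply/negP; rewrite -leNgt (le_trans zn)// -[leRHS]mul1r ler_wpM2r ?lern1//.
    exact: ltW.
  have zn1 : n.-1%:R * b < `|z x|.
    rewrite ltNge; apply/negP => /nmin; rewrite leqNgt => /negP; apply.
    by rewrite ltn_predL (ltn_trans _ n1).
  case: n => [//|[//|i]] in zn nmin n1 zn1 *.
  apply: (@le_trans _ _ (F i x)); last first.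
    have := @nneseries_lim_ge R (F ^~ x) predT 0%N i.+1 (fun n _ _ => F0 n x).
    apply: le_trans; rewrite big_nat_recr//= leeDr//; apply: sume_ge0 => j _; exact: F0.
  rewrite /F lee_fin indicE mem_set//= mulr1 ler_expR ler_wpM2l//.
  by rewrite -[leLHS]real_normK ?num_real// lerXn2r ?nnegrE// mulr_ge0// ltW.
rewrite integral_nneseries//.
have mfin : mu (level z b) \is a fin_num by rewrite ge0_fin_numE.
rewrite -(fineK mfin) -EFinM; set m := fine _.
have m0 : 0 <= m by rewrite fine_ge0.
apply: (@le_trans _ _ (\sum_(i <oo) (C * m / (2 ^ i.+1)%:R)%:E)%E); last first.
  by apply: epsilon_trick0; rewrite mulr_ge0.
apply: lee_nneseries => [i _ _|i _]; first exact: integral_ge0.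
apply: (@le_trans _ _ (\int[mu]_x F i x)%E).
  apply: ge0_subset_integral => //; exact: mFT.
rewrite integral_scaled_indic//.
apply: (@le_trans _ _ ((c i)%:E * (mu (level z b) * (expR (- (k * i%:R ^+ 2)))%:E))%E).
  by rewrite lee_wpmul2l ?lee_fin// HE.
rewrite -(fineK mfin) -/m -!EFinM lee_fin mulrCA [leRHS]mulrAC mulrC.
rewrite ler_wpM2r// /c -expRD /C expnS natrM invfM mulrACA divff// mul1r.
rewrite ler_pdivlMr ?ltr0n ?expn_gt0//.
apply: (@le_trans _ _ (expR (4 * (beta * b ^+ 2) - i%:R) * expR (i%:R))); last first.
  by rewrite -expRD subrK.
rewrite ler_pM ?expR_ge0// ?ler0n//.
  rewrite ler_expR.
  have bb0 : 0 <= beta * b ^+ 2 by rewrite mulr_ge0 ?sqr_ge0.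
  have i0 : (0 : R) <= i%:R by [].
  have ii : (i%:R : R) <= i%:R ^+ 2.
    by rewrite -natrX ler_nat; case: (i) => // j; rewrite expnS expn1 leq_pmulr.
  rewrite /k -[i.+2]addn2 natrD; nra.
rewrite natrX -[i%:R]mulr1 expRM_natl lerXn2r ?nnegrE ?expR_ge0//.
by rewrite (le_trans _ (expR_ge1Dx _))//; lra.
Qed.

End moser_trudinger.

(** * Truncation at a constant *)

Section primitive.
Context {R : realType}.
Local Notation mu := (@lebesgue_measure R).
Implicit Types (g : R -> R) (p q t L : R).

Lemma continuous_integrable_itv g : continuous g ->
  forall a b, mu.-integrable `[a, b] (EFin \o g).
Proof.
move=> cg a b; apply: continuous_compact_integrable; first exact: segment_compact.
exact: continuous_subspaceT.
Qed.

Let Rintegral_itvD g a b c : (forall a b, mu.-integrable `[a, b] (EFin \o g)) ->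
  a <= b -> b <= c ->
  \int[mu]_(x in `[a, c]) g x =
  \int[mu]_(x in `[a, b]) g x + \int[mu]_(x in `[b, c]) g x.
Proof.
move=> ig ab bc.
have := @Rintegral_itvB R g (BLeft a) (BRight c) b
  (ig a c).
rewrite !bnd_simp => /(_ ab bc) /eqP; rewrite subr_eq addrC => /eqP ->.
congr (_ + _); apply: Rintegral_itv_obnd_cbnd.
apply: (@integrableS _ _ _ mu `[b, c]) => //; exact: subset_itv_oc_cc.
Qed.

Lemma primitive_sub g p q : (forall a b, mu.-integrable `[a, b] (EFin \o g)) -> q <= p ->
  primitive g p - primitive g q = \int[mu]_(x in `[q, p]) g x.
Proof.
move=> cg qp; rewrite /primitive.
have [q0|q0] := leP 0 q.
  by rewrite (le_trans q0 qp) (Rintegral_itvD cg q0 qp) addrC addKr.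
have [p0|p0] := leP 0 p.
  by rewrite opprK (Rintegral_itvD cg (ltW q0) p0) addrC.
by rewrite opprK addrC (Rintegral_itvD cg qp (ltW p0)) addrK.
Qed.

Lemma primitive0 g : primitive g 0 = 0.
Proof. by rewrite /primitive lexx set_itv1 Rintegral_set1. Qed.

(** Stated for locally integrable functions because it serves both [g] and the bounded measurable
    functions that are averaged later. *)
Lemma primitive_lip g p q L : (forall a b, mu.-integrable `[a, b] (EFin \o g)) ->
  (forall t, Num.min p q <= t <= Num.max p q -> `|g t| <= L) ->
  `|primitive g p - primitive g q| <= L * `|p - q|.
Proof.
move=> ig; wlog qp : p q / q <= p => [H gL|].
  have [qp|pq] := leP q p; first exact: H.
  by rewrite distrC [`|p - q|]distrC H// 1?ltW// minC maxC.
rewrite (min_idPr qp) (max_idPl qp) => gL.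
rewrite primitive_sub// [`|p - q|]ger0_norm ?subr_ge0//.
have gi := ig q p.
apply: (le_trans (le_normr_Rintegral _ gi)) => //.
apply: (@le_trans _ _ (\int[mu]_(x in `[q, p]) L)).
  apply: le_Rintegral => //.
  - exact: integrable_norm.
  - by apply: continuous_integrable_itv => x; exact: cvg_cst.
rewrite Rintegral_cst//= lebesgue_measure_itv/= lte_fin.
by move: qp; rewrite le_eqVlt => /predU1P[->|->//]; rewrite ltxx/= subrr.
Qed.

Lemma bounded_on_itv g a b : continuous g -> exists2 M, 0 <= M &
  forall t, a <= t <= b -> `|g t| <= M.
Proof.
move=> cg; have [ab|ba] := leP a b; last first.
  by exists 0 => // t /andP[at_ tb]; move: (le_trans at_ tb); rewrite leNgt ba.
have cn : {within `[a, b], continuous (fun t => `|g t|)}.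
  apply: continuous_subspaceT => t.
  exact: continuous_comp (cg t) (@norm_continuous _ _ _).
have [c _ cmax] := EVT_max ab cn.
by exists `|g c| => // t tab; apply: cmax; rewrite in_itv.
Qed.

Lemma continuous_primitive g : continuous g -> continuous (primitive g).
Proof.
move=> cg p.
have [M M0 gM] := @bounded_on_itv g (p - 1) (p + 1) cg.
apply/cvgrPdist_le => e e0; near=> t.
have : `|p - t| < 1 by near: t; exact: (@nbhsx_ballx R R p 1 ltr01).
rewrite ltr_norml => /andP[t1 t2].
apply: le_trans (primitive_lip (continuous_integrable_itv cg) (L := M) _) _.
  move=> s /andP[s1 s2]; apply: gM; apply/andP; split.
    rewrite (le_trans _ s1)// le_min; apply/andP; split; lra.
  rewrite (le_trans s2)// ge_max; apply/andP; split; lra.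
apply: (@le_trans _ _ ((M + 1) * `|p - t|)).
  by rewrite ler_wpM2r// lerDl.
rewrite mulrC -ler_pdivlMr; last lra.
near: t; apply: cvgr_dist_le; first exact: cvg_id.
by rewrite divr_gt0//; lra.
Unshelve. all: end_near. Qed.

(** Either condition gives an exponent at which the ratio tends to 0: 1 in the subcritical case,
    [alpha0 + 1] in the critical one. Compactness handles the bounded range of [t]. *)
Lemma growth_bound g : continuous g -> subcritical g \/ critical g ->
  exists2 alpha, 0 < alpha & exists2 M, 0 <= M &
  forall t, `|g t| <= M * expR (alpha * t ^+ 2).
Proof.
move=> cg H.
have [alpha a0 gr] : exists2 alpha, 0 < alpha &
    growth_ratio g alpha @ abs_infty R --> 0.
  case: H => [sub|[a0 a0_gt0 /(_ (a0 + 1))[_ gr]]].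
    by exists 1 => //; exact: sub.
  by exists (a0 + 1); [lra|apply: gr; lra].
exists alpha => //.
move/cvgrPdist_le : gr => /(_ 1 ltr01)[T _ HT].
have [M M0 gM] := @bounded_on_itv g (- T) T cg.
exists (M + 1); first lra.
move=> t; have e1 : 1 <= expR (alpha * t ^+ 2).
  by rewrite -expR0 ler_expR mulr_ge0 ?sqr_ge0// ltW.
have [tT|tT] := leP `|t| T.
  rewrite (@le_trans _ _ M)//; first by apply: gM; rewrite -ler_norml.
  by rewrite (@le_trans _ _ (M + 1))//; [lra|rewrite ler_peMr//; lra].
have := HT t tT; rewrite /= sub0r normrN ger0_norm /growth_ratio; last first.
  by rewrite divr_ge0 ?expR_ge0.
rewrite ler_pdivrMr ?expR_gt0// => /le_trans; apply.
by rewrite ler_wpM2r ?expR_ge0//; lra.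
Qed.

End primitive.

(** * Clamping and the energy it releases *)

Section clamp.
Context {R : realType}.
Local Notation mu := (@lebesgue_measure R).
Implicit Types (c d r q s t a : R) (z w g : R -> R).

Definition clamp c r : R := Num.max (- c) (Num.min r c).

Lemma clampP c r : 0 <= c ->
  [\/ r < - c /\ clamp c r = - c, - c <= r <= c /\ clamp c r = r |
      c < r /\ clamp c r = c].
Proof.
move=> c0; rewrite /clamp; have [rc|cr] := leP r c.
- have [cr|cr] := leP (- c) r; first by constructor 2.
  by constructor 1.
- constructor 3; split => //; apply/max_idPr; lra.
Qed.

Lemma clamp_bound c r : 0 <= c -> `|clamp c r| <= c.
Proof. by move=> c0; have [] := clampP r c0 => -[? ->]; rewrite ler_norml; lra. Qed.

Lemma clamp_norm_le c r : 0 <= c -> `|clamp c r| <= `|r|.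
Proof.
move=> c0; have [] := clampP r c0 => -[H ->]//.
- by rewrite normrN [leLHS]ger0_norm// ltr0_norm; lra.
- by rewrite !ger0_norm; lra.
Qed.

Lemma clamp_lip c r q : 0 <= c -> `|clamp c r - clamp c q| <= `|r - q|.
Proof.
move=> c0; have := ler_norm (r - q); have := lerNnormlW (lexx `|r - q|).
set n := `|r - q|; rewrite ler_norml => n1 n2.
have [] := clampP r c0 => -[rc ->]; have [] := clampP q c0 => -[qc ->];
  by apply/andP; split; lra.
Qed.

Lemma soft_lip c r q : 0 <= c ->
  `|(r - clamp c r) - (q - clamp c q)| <= `|r - q|.
Proof.
move=> c0; have := ler_norm (r - q); have := lerNnormlW (lexx `|r - q|).
set n := `|r - q|; rewrite ler_norml => n1 n2.
have [] := clampP r c0 => -[rc ->]; have [] := clampP q c0 => -[qc ->];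
  by apply/andP; split; lra.
Qed.

Lemma soft_norm_le c r : 0 <= c -> `|r - clamp c r| <= `|r|.
Proof.
move=> c0; have [] := clampP r c0 => -[H ->].
- by rewrite !ltr0_norm; lra.
- by rewrite subrr normr0.
- by rewrite !gtr0_norm; lra.
Qed.

Lemma measurable_clamp z w : measurable_fun setT z -> measurable_fun setT w ->
  measurable_fun setT (fun x => clamp (w x) (z x)).
Proof. by move=> mz mw; rewrite /clamp; measure_tac. Qed.

(* Truncating by barriers [c] at one point and [d] at another: the truncated
   part [r - clamp c r] is nonzero only where the barrier is attained. *)
Lemma clamp_pair c d r q : 0 <= c -> 0 <= d ->
  (clamp c r - clamp d q) ^+ 2 +
    2 * ((c - d) * `|r - clamp c r| + (d - c) * `|q - clamp d q|)
  <= (r - q) ^+ 2.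
Proof.
move=> c0 d0; have [] := clampP r c0 => -[rc ->];
  have [] := clampP q d0 => -[qd ->];
  rewrite ?subrr ?normr0 ?mulr0 ?addr0 ?add0r;
  rewrite ?(ltr0_norm (_ : r - - c < 0)) ?(ltr0_norm (_ : q - - d < 0))
    ?(gtr0_norm (_ : 0 < r - c)) ?(gtr0_norm (_ : 0 < q - d));
  have := sqr_ge0 ((r + c) - (q + d)); have := sqr_ge0 ((r - c) - (q - d)); nra.
Qed.

(** For [r > s] the difference of squares is [(r - s) * (r + s - 2 * q)], and [2 * q <= s] keeps the
    second factor above [s]. *)
Lemma clamp_pair_half s r q : 0 <= s -> `|q| <= s / 2 ->
  (clamp s r - q) ^+ 2 + s * `|r - clamp s r| <= (r - q) ^+ 2.
Proof.
move=> s0; rewrite ler_norml => /andP[q1 q2].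
have [] := clampP r s0 => -[rs ->].
- rewrite ltr0_norm; nra.
- by rewrite subrr normr0 mulr0 addr0.
- rewrite gtr0_norm; nra.
Qed.

(** Each point with [|z| > s] is paired with the points where [|z| <= s / 2], which fill the line up
    to measure [a]. For the other pairs it is enough that [clamp] is a contraction. *)
Lemma energy_clamp_le z s a : measurable_fun setT z -> 0 <= s -> 0 < a ->
  (mu (level z (s / 2)) <= a%:E)%E ->
  (energy (clamp s \o z) +
     (s / a)%:E * \int[mu]_x (`|z x - clamp s (z x)|)%:E <= energy z)%E.
Proof.
move=> mz s0 a0 mua.
have mw : measurable_fun setT (clamp s \o z).
  by apply: (@measurable_clamp z (fun=> s)).
pose v x := `|z x - clamp s (z x)|.
have mv : measurable_fun setT v by rewrite /v; measure_tac.
have v0 x : 0 <= v x by rewrite /v.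
set A := level z (s / 2).
have mA : measurable A by exact: measurable_level.
have mC : measurable (~` A) by exact: measurableC.
have m1 : measurable_fun setT (\1_(~` A) : R -> R) by exact: measurable_indic.
have mF : measurable_fun setT
    (fun p : R * R => (s * v p.1 * \1_(~` A) p.2 * kern p.1 p.2)%:E).
  apply/measurable_EFinP; have ? := measurable_comp_fst mv.
  have ? := measurable_comp_snd m1; have ? := @measurable_kern R.
  by measure_tac.
have F0 (p : R * R) : (0 <= (s * v p.1 * \1_(~` A) p.2 * kern p.1 p.2)%:E)%E.
  by rewrite lee_fin mulr_ge0 ?kern_ge0// mulr_ge0// mulr_ge0.
apply: (@le_trans _ _ (energy (clamp s \o z) + \int[(mu \x mu)%E]_p
    (s * v p.1 * \1_(~` A) p.2 * kern p.1 p.2)%:E)%E).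
  rewrite leeD2l//.
  apply: le_trans (integral_rect_kern_ge (f := fun x => s * v x) _ _ mA mua a0).
  - by rewrite integral_scaled// muleA -EFinM mulrC.
  - by apply: measurable_funM.
  - by move=> x; rewrite mulr_ge0.
rewrite -ge0_integralD//; last 2 first.
- by move=> p _; rewrite lee_fin mulr_ge0 ?sqr_ge0 ?kern_ge0.
- exact: measurable_energy_integrand.
apply: ge0_le_integral => //.
- by move=> p _; rewrite adde_ge0// lee_fin mulr_ge0 ?sqr_ge0 ?kern_ge0.
- by apply: emeasurable_funD => //; exact: measurable_energy_integrand.
- exact: measurable_energy_integrand.
move=> [x y] _ /=; rewrite -EFinD lee_fin -mulrDl ler_wpM2r ?kern_ge0//.
rewrite indicE; have [|yA] := boolP (y \in ~` A).
  rewrite inE /A /level/= => /negP; rewrite -leNgt mulr1 => ys.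
  have -> : clamp s (z y) = z y.
    have [] := clampP (z y) s0 => -[] //; move: ys; rewrite ler_norml; lra.
  exact: clamp_pair_half.
rewrite mulr0 addr0 -[leLHS]real_normK ?num_real// -[leRHS]real_normK ?num_real//.
by rewrite ler_sqr ?nnegrE//; exact: clamp_lip.
Qed.

End clamp.

Section constant_truncation.
Context {R : realType}.
Local Notation mu := (@lebesgue_measure R).
Implicit Types (z w g : R -> R) (s alpha M C I : R).

Let muI01 : (mu (`[0%R, 1%R]%classic : set R) < +oo)%E.
Proof. by rewrite lebesgue_measure_itv/= lte_fin ltr01 -EFinB ltry. Qed.

Lemma measurable_primitive_comp g w : continuous g -> measurable_fun setT w ->
  measurable_fun setT (fun x => primitive g (w x)).
Proof.
move=> cg mw; have cG := continuous_primitive cg.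
exact: (measurableT_comp (continuous_measurable_fun cG) mw).
Qed.

Lemma integrable_primitive_bounded g w C : continuous g ->
  measurable_fun setT w -> (forall x, `|w x| <= C) ->
  mu.-integrable `[0, 1] (EFin \o (fun x => primitive g (w x))).
Proof.
move=> cg mw wC; apply: measurable_bounded_integrable => //.
  by apply: measurable_funTS; exact: measurable_primitive_comp.
have [M M0 HM] := bounded_on_itv (- C) C (continuous_primitive cg).
exists M; split; first exact: num_real.
move=> N MN x _; rewrite /= (le_trans _ (ltW MN))// HM//.
by rewrite -ler_norml.
Qed.

Lemma le_Phi g w z C I : continuous g ->
  measurable_fun setT w -> measurable_fun setT z -> (forall x, `|w x| <= C) ->
  (energy z < +oo)%E ->
  (\int[mu]_(x in `[0%R, 1%R])
     (`|primitive g (z x) - primitive g (w x)|)%:E <= I%:E)%E ->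
  (energy w + (2 * I)%:E <= energy z)%E ->
  Phi g w <= Phi g z.
Proof.
move=> cg mw mz wC ez ID ewz.
have I0 : 0 <= I by rewrite -lee_fin (le_trans _ ID)// integral_ge0.
have ew : (energy w < +oo)%E.
  by apply: le_lt_trans ez; apply: le_trans ewz; rewrite leeDl// lee_fin mulr_ge0.
have iw := integrable_primitive_bounded cg mw wC.
set Gz := fun x => primitive g (z x); set Gw := fun x => primitive g (w x).
have mD : measurable_fun setT (fun x => Gz x - Gw x).
  by apply: measurable_funB; exact: measurable_primitive_comp.
have iD : mu.-integrable `[0, 1] (EFin \o (fun x => Gz x - Gw x)).
  apply/integrableP; split; first exact/measurable_EFinP/measurable_funTS.
  by apply: le_lt_trans ID _; rewrite ltry.
(* Integrability of [Gz] is not given, and without it the real-valued integral carries no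
   information; it follows from the bounded [Gw] and the integrable difference. *)
have iz : mu.-integrable `[0, 1] (EFin \o Gz).
  have : mu.-integrable `[0, 1] ((EFin \o (fun x => Gz x - Gw x)) \+ (EFin \o Gw)).
    exact: integrableD.
  apply: eq_integrable => // x _ /=.
  by rewrite -EFinD subrK.
have D_le : \int[mu]_(x in `[0, 1]) Gz x - \int[mu]_(x in `[0, 1]) Gw x <= I.
  rewrite -RintegralB// (le_trans (ler_norm _))//.
  rewrite (le_trans (le_normr_Rintegral _ iD))//.
  have := ID; rewrite -(@fineK _ (\int[mu]_(x in `[0%R, 1%R]) _)%E) ?lee_fin//.
  rewrite ge0_fin_numE ?integral_ge0//.
  by apply: le_lt_trans ID _; rewrite ltry.
have {}ewz : normX w ^+ 2 + 2 * I <= normX z ^+ 2.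
  by rewrite -lee_fin EFinD -(energy_normX ew) -(energy_normX ez).
rewrite /Phi -/Gz -/Gw.
move: (normX w ^+ 2) (normX z ^+ 2) ewz D_le => nw nz.
move: (\int[mu]_(x in _) Gz x) (\int[mu]_(x in _) Gw x) => a b; lra.
Qed.

Lemma Phi_cst0 g : Phi g (fun=> 0) = 0.
Proof.
rewrite /Phi; under eq_Rintegral do rewrite primitive0.
rewrite Rintegral_cst// mul0r subr0.
have -> : normX (fun=> 0 : R) = 0.
  rewrite /normX /innerX /Rintegral gagliardo_energy /energy.
  under eq_integral do rewrite subr0 expr0n/= mul0r.
  by rewrite integral0/= sqrtr0.
by rewrite expr0n/= mulr0.
Qed.

(** Where [|z| <= 2 * s] the exponential is bounded. Elsewhere the part cut off is at least [s], so
    the measure of that set is at most [s^-1] times the integral of this part; raising the exponent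
    by 1 absorbs the factor [|z|]. *)
Let integral_expR_tail s alpha : 0 < s -> 0 <= alpha ->
  exists2 E, 0 < E & exists2 L, 0 <= L &
  forall z, measurable_fun setT z -> (energy z <= E%:E)%E ->
    (mu (level z 0) < +oo)%E ->
    (\int[mu]_x (`|z x - clamp s (z x)| * expR (alpha * z x ^+ 2))%:E <=
     L%:E * \int[mu]_x (`|z x - clamp s (z x)|)%:E)%E.
Proof.
move=> s0 alpha0.
have [||E E0 [C C0 HE]] := @expR_level_integral R (alpha + 1) (2 * s).
- lra.
- lra.
exists E => //; pose L1 := expR (alpha * (2 * s) ^+ 2).
have L10 : 0 <= L1 by exact: expR_ge0.
exists (L1 + C / s); first by rewrite addr_ge0// divr_ge0// ltW.
move=> z mz zE z0fin.
set v := fun x => `|z x - clamp s (z x)|.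
have mw : measurable_fun setT (fun x => clamp s (z x)).
  by apply: (@measurable_clamp _ z (fun=> s)).
have mv : measurable_fun setT v by rewrite /v; measure_tac.
have v0 x : 0 <= v x by rewrite /v.
pose B := level z (2 * s).
have mB : measurable B by exact: measurable_level.
have Bfin : (mu B < +oo)%E.
  apply: le_lt_trans z0fin; apply: le_lebesgue => //; first exact: measurable_level.
  by apply: level_le; lra.
have vB x : B x -> s <= v x.
  rewrite /B /level/= /v => zB; have [] := clampP (z x) (ltW s0) => -[H ->].
  - by move: zB; rewrite ltr0_norm; [rewrite ltr0_norm; lra|lra].
  - by move: zB H; rewrite -ler_norml; lra.
  - by move: zB; rewrite gtr0_norm; [rewrite gtr0_norm; lra|lra].
have sB : (s%:E * mu B <= \int[mu]_x (v x)%:E)%E.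
  rewrite -integral_scaled_indic ?(ltW s0)//; apply: ge0_le_integral => //.
  - by move=> x _; rewrite lee_fin mulr_ge0// ltW.
  - by apply/measurable_EFinP/measurable_funM => //; exact: measurable_indic.
  - exact/measurable_EFinP.
  move=> x _; rewrite lee_fin indicE.
  by have [/set_mem/vB|_] := boolP (x \in B); rewrite ?mulr1// mulr0.
have mexp c : measurable_fun setT (fun x => expR (c * z x ^+ 2)).
  by measure_tac.
have m1 : measurable_fun setT (\1_B : R -> R) by exact: measurable_indic.
apply: (@le_trans _ _ (\int[mu]_x
    ((L1 * v x)%:E + (expR ((alpha + 1) * z x ^+ 2) * \1_B x)%:E))%E).
  apply: ge0_le_integral => //.
  - by apply/measurable_EFinP; apply: measurable_funM => //; exact: mexp.
  - apply: emeasurable_funD; apply/measurable_EFinP; apply: measurable_funM => //.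
    exact: mexp.
  move=> x _; rewrite -EFinD lee_fin indicE.
  have [/set_mem xB|xB] := boolP (x \in B).
    rewrite mulr1 (le_trans _ (_ : expR ((alpha + 1) * z x ^+ 2) <= _))//; last first.
      by rewrite lerDr mulr_ge0.
    rewrite mulrDl mul1r expRD mulrC ler_wpM2l ?expR_ge0//.
    rewrite (le_trans (soft_norm_le _ (ltW s0)))//.
    rewrite (le_trans _ (expR_ge1Dx _))// -[z x ^+ 2]real_normK ?num_real//.
    have := normr_ge0 (z x); have := sqr_ge0 (`|z x| - 1); nra.
  rewrite mulr0 addr0 mulrC ler_wpM2r// ler_expR ler_wpM2l//.
  move: xB; rewrite notin_setE /B /level/= => /negP; rewrite -leNgt => zs.
  by rewrite -[leLHS]real_normK ?num_real// lerXn2r ?nnegrE//; lra.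
rewrite ge0_integralD//=; try
  by apply/measurable_EFinP; apply: measurable_funM => //; exact: mexp.
have HB : (\int[mu]_x (expR ((alpha + 1) * z x ^+ 2) * \1_B x)%:E <=
    C%:E * mu B)%E.
  apply: le_trans (HE z mz zE Bfin); rewrite [in leRHS]integral_mkcond.
  rewrite le_eqVlt; apply/orP; left; apply/eqP; apply: eq_integral => x _.
  by rewrite patchE indicE /B; case: ifPn => _; rewrite ?mulr1 ?mulr0.
rewrite integral_scaled// EFinD ge0_muleDl ?lee_fin ?divr_ge0 ?(ltW s0)//.
rewrite leeD2l//; apply: le_trans HB _.
rewrite EFinM -muleA lee_wpmul2l ?lee_fin//.
rewrite -[leLHS]mul1e -(mulVf (lt0r_neq0 s0)) EFinM -muleA lee_wpmul2l//.
  by rewrite lee_fin invr_ge0 ltW.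
by move=> x _; rewrite lee_fin mulr_ge0.
Qed.

Theorem constant_truncation g s : continuous g -> subcritical g \/ critical g ->
  0 < s -> exists2 E, 0 < E &
  forall z, measurable_fun setT z ->
    {ae mu, forall x, ~ `]0, 1[%classic x -> z x = 0} ->
    (energy z <= E%:E)%E -> Phi g (clamp s \o z) <= Phi g z.
Proof.
move=> cg grow s0; have [alpha a0 [M M0 gM]] := growth_bound cg grow.
have [E E0 [L L0 HE]] := integral_expR_tail s0 (ltW a0).
pose Lam := M * L; have Lam0 : 0 <= Lam by rewrite mulr_ge0.
(* [L] was obtained before [a], so [a] can be chosen to make the gain [s / a] exceed [2 * Lam]. The
   second term of the minimum below then bounds the measure of [|z| > s / 2] by [a], through
   Chebyshev's inequality. *)
pose a := s / (2 * Lam + 1); have a_gt0 : 0 < a by rewrite divr_gt0//; lra.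
exists (Num.min E (a * (s / 2) ^+ 2)).
  by rewrite lt_min E0 mulr_gt0// exprn_gt0//; lra.
move=> z mz z0; rewrite EFin_min le_min => /andP[zE zs].
have z0fin : (mu (level z 0) < +oo)%E.
  by apply: le_lt_trans (level0_le1 mz z0) _; rewrite ltry.
have mua : (mu (level z (s / 2)) <= a%:E)%E.
  have s20 : 0 < (s / 2) ^+ 2 by rewrite exprn_gt0//; lra.
  rewrite -(mulKf (lt0r_neq0 s20) a) EFinM lee_pdivlMl// [_ * a]mulrC.
    by apply: le_trans zs; apply: chebyshev_energy => //; lra.
have mw : measurable_fun setT (clamp s \o z).
  by apply: (@measurable_clamp _ z (fun=> s)).
have ener := energy_clamp_le mz (ltW s0) a_gt0 mua.
have ezfin : (energy z < +oo)%E by apply: le_lt_trans zE _; rewrite ltry.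
set V := (\int[mu]_x (`|z x - clamp s (z x)|)%:E)%E in ener.
have V0 : (0 <= V)%E by apply: integral_ge0.
have saE : s / a = 2 * Lam + 1.
  by rewrite /a; field; rewrite !gt_eqF//; lra.
(* An infinite [V] would force infinite energy through [ener]. *)
have Vfin : V \is a fin_num.
  rewrite ge0_fin_numE//.
  have : ((s / a)%:E * V < +oo)%E.
    apply: le_lt_trans ezfin; apply: le_trans ener; rewrite leeDr//.
    exact: energy_ge0.
  rewrite saE; case: (V) V0 => [r _ _|_|] //; first by rewrite ltry.
  by rewrite gt0_muley => [//|]; rewrite lte_fin; lra.
apply: (@le_Phi g (clamp s \o z) z s (Lam * fine V)) => //.
- by move=> x; exact/clamp_bound/ltW.
- apply: (@le_trans _ _ (\int[mu]_x
    (M * (`|z x - clamp s (z x)| * expR (alpha * z x ^+ 2)))%:E)%E).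
    rewrite integral_mkcond; apply: ge0_le_integral => //.
    + by move=> x _; rewrite patchE; case: ifPn.
    + apply/(measurable_restrictT _ (measurable_itv _))/measurable_funTS.
      apply/measurable_EFinP/(measurableT_comp (@normr_measurable _ setT)).
      by apply: measurable_funB; exact: measurable_primitive_comp.
    + by apply/measurable_EFinP; measure_tac.
    move=> x _; rewrite patchE; case: ifPn => _; last first.
      by rewrite lee_fin mulr_ge0// mulr_ge0 ?expR_ge0.
    rewrite lee_fin /= [X in M * X]mulrC mulrA.
    apply: (primitive_lip (continuous_integrable_itv cg)) => // t tz.
    rewrite (le_trans (gM t))// ler_wpM2l// ler_expR ler_wpM2l ?(ltW a0)//.
    rewrite -[leLHS]real_normK ?num_real// -[leRHS]real_normK ?num_real//.
    rewrite lerXn2r ?nnegrE//.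
    have := clamp_norm_le (z x) (ltW s0); move: tz.
    rewrite !ler_norml ge_min le_max => /andP[/orP t1 /orP t2] /andP[w1 w2].
    have := ler_norm (z x); have := ler_norm (- z x); rewrite normrN => ? ?.
    by apply/andP; split; [case: t1|case: t2]; lra.
  rewrite integral_scaled//; last by measure_tac.
  rewrite EFinM fineK// /Lam EFinM -muleA lee_wpmul2l ?lee_fin//.
  exact: HE.
apply: le_trans ener; rewrite leeD2l// saE -(fineK Vfin) -EFinM lee_fin.
have := fine_ge0 V0; nra.
Qed.

End constant_truncation.

(** * A supersolution of the half-Laplacian *)

Section ftc.
Context {R : realType}.
Local Notation mu := (@lebesgue_measure R).
Implicit Types (f g F : R -> R) (a b c s t x y : R).

Lemma FTC_segment f F a b : a <= b ->
  (forall y, a <= y <= b -> {for y, continuous f}) ->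
  (forall y, a <= y <= b -> {for y, continuous F}) ->
  (forall y, a < y < b -> is_derive y 1 F (f y)) ->
  (\int[mu]_(y in `[a, b]) (f y)%:E = (F b - F a)%:E)%E.
Proof.
rewrite le_eqVlt => /predU1P[-> _ _ _|ab cf cF dF].
  by rewrite set_itv1 integral_set1 subrr.
rewrite (@continuous_FTC2 _ f F)// ?EFinB//.
- apply: continuous_in_subspaceT => y /set_mem/=; rewrite in_itv/=; exact: cf.
- split.
  + by move=> y; rewrite in_itv/= => /dF[].
  + by apply/cvg_at_right_filter/cF; rewrite lexx ltW.
  + by apply/cvg_at_left_filter/cF; rewrite lexx ltW.
- by move=> y; rewrite in_itv/= => /dF dFy; rewrite derive1E derive_val.
Qed.

(** These rules are stated for pointwise expressions, so that the derivative of an explicit formula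
    is assembled as a term and a field identity is all that remains. *)
Lemma is_deriveD_fun f g x a b : is_derive x 1 f a -> is_derive x 1 g b ->
  is_derive x 1 (fun y => f y + g y) (a + b).
Proof. exact: is_deriveD. Qed.

Lemma is_deriveB_fun f g x a b : is_derive x 1 f a -> is_derive x 1 g b ->
  is_derive x 1 (fun y => f y - g y) (a - b).
Proof. exact: is_deriveB. Qed.

Lemma is_deriveZ_fun c f x a : is_derive x 1 f a ->
  is_derive x 1 (fun y => c * f y) (c * a).
Proof. exact: is_deriveZ. Qed.

Lemma is_deriveM_fun f g x a b : is_derive x 1 f a -> is_derive x 1 g b ->
  is_derive x 1 (fun y => f y * g y) (f x * b + g x * a).
Proof. exact: is_deriveM. Qed.

Lemma is_deriveV_fun f x a : f x != 0 -> is_derive x 1 f a ->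
  is_derive x 1 (fun y => (f y)^-1) (- a / f x ^+ 2).
Proof.
move=> fx df; apply: is_derive_eq (is_deriveV fx df) _.
by rewrite /GRing.scale/= mulNr mulrC mulNr.
Qed.

Lemma is_derive_comp_fun f g x a b :
  is_derive (g x) 1 f a -> is_derive x 1 g b ->
  is_derive x 1 (fun y => f (g y)) (a * b).
Proof. exact: is_derive1_comp. Qed.

Lemma is_derive_continuous F x a : is_derive x 1 F a -> {for x, continuous F}.
Proof. by case=> dF _; exact/differentiable_continuous/derivable1_diffP. Qed.

Lemma continuous_kernr x y : x != y -> {for y, continuous (kern x)}.
Proof.
move=> xy; rewrite /kern.
apply: continuous_comp; last first.
  by apply: inv_continuous; rewrite sqrf_eq0 normr_eq0 subr_eq0.
apply: continuous_comp (@exprn_continuous _ 2 _).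
apply: continuous_comp (@norm_continuous _ _ _).
by apply: cvgB; [exact: cvg_cst|exact: cvg_id].
Qed.

Lemma integral_kern_itv x a b : a <= b -> b < x \/ x < a ->
  (\int[mu]_(y in `[a, b]) (kern x y)%:E =
   ((a - x)^-1 - (b - x)^-1)%:E)%E.
Proof.
move=> ab xab; have yx y : a <= y <= b -> y - x != 0.
  by move=> /andP[ay yb]; rewrite subr_eq0; apply/eqP => yx; case: xab; lra.
have dx y : a <= y <= b -> is_derive y 1 (fun y => - (y - x)^-1) (kern x y).
  move=> /yx yx0; rewrite /kern real_normK ?num_real// -sqrrN opprB.
  have d1 : is_derive y 1 (fun y => y - x) (1 - 0).
    exact: is_deriveB_fun (is_derive_id _ _) (is_derive_cst _ _ _).
  apply: is_derive_eq (is_deriveN (is_deriveV_fun _ d1)) _ => //.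
  by rewrite subr0 mulNr opprK mul1r.
transitivity ((- (b - x)^-1 - (- (a - x)^-1))%:E); last by congr EFin; lra.
apply: (@FTC_segment (kern x) (fun y => - (y - x)^-1)) => //.
- by move=> y /yx yx0; apply: continuous_kernr; rewrite eq_sym -subr_eq0.
- by move=> y /dx; exact: is_derive_continuous.
- by move=> y /andP[ay yb]; apply: dx; rewrite !ltW.
Qed.

End ftc.

(** * The odds coordinate and an explicit antiderivative *)

Section odds.
Context {R : realType}.
Local Notation mu := (@lebesgue_measure R).
Implicit Types (a b s t x y : R).

(** As a coordinate on [[0, 1[], with inverse [t |-> t ^+ 2 / (1 + t ^+ 2)], it makes the kernel
    rational. *)
Definition odds y : R := Num.sqrt (y / (1 - y)).

Lemma odds_ge0 y : 0 <= odds y.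
Proof. exact: sqrtr_ge0. Qed.

Lemma odds_sqr y : 0 <= y < 1 -> odds y ^+ 2 = y / (1 - y).
Proof. by move=> /andP[y0 y1]; rewrite sqr_sqrtr// divr_ge0//; lra. Qed.

Lemma odds_gt0 y : 0 < y < 1 -> 0 < odds y.
Proof. by move=> /andP[y0 y1]; rewrite sqrtr_gt0 divr_gt0//; lra. Qed.

Lemma onem_odds y : 0 <= y < 1 -> 1 - y = (1 + odds y ^+ 2)^-1.
Proof.
move=> y01; rewrite odds_sqr//; move: y01 => /andP[y0 y1].
have ? : 1 - y != 0 by rewrite subr_eq0 eq_sym lt_eqF.
by rewrite (_ : 1 + y / (1 - y) = (1 - y)^-1) ?invrK//; field.
Qed.

Lemma oddsK y : 0 <= y < 1 -> y = odds y ^+ 2 / (1 + odds y ^+ 2).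
Proof.
move=> y01; rewrite -onem_odds// odds_sqr// divfK//.
by move: y01 => /andP[y0 y1]; rewrite subr_eq0 eq_sym lt_eqF.
Qed.

Lemma odds_le x y : 0 <= x < 1 -> 0 <= y < 1 -> (odds x <= odds y) = (x <= y).
Proof.
move=> x01 y01; rewrite -ler_sqr ?nnegrE ?odds_ge0// !odds_sqr//.
move: x01 y01 => /andP[x0 x1] /andP[y0 y1].
rewrite ler_pdivrMr; last lra.
rewrite mulrAC ler_pdivlMr; last lra.
by apply/idP/idP; lra.
Qed.

Lemma continuous_odds y : y < 1 -> {for y, continuous odds}.
Proof.
move=> y1; apply: continuous_comp (@sqrt_continuous R _).
apply: cvgM; first exact: cvg_id.
apply: cvgV; first by rewrite subr_eq0 eq_sym lt_eqF.
by apply: cvgB; [exact: cvg_cst|exact: cvg_id].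
Qed.

Lemma is_derive_odds y : 0 < y < 1 ->
  is_derive y 1 odds ((1 + odds y ^+ 2) ^+ 2 / (2 * odds y)).
Proof.
move=> y01; have o0 := odds_gt0 y01.
have y01' : 0 <= y < 1 by move: y01 => /andP[/ltW -> ->].
have y1 : 1 - y != 0 by move: y01 => /andP[_ y1]; rewrite subr_eq0 eq_sym lt_eqF.
have d1 : is_derive y 1 (fun y => 1 - y) (0 - 1).
  exact: is_deriveB_fun (is_derive_cst _ _ _) (is_derive_id _ _).
have d2 := is_deriveM_fun (is_derive_id y 1) (is_deriveV_fun (f := fun y => 1 - y) y1 d1).
have p0 : 0 < y / (1 - y) by move: o0; rewrite sqrtr_gt0.
have := is_derive_comp_fun (g := fun y => y / (1 - y)) (is_derive1_sqrt p0) d2.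
move=> /is_derive_eq; apply; rewrite -/(odds y) /GRing.scale/=.
rewrite -[(1 + odds y ^+ 2)]invrK -onem_odds//.
by field; rewrite y1 gt_eqF.
Qed.

(* With [s] and [t] the values of [odds] at [x] and [y], the kernel times [s - t]
   is a rational function of [t]; the square in the logarithm stands for an
   absolute value. *)
Definition odds_primitive s t : R :=
  4^-1 * ln (((s + t) / (s - t)) ^+ 2) + s / (s + t).

Lemma is_derive_odds_primitive s t : 0 < s -> 0 <= t -> s != t ->
  is_derive t 1 (odds_primitive s) (2 * s * t / ((s - t) * (s + t) ^+ 2)).
Proof.
move=> s0 t0 st; have st0 : s - t != 0 by rewrite subr_eq0.
have stp : s + t != 0 by rewrite gt_eqF//; lra.
have dD : is_derive t 1 (fun t => s + t) (0 + 1).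
  exact: is_deriveD_fun (is_derive_cst _ _ _) (is_derive_id _ _).
have dB : is_derive t 1 (fun t => s - t) (0 - 1).
  exact: is_deriveB_fun (is_derive_cst _ _ _) (is_derive_id _ _).
have dq := is_deriveM_fun dD (is_deriveV_fun (f := fun t => s - t) st0 dB).
have dq2 := is_deriveM_fun dq dq.
have q0 : 0 < (s + t) / (s - t) * ((s + t) / (s - t)).
  by rewrite -expr2 exprn_even_gt0//= mulf_neq0// invr_neq0.
have dln := is_derive_comp_fun
  (g := fun t => (s + t) / (s - t) * ((s + t) / (s - t))) (is_derive1_ln q0) dq2.
have := is_deriveD_fun (is_deriveZ_fun 4^-1 dln)
  (is_deriveZ_fun s (is_deriveV_fun (f := fun t => s + t) stp dD)).
move=> /is_derive_eq; apply; rewrite /GRing.scale/=.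
by field; rewrite st0 stp.
Qed.

(** In odds, [x - y] is [(s - t) * (s + t)] over [(1 + s ^+ 2) * (1 + t ^+ 2)], and the derivative
    of [y] in [t] is [2 * t / (1 + t ^+ 2) ^+ 2]. The powers of [1 + t ^+ 2] cancel, leaving the
    derivative of [odds_primitive] times a factor depending on [s] alone. *)
Lemma is_derive_odds_comp x y : 0 < x < 1 -> 0 < y < 1 -> y != x ->
  is_derive y 1
    (fun y => (1 + odds x ^+ 2) ^+ 2 / odds x * odds_primitive (odds x) (odds y))
    ((odds x - odds y) * kern x y).
Proof.
move=> x01 y01 yx; have s0 := odds_gt0 x01; have t0 := odds_gt0 y01.
have w01 (z : R) : 0 < z < 1 -> 0 <= z < 1 by move=> /andP[/ltW -> ->].
have st : odds x != odds y.
  apply: contra_neq yx => e.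
  by rewrite (oddsK (w01 _ x01)) (oddsK (w01 _ y01)) e.
have d1 := is_derive_odds_primitive s0 (ltW t0) st.
have := is_deriveZ_fun ((1 + odds x ^+ 2) ^+ 2 / odds x)
  (is_derive_comp_fun d1 (is_derive_odds y01)).
move=> /is_derive_eq; apply.
rewrite /kern real_normK ?num_real//.
rewrite [in X in _ = _ * X](oddsK (w01 _ x01)) [in X in _ = _ * X](oddsK (w01 _ y01)).
move: (odds x) (odds y) s0 t0 st => s t s0 t0 st.
have st0 : s - t != 0 by rewrite subr_eq0.
have stp : s + t != 0 by rewrite gt_eqF//; lra.
have s2 : 1 + s ^+ 2 != 0 by rewrite gt_eqF// ltr_wpDr ?sqr_ge0.
have t2 : 1 + t ^+ 2 != 0 by rewrite gt_eqF// ltr_wpDr ?sqr_ge0.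
have -> : s ^+ 2 / (1 + s ^+ 2) - t ^+ 2 / (1 + t ^+ 2) =
  (s - t) * (s + t) / ((1 + s ^+ 2) * (1 + t ^+ 2)).
  by field; rewrite s2 t2.
by field; rewrite ?st0 ?stp ?s2 ?t2 ?(gt_eqF s0) ?(gt_eqF t0).
Qed.

Lemma integral_odds_kern x a b : 0 < x < 1 -> 0 <= a -> a <= b -> b < 1 ->
  b < x \/ x < a ->
  (\int[mu]_(y in `[a, b]) ((odds x - odds y) * kern x y)%:E =
   ((1 + odds x ^+ 2) ^+ 2 / odds x * (odds_primitive (odds x) (odds b) -
      odds_primitive (odds x) (odds a)))%:E)%E.
Proof.
move=> x01 a0 ab b1 xab; have s0 := odds_gt0 x01.
have yx y : a <= y <= b -> x != y.
  by move=> /andP[ay yb]; apply/eqP => yx; case: xab; lra.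
have x01' : 0 <= x < 1 by move: x01 => /andP[/ltW -> ->].
pose c := (1 + odds x ^+ 2) ^+ 2 / odds x; rewrite -/c mulrBr.
pose f y := (odds x - odds y) * kern x y.
pose F y := c * odds_primitive (odds x) (odds y).
have cf y : a <= y <= b -> {for y, continuous f}.
  move=> /[dup] /yx xy /andP[ay yb]; apply: cvgM.
    apply: cvgB; first exact: cvg_cst.
    by apply: continuous_odds; lra.
  exact: continuous_kernr.
have cF y : a <= y <= b -> {for y, continuous F}.
  move=> /[dup] /yx xy /andP[ay yb]; apply: cvgM; first exact: cvg_cst.
  apply: continuous_comp; first by apply: continuous_odds; lra.
  apply: is_derive_continuous; apply: is_derive_odds_primitive => //.
    exact: odds_ge0.
  have y01 : 0 <= y < 1 by apply/andP; split; lra.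
  by apply: contra_neq xy => e; rewrite (oddsK x01') (oddsK y01) e.
have dF y : a < y < b -> is_derive y 1 F (f y).
  move=> /andP[ay yb]; apply: is_derive_odds_comp => //.
    by apply/andP; split; lra.
  by rewrite eq_sym yx// !ltW.
exact: (FTC_segment ab cf cF dF).
Qed.

End odds.

(** * Translations and reflections *)

Section invariance.
Context {R : realType}.
Local Notation mu := (@lebesgue_measure R).
Implicit Types (f : R -> \bar R) (c : R).

Lemma lebesgue_measure_shift c (A : set R) : measurable A ->
  pushforward mu ((fun y => y + c) : _ -> measurableTypeR R) A = mu A.
Proof.
move=> mA; apply/esym/lebesgue_measure_unique => //=.
  exact: measurable_funD.
move=> _ _ [[a b]] _ <-; rewrite /pushforward/=.
rewrite (_ : _ @^-1` _ = `]a - c, b - c]%classic); last first.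
  apply/seteqP; split => y /=; rewrite !in_itv/= => /andP[ay yb];
    apply/andP; split; lra.
rewrite !lebesgue_measure_itv/= !lte_fin ltrD2r.
by rewrite -!EFinB opprB addrA subrK.
Qed.

Lemma ge0_integral_shift f c : measurable_fun setT f -> (forall y, 0 <= f y)%E ->
  (\int[mu]_y f (y + c)%R = \int[mu]_y f y)%E.
Proof.
move=> mf f0; pose phi : measurableTypeR R -> measurableTypeR R := fun y => y + c.
have mphi : measurable_fun setT phi by exact: measurable_funD.
have <- := @ge0_integral_pushforward _ _ _ _ R phi mphi mu setT f measurableT mf
  (fun y _ => f0 y).
by apply: eq_measure_integral => A mA _; exact: lebesgue_measure_shift.
Qed.

Lemma ge0_integral_opp f : measurable_fun setT f -> (forall y, 0 <= f y)%E ->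
  (\int[mu]_y f (- y)%R = \int[mu]_y f y)%E.
Proof.
move=> mf f0; pose phi : measurableTypeR R -> measurableTypeR R := fun y => - y.
have mphi : measurable_fun setT phi by exact: measurable_funN.
have <- := @ge0_integral_pushforward _ _ _ _ R phi mphi mu setT f measurableT mf
  (fun y _ => f0 y).
by apply: eq_measure_integral => A mA _; exact: lebesgue_measureN.
Qed.

Lemma ge0_integral_onem f : measurable_fun setT f -> (forall y, 0 <= f y)%E ->
  (\int[mu]_y f (1 - y)%R = \int[mu]_y f y)%E.
Proof.
move=> mf f0; rewrite -[RHS]ge0_integral_opp// -[RHS](@ge0_integral_shift _ (- 1))//.
  by apply: eq_integral => y _; rewrite opprD opprK addrC.
exact: (measurableT_comp mf).
Qed.

End invariance.

(** * The barrier, its rise and its fall *)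

Section barrier.
Context {R : realType}.
Local Notation mu := (@lebesgue_measure R).
Implicit Types (a b s t x y : R).

(** Agrees with [delta] on the open interval ([deltaE]); the closed form gives measurability and
    symmetry by computation. *)
Definition dist01 x : R := Num.max 0 (Num.min x (1 - x)).

(** Since [dist01] is at most one half, the singularity of [odds] at 1 is never met, and the barrier
    is comparable to the square root of the distance. *)
Definition barrier x : R := odds (dist01 x).

Lemma dist01_onem x : dist01 (1 - x) = dist01 x.
Proof. by rewrite /dist01 opprB addrCA subrr addr0 minC. Qed.

Lemma dist01_bound x : 0 <= dist01 x <= 2^-1.
Proof.
rewrite /dist01 le_max lexx/= ge_max ge_min; apply/andP; split; first lra.
by have [h|h] := leP x 2^-1; apply/orP; [left|right; lra].
Qed.

Lemma dist01_left x : 0 <= x <= 2^-1 -> dist01 x = x.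
Proof.
move=> /andP[x0 x1]; rewrite /dist01 (min_idPl _); last lra.
exact/max_idPr.
Qed.

Lemma dist01_out x : ~~ (0 < x < 1) -> dist01 x = 0.
Proof.
rewrite negb_and -!leNgt => H; rewrite /dist01; apply/max_idPl.
by rewrite ge_min; case/orP: H => H; apply/orP; [left|right; lra].
Qed.

Lemma dist01_gt0 x : 0 < x < 1 -> 0 < dist01 x.
Proof. by move=> /andP[x0 x1]; rewrite lt_max lt_min x0/= subr_gt0 x1 orbT. Qed.

Lemma dist01_lip x y : `|dist01 x - dist01 y| <= `|x - y|.
Proof.
have := ler_norm (x - y); have := lerNnormlW (lexx `|x - y|).
set n := `|x - y| => n1 n2; rewrite /dist01 ler_norml.
have [hx|hx] := leP x (1 - x); have [hy|hy] := leP y (1 - y).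
all: case: (leP 0 _) => h1; case: (leP 0 _) => h2; apply/andP; split; lra.
Qed.

Let dist01_lt1 x : 0 <= dist01 x < 1.
Proof. by have /andP[-> ?] := dist01_bound x; lra. Qed.

Lemma barrier_ge0 x : 0 <= barrier x.
Proof. exact: odds_ge0. Qed.

Lemma barrier_gt0 x : 0 < x < 1 -> 0 < barrier x.
Proof.
move=> /dist01_gt0 d0; apply: odds_gt0; rewrite d0/=.
by have /andP[] := dist01_lt1 x.
Qed.

Lemma barrier_out x : ~~ (0 < x < 1) -> barrier x = 0.
Proof. by move=> /dist01_out; rewrite /barrier /odds => ->; rewrite mul0r sqrtr0. Qed.

Lemma barrier_onem x : barrier (1 - x) = barrier x.
Proof. by rewrite /barrier dist01_onem. Qed.

Lemma barrier_left x : 0 <= x <= 2^-1 -> barrier x = odds x.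
Proof. by move=> ?; rewrite /barrier dist01_left. Qed.

Lemma barrier_sqr_ge x : dist01 x <= barrier x ^+ 2.
Proof.
have /andP[d0 d1] := dist01_lt1 x; rewrite odds_sqr ?d0// ler_pdivlMr; nra.
Qed.

Lemma barrier_sqr_le x : barrier x ^+ 2 <= 2 * dist01 x.
Proof.
have /andP[d0 d1] := dist01_bound x.
have d01 : 0 <= dist01 x < 1 by rewrite d0/=; lra.
rewrite odds_sqr// ler_pdivrMr; nra.
Qed.

Lemma barrier_le1 x : barrier x <= 1.
Proof.
have /andP[d0 d1] := dist01_bound x.
rewrite -(@ler_sqr _ (barrier x)) ?nnegrE ?barrier_ge0// expr1n.
by apply: le_trans (barrier_sqr_le x) _; lra.
Qed.

Lemma measurable_barrier : measurable_fun setT barrier.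
Proof.
by rewrite /barrier /odds /dist01; measure_tac.
Qed.

(* The region where the singularity of the kernel is cut off, scaled
   multiplicatively in the odds so that it is adapted to both end points. *)
Definition far sigma x y : bool :=
  [|| ~~ ((0 < x < 1) && (0 < y < 1)),
      sigma ^+ 2 * (x * (1 - y)) <= y * (1 - x) |
      sigma ^+ 2 * (y * (1 - x)) <= x * (1 - y)].

Lemma farC sigma x y : far sigma x y = far sigma y x.
Proof. by rewrite /far andbC orbCA orbA orbC orbA orbC orbCA. Qed.

Lemma far_onem sigma x y : far sigma (1 - x) (1 - y) = far sigma x y.
Proof.
have e (z : R) : (0 < 1 - z < 1) = (0 < z < 1).
  by apply/andP/andP => -[]; split; lra.
rewrite /far !e !subKr; congr orb; rewrite orbC.
by rewrite [(1 - y) * x]mulrC [(1 - x) * y]mulrC.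
Qed.

(** Positive parts make [rise] and [fall] integrals of nonnegative functions, to which Tonelli's
    theorem applies before anything is known to be finite. *)
Definition rise_kern sigma x y : R :=
  (far sigma x y)%:R * Num.max 0 (barrier y - barrier x) * kern x y.

Lemma rise_kern_ge0 sigma x y : 0 <= rise_kern sigma x y.
Proof. by rewrite /rise_kern mulr_ge0 ?kern_ge0// mulr_ge0// le_max lexx. Qed.

Lemma rise_kern_onem sigma x y :
  rise_kern sigma (1 - x) (1 - y) = rise_kern sigma x y.
Proof.
rewrite /rise_kern far_onem !barrier_onem /kern.
have -> : 1 - x - (1 - y) = y - x by lra.
by rewrite [`|y - x|]distrC.
Qed.

Lemma measurable_natr_bool d (T : measurableType d) (h : T -> bool) :
  measurable_fun setT h -> measurable_fun setT (fun w => (h w)%:R : R).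
Proof.
move=> mh; rewrite (_ : (fun w => _) = \1_[set w | h w]); last first.
  apply/funext => w; rewrite indicE; case: (boolP (h w)) => hw.
    by rewrite mem_set.
  by rewrite memNset//=; exact/negP.
apply: measurable_indic; rewrite -[X in measurable X]setTI.
exact: mh measurableT [set true] I.
Qed.

Lemma measurable_far sigma :
  measurable_fun setT (fun p : R * R => (far sigma p.1 p.2)%:R : R).
Proof.
apply: measurable_natr_bool; rewrite /far.
apply: measurable_or.
  apply: measurable_neg; apply: measurable_and; apply: measurable_and;
    apply: measurable_fun_ltr; measure_tac.
by apply: measurable_or; apply: measurable_fun_ler; measure_tac.
Qed.

Lemma measurable_rise_kern sigma :
  measurable_fun setT (fun p : R * R => rise_kern sigma p.1 p.2).
Proof.
have ? := measurable_far sigma; have ? := @measurable_kern R.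
have ? := measurable_comp_fst measurable_barrier.
have ? := measurable_comp_snd measurable_barrier.
by rewrite /rise_kern; measure_tac.
Qed.

(* [fall - rise] is the half-Laplacian of the barrier, up to a factor, with the
   integrand restricted to [far]. *)
Definition rise sigma x : \bar R := (\int[mu]_y (rise_kern sigma x y)%:E)%E.
Definition fall sigma x : \bar R := (\int[mu]_y (rise_kern sigma y x)%:E)%E.

Lemma measurable_rise_kernr sigma x : measurable_fun setT (rise_kern sigma x).
Proof.
exact: (measurableT_comp (measurable_rise_kern sigma) (measurable_pair1 x)).
Qed.

Lemma measurable_rise_kernl sigma x :
  measurable_fun setT (rise_kern sigma ^~ x).
Proof.
exact: (measurableT_comp (measurable_rise_kern sigma) (measurable_pair2 x)).
Qed.

Lemma rise_onem sigma x : rise sigma (1 - x) = rise sigma x.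
Proof.
rewrite /rise -ge0_integral_onem.
- by apply: eq_integral => y _; rewrite rise_kern_onem.
- by apply/measurable_EFinP; exact: measurable_rise_kernr.
- by move=> y; rewrite lee_fin rise_kern_ge0.
Qed.

Lemma fall_onem sigma x : fall sigma (1 - x) = fall sigma x.
Proof.
rewrite /fall -ge0_integral_onem.
- by apply: eq_integral => y _; rewrite rise_kern_onem.
- by apply/measurable_EFinP; exact: measurable_rise_kernl.
- by move=> y; rewrite lee_fin rise_kern_ge0.
Qed.

(** This is [ln u <= u - 1] at [u = (1 - t) / (1 + t)]. The square doubles the logarithm and [u - 1]
    brings another factor 2, whence one quarter. *)
Lemma log_ratio_ge t : 0 < t < 1 ->
  t / (1 + t) <= 4^-1 * ln (((1 + t) / (1 - t)) ^+ 2).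
Proof.
move=> /andP[t0 t1].
have p0 : 0 < (1 - t) / (1 + t) by rewrite divr_gt0; lra.
have -> : (1 + t) / (1 - t) = ((1 - t) / (1 + t))^-1 by rewrite invf_div.
rewrite lnXn ?invr_gt0// lnV ?posrE//.
have := @le_ln1Dx R ((1 - t) / (1 + t) - 1).
rewrite addrCA subrr addr0 => H.
have {}H : ln ((1 - t) / (1 + t)) <= (1 - t) / (1 + t) - 1 by apply: H; lra.
have e : (1 - t) / (1 + t) - 1 = - 2 * (t / (1 + t)).
  by field; rewrite gt_eqF//; lra.
by move: H; rewrite e mulNrn -mulr_natl; lra.
Qed.

End barrier.

(** * Explicit bounds for the half-Laplacian of the barrier *)

Section supersolution.
Context {R : realType}.
Local Notation mu := (@lebesgue_measure R).
Implicit Types (a b s t x y sigma : R) (A B : set R).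

Lemma le_integral_subset (h : R -> R) A B : measurable A -> measurable B ->
  measurable_fun setT h -> (forall y, 0 <= h y) -> A `<=` B ->
  (\int[mu]_(y in A) (h y)%:E <= \int[mu]_(y in B) (h y)%:E)%E.
Proof.
move=> mA mB mh h0 AB; apply: ge0_subset_integral => //.
- by apply/measurable_EFinP; exact: measurable_funTS.
- by move=> y _; rewrite lee_fin.
Qed.

Lemma integral_disjU (h : R -> R) A B : measurable A -> measurable B ->
  measurable_fun setT h -> (forall y, 0 <= h y) -> (forall y, A y -> ~ B y) ->
  (\int[mu]_(y in A `|` B) (h y)%:E =
   \int[mu]_(y in A) (h y)%:E + \int[mu]_(y in B) (h y)%:E)%E.
Proof.
move=> mA mB mh h0 AB; rewrite ge0_integral_setU//.
- by apply/measurable_EFinP; exact: measurable_funTS.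
- by move=> y _; rewrite lee_fin.
- by apply/disj_setPS => y [Ay /(AB _ Ay)].
Qed.

Lemma ge0_integral_le2 (h : R -> R) A B : measurable A -> measurable B ->
  measurable_fun setT h -> (forall y, 0 <= h y) ->
  (forall y, ~ A y -> ~ B y -> h y = 0) ->
  (\int[mu]_y (h y)%:E <=
   \int[mu]_(y in A) (h y)%:E + \int[mu]_(y in B) (h y)%:E)%E.
Proof.
move=> mA mB mh h0 hAB.
have mBA : measurable (B `\` A) by exact: measurableD.
have mU : measurable (A `|` (B `\` A)) by exact: measurableU.
have -> : (\int[mu]_y (h y)%:E = \int[mu]_(y in A `|` (B `\` A)) (h y)%:E)%E.
  rewrite [RHS]integral_mkcond; apply: eq_integral => y _.
  rewrite patchE; case: ifPn => //; rewrite notin_setE => /not_orP[Ay BAy].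
  by rewrite hAB// => By; apply: BAy.
rewrite integral_disjU//; last by move=> y Ay [].
by rewrite leeD2l//; apply: le_integral_subset => // y [].
Qed.

Lemma integral_scaled_kern_itv c x a b (b1 b2 : bool) :
  0 <= c -> a <= b -> b < x \/ x < a ->
  (\int[mu]_(y in [set` Interval (BSide b1 a) (BSide b2 b)]) (c * kern x y)%:E =
   (c * ((a - x)^-1 - (b - x)^-1))%:E)%E.
Proof.
move=> c0 ab xab.
have mk D : measurable_fun D (fun y => (c * kern x y)%:E).
  apply/measurable_EFinP/measurable_funTS; apply: measurable_funM => //.
  exact: measurable_kernr.
have -> : (\int[mu]_(y in [set` Interval (BSide b1 a) (BSide b2 b)]) (c * kern x y)%:E =
    \int[mu]_(y in `[a, b]) (c * kern x y)%:E)%E.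
  by case: b1; case: b2; rewrite ?integral_itv_bndo_bndc ?integral_itv_obnd_cbnd//.
under eq_integral do rewrite EFinM.
rewrite ge0_integralZl_EFin//; last 2 first.
- by move=> y _; rewrite lee_fin kern_ge0.
- by apply/measurable_EFinP/measurable_funTS; exact: measurable_kernr.
by rewrite integral_kern_itv.
Qed.

(** The logarithmic part of [odds_primitive s] at [s / sigma] and at [sigma * s]: the multiplicative
    window gives both edges the same divergent term. *)
Definition log_sigma sigma : R := 4^-1 * ln (((sigma + 1) / (sigma - 1)) ^+ 2).

Definition odds_weight s : R := (1 + s ^+ 2) ^+ 2 / s.

(** Used with [sigma^-1] and [sigma] to locate the two edges of [far] seen from [x]; the last
    equation is the edge condition, cross-multiplied. *)
Let odds_pt (r : R) x : 0 < r -> 0 < x < 1 -> exists y,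
  [/\ 0 < y < 1, odds y = r * odds x & y * (1 - x) = r ^+ 2 * (x * (1 - y))].
Proof.
move=> r0 /andP[x0 x1]; have r2 : 0 < r ^+ 2 by rewrite exprn_gt0.
have D0 : 0 < 1 - x + r ^+ 2 * x by rewrite addr_gt0 ?subr_gt0// mulr_gt0.
pose y := r ^+ 2 * x / (1 - x + r ^+ 2 * x).
have y0 : 0 < y by rewrite divr_gt0// mulr_gt0.
have y1 : y < 1 by rewrite ltr_pdivrMr// mul1r; lra.
have yE : y * (1 - x) = r ^+ 2 * (x * (1 - y)) by rewrite /y; field; rewrite gt_eqF.
exists y; split => //; first by rewrite y0.
apply/eqP; rewrite -(@eqrXn2 _ 2)// ?odds_ge0//; last first.
  by rewrite mulr_ge0 ?odds_ge0// ltW.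
have x1' : 0 < 1 - x by rewrite subr_gt0.
have y1' : 0 < 1 - y by rewrite subr_gt0.
have x01 : 0 <= x < 1 by rewrite ltW.
have y01 : 0 <= y < 1 by rewrite ltW.
by rewrite exprMn (odds_sqr x01) (odds_sqr y01) mulrA
  (eqr_div _ _ (lt0r_neq0 y1') (lt0r_neq0 x1')) yE mulrA.
Qed.

(** Only the exterior and the part of the interval left of the window are kept. The value of the
    primitive at 0 subtracts one [odds_weight], and the exterior restores it. *)
Lemma fall_ge sigma x : 1 < sigma -> 0 < x <= 2^-1 ->
  ((odds_weight (odds x) * (log_sigma sigma + sigma / (sigma + 1)) - 4^-1)%:E
   <= fall sigma x)%E.
Proof.
move=> s1 /andP[x0 xh].
have x01 : 0 < x < 1 by apply/andP; split; lra.
have x01' : 0 <= x < 1 by apply/andP; split; lra.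
have px : barrier x = odds x by apply: barrier_left; apply/andP; split; lra.
have V0 : 0 < sigma^-1 by rewrite invr_gt0; lra.
have [l [/andP[l0 l1] ol lE]] := odds_pt V0 x01.
have s0 := odds_gt0 x01; set s := odds x in px ol s0 *.
have lx : l < x.
  rewrite ltNge -odds_le//; last lra.
  rewrite ol -ltNge -/s -[ltRHS]mul1r ltr_pM2r// invf_lt1; lra.
have hs01 : s <= 1.
  rewrite -(@ler_sqr _ s) ?nnegrE ?(ltW s0)// expr1n /s odds_sqr//.
  by rewrite ler_pdivrMr; lra.
pose h y := rise_kern sigma y x.
have mh : measurable_fun setT h by exact: measurable_rise_kernl.
have h0 y : 0 <= h y by exact: rise_kern_ge0.
have hout y : ~~ (0 < y < 1) -> h y = s * kern x y.
  move=> y01; rewrite /h /rise_kern /far (negbTE y01)/= mul1r (barrier_out y01).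
  by rewrite subr0 px (max_idPr _) ?(ltW s0)// kernC.
have hleft y : 0 <= y <= l -> h y = (s - odds y) * kern x y.
  move=> /andP[y0 yl].
  have py : barrier y = odds y by apply: barrier_left; apply/andP; split; lra.
  have -> : h y = Num.max 0 (s - odds y) * kern y x.
    rewrite /h /rise_kern px py (_ : far _ _ _) ?mul1r//.
    rewrite /far; apply/orP; right; apply/orP; left.
    have e : x * (1 - l) = sigma ^+ 2 * (l * (1 - x)).
      by rewrite lE exprVn mulrA divff ?mul1r// expf_neq0// gt_eqF//; lra.
    have := sqr_ge0 sigma; nra.
  by rewrite kernC (max_idPr _)// subr_ge0 odds_le//; lra.
(* Segments of length 8 stand for the exterior half-lines. Each omitted tail is worth at most
   [s / 8], and [s <= 1], which accounts for the loss [4^-1]. *)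
pose A1 : set R := `[-8, 0[%classic; pose A2 : set R := `[0, l]%classic.
pose A3 : set R := `]1, 9]%classic.
have mA1 : measurable A1 by exact: measurable_itv.
have mA2 : measurable A2 by exact: measurable_itv.
have mA3 : measurable A3 by exact: measurable_itv.
have mA23 : measurable (A2 `|` A3) by exact: measurableU.
have mA123 : measurable (A1 `|` (A2 `|` A3)) by exact: measurableU.
apply: (@le_trans _ _ (\int[mu]_(y in A1 `|` (A2 `|` A3)) (h y)%:E)%E); last first.
  exact: le_integral_subset.
rewrite integral_disjU//; last first.
  by move=> y; rewrite /A1 /A2 /A3/= !in_itv/= => y1 [] y2; lra.
rewrite integral_disjU//; last first.
  by move=> y; rewrite /A2 /A3/= !in_itv/= => y1 y2; lra.
have I2 : (\int[mu]_(y in A2) (h y)%:E =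
    (odds_weight s * (log_sigma sigma + sigma / (sigma + 1) - 1))%:E)%E.
  transitivity (\int[mu]_(y in A2) ((s - odds y) * kern x y)%:E)%E.
    apply: eq_integral => y /set_mem; rewrite /A2/= in_itv/= => y0l.
    by rewrite hleft.
  rewrite integral_odds_kern//; [|lra|by left].
  congr EFin; rewrite -/s -/(odds_weight s) ol; congr (_ * _).
  have o0 : odds 0 = 0 :> R by rewrite /odds mul0r sqrtr0.
  rewrite o0 /odds_primitive addr0 subr0.
  rewrite divff ?gt_eqF// expr1n ln1 mulr0 add0r; congr (_ + _ - _).
    rewrite /log_sigma; congr (_ * ln (_ ^+ 2)); clear -s0 s1; field.
    by apply/and3P; split; rewrite gt_eqF//; nra.
  by clear -s0 s1; field; apply/and3P; split; rewrite gt_eqF//; nra.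
have I1 : (\int[mu]_(y in A1) (h y)%:E = (s * (x^-1 - (x + 8)^-1))%:E)%E.
  transitivity (\int[mu]_(y in A1) (s * kern x y)%:E)%E.
    apply: eq_integral => y /set_mem; rewrite /A1/= in_itv/= => /andP[_ y0].
    by rewrite hout// negb_and -!leNgt (ltW y0).
  rewrite integral_scaled_kern_itv ?(ltW s0)//; last by left.
  have -> : - 8 - x = - (x + 8) by lra.
  by rewrite sub0r !invrN opprK addrC.
have I3 : (\int[mu]_(y in A3) (h y)%:E = (s * ((1 - x)^-1 - (9 - x)^-1))%:E)%E.
  transitivity (\int[mu]_(y in A3) (s * kern x y)%:E)%E.
    apply: eq_integral => y /set_mem; rewrite /A3/= in_itv/= => /andP[y1 _].
    by rewrite hout// negb_and -!leNgt (ltW y1) orbT.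
  by rewrite integral_scaled_kern_itv ?(ltW s0)//; [lra|right; lra].
rewrite I1 I2 I3 -!EFinD lee_fin.
have w : s * (x^-1 + (1 - x)^-1) = odds_weight s.
  have x1 : 1 - x = (1 + s ^+ 2)^-1 by exact: onem_odds.
  have xE : x = s ^+ 2 / (1 + s ^+ 2) by exact: oddsK.
  rewrite x1 {1}xE /odds_weight; field.
  by rewrite gt_eqF//= gt_eqF// ltr_wpDr ?sqr_ge0.
have e8 : (x + 8)^-1 <= 8^-1 by clear -x0; rewrite lef_pV2 ?posrE; lra.
have e9 : (9 - x)^-1 <= 8^-1 by clear -xh; rewrite lef_pV2 ?posrE; lra.
nra.
Qed.

Let half_odds : odds 2^-1 = 1 :> R.
Proof. by rewrite /odds (_ : 2^-1 / (1 - 2^-1) = 1) ?sqrtr1//; field. Qed.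

(** Beyond the midpoint the barrier stays below 1, whereas [odds] keeps growing. This is the source
    of strictness, worth [2^-1]; after the loss in [fall_ge] a margin of [4^-1] remains. *)
Lemma rise_le sigma x : 1 < sigma -> 0 < x <= 2^-1 ->
  (rise sigma x <=
   (odds_weight (odds x) * (log_sigma sigma + sigma / (sigma + 1)) - 2^-1)%:E)%E.
Proof.
move=> s1 /andP[x0 xh].
have x01 : 0 < x < 1 by apply/andP; split; lra.
have x01' : 0 <= x < 1 by apply/andP; split; lra.
have px : barrier x = odds x by apply: barrier_left; apply/andP; split; lra.
have V0 : 0 < sigma by lra.
have [r [/andP[r0 r1] or_ rE]] := odds_pt V0 x01.
have s0 := odds_gt0 x01; set s := odds x in px or_ s0 *.
have sg2 : 1 < sigma ^+ 2 by rewrite exprn_egt1.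
have xr : x < r.
  have : 0 < (sigma ^+ 2 - 1) * (x * (1 - r)) by rewrite !mulr_gt0// subr_gt0.
  by move: rE; rewrite mulrBl mul1r => <-; lra.
have xE : x = s ^+ 2 / (1 + s ^+ 2) by exact: oddsK.
have x1E : 1 - x = (1 + s ^+ 2)^-1 by exact: onem_odds.
have hs01 : s <= 1.
  rewrite -(@ler_sqr _ s) ?nnegrE ?(ltW s0)// expr1n /s odds_sqr//.
  by rewrite ler_pdivrMr; lra.
pose h y := rise_kern sigma x y.
have mh : measurable_fun setT h by exact: measurable_rise_kernr.
have h0 y : 0 <= h y by exact: rise_kern_ge0.
have hzero y : ~~ (r <= y <= 1) -> h y = 0.
  move=> yr; rewrite /h /rise_kern.
  have [ps|ps] := leP (barrier y) (barrier x).
    by rewrite (max_idPl _) ?mulr0 ?mul0r// subr_le0.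
  have y01 : 0 < y < 1.
    have [//|yo] := boolP (0 < y < 1).
    by move: ps; rewrite (barrier_out yo) ltNge barrier_ge0.
  have xy : x < y.
    rewrite ltNge; apply/negP => yx; move: ps; rewrite px barrier_left; last lra.
    by rewrite /s ltNge odds_le ?yx//; lra.
  rewrite (_ : far _ _ _ = false) ?mul0r//; apply/negbTE.
  move: yr y01 => yr /andP[y0 y1].
  have {}yr : y < r by rewrite ltNge; apply: contra yr => ->; rewrite ltW.
  rewrite /far x01 y0 y1/= negb_or -!ltNge.
  have x1 : 0 < 1 - x by lra.
  have sg0 : 0 < sigma ^+ 2 by lra.
  have ry : 0 < r - y by lra.
  have p1 := mulr_gt0 ry x1; have p2 := mulr_gt0 sg0 (mulr_gt0 x0 ry).
  have p3 : 0 < (sigma ^+ 2 - 1) * (y * (1 - x)) by rewrite !mulr_gt0// subr_gt0.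
  by apply/andP; split; lra.
have hle1 y : h y <= (1 - s) * kern x y.
  rewrite /h /rise_kern ler_wpM2r ?kern_ge0// -[leRHS]mul1r.
  rewrite ler_pM ?ler0n ?lern1 ?leq_b1 ?le_max ?lexx//.
  by rewrite ge_max subr_ge0 hs01 px lerB// barrier_le1.
have sP : 0 < s ^+ 2 by rewrite exprn_gt0.
pose c0 := odds_weight s; have c0_gt0 : 0 < c0.
  by rewrite divr_gt0// exprn_gt0//; lra.
have c0s : c0 * s = (1 + s ^+ 2) ^+ 2 by rewrite /c0 /odds_weight divfK// gt_eqF.
(* [sigma * s] is the value of [odds] at the edge [r], and [odds] is 1 at the midpoint: the cases
   are whether [r] lies left of it. *)
have [ss|ss] := ltP (sigma * s) 1.
  have sl1 : s < 1 by nra.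
  have rh : r < 2^-1.
    rewrite ltNge -odds_le ?half_odds ?or_ -?ltNge//; [lra|].
    by rewrite ltW.
  pose A : set R := `[r, 2^-1]%classic; pose B : set R := `[2^-1, 1]%classic.
  have mA : measurable A by exact: measurable_itv.
  have mB : measurable B by exact: measurable_itv.
  have h1 : (\int[mu]_(y in A) (h y)%:E <=
      (c0 * (log_sigma sigma + 1 / (sigma + 1) - 2 * (s / (1 + s))))%:E)%E.
    apply: (@le_trans _ _ (\int[mu]_(y in A) ((odds y - s) * kern x y)%:E)%E).
      apply: ge0_le_integral => //.
      - by move=> y _; rewrite lee_fin.
      - by apply/measurable_EFinP; exact: measurable_funTS.
      - apply/measurable_EFinP/measurable_funTS; rewrite /odds.
        by have ? := @measurable_kernr R x; measure_tac.
      move=> y; rewrite /A/= in_itv/= => /andP[ry yh].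
      have py : barrier y = odds y by apply: barrier_left; apply/andP; split; lra.
      rewrite lee_fin /h /rise_kern ler_wpM2r ?kern_ge0// px py.
      rewrite (max_idPr _); last by rewrite subr_ge0 /s odds_le//; lra.
      rewrite -[leRHS]mul1r ler_wpM2r ?lern1 ?leq_b1// subr_ge0 /s odds_le//; lra.
    have hlt : 2^-1 < 1 :> R by lra.
    have := integral_odds_kern x01 (ltW r0) (ltW rh) hlt (or_intror xr).
    have -> : (\int[mu]_(y in `[r, 2^-1%R]) ((odds x - odds y) * kern x y)%:E =
        - \int[mu]_(y in A) ((odds y - s) * kern x y)%:E)%E.
      rewrite -integral_ge0N.
        by apply: eq_integral => y _; rewrite -EFinN -mulNr opprB.
      move=> y; rewrite /A/= in_itv/= => /andP[ry yh].
      by rewrite lee_fin mulr_ge0 ?kern_ge0// subr_ge0 /s odds_le//; lra.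
    move=> /eqP; rewrite eqe_oppLR => /eqP ->; rewrite -EFinN lee_fin.
    rewrite -/s -/(odds_weight s) -/c0 -mulrN ler_pM2l// opprB half_odds or_.
    rewrite /odds_primitive /log_sigma.
    have -> : ((s + sigma * s) / (s - sigma * s)) ^+ 2 =
        ((sigma + 1) / (sigma - 1)) ^+ 2.
      rewrite -sqrrN; congr (_ ^+ 2); clear -s0 s1; field.
      by apply/andP; split; [rewrite gt_eqF//; lra|rewrite lt_eqF//; nra].
    have -> : s / (s + sigma * s) = 1 / (sigma + 1).
      by clear -s0 s1; field; apply/andP; split; rewrite gt_eqF//; nra.
    have -> : ((s + 1) / (s - 1)) ^+ 2 = ((1 + s) / (1 - s)) ^+ 2.
      rewrite -sqrrN; congr (_ ^+ 2); clear -s0 sl1; field.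
      by apply/andP; split; [rewrite gt_eqF//; lra|rewrite lt_eqF//; nra].
    (* This doubles the term [s / (1 + s)] that the primitive subtracts at the midpoint: one copy
       pays for the right half of the interval, the other for the margin. *)
    have := @log_ratio_ge R s; rewrite s0 sl1 [s + 1]addrC => /(_ isT); lra.
  have h2 : (\int[mu]_(y in B) (h y)%:E <= (c0 * (s / (1 + s)))%:E)%E.
    apply: (@le_trans _ _ (\int[mu]_(y in B) ((1 - s) * kern x y)%:E)%E).
      apply: ge0_le_integral => //.
      - by move=> y _; rewrite lee_fin.
      - by apply/measurable_EFinP; exact: measurable_funTS.
      - apply/measurable_EFinP/measurable_funTS; apply: measurable_funM => //.
        exact: measurable_kernr.
      by move=> y _; rewrite lee_fin hle1.
    rewrite /B integral_scaled_kern_itv ?subr_ge0//; [|lra|right; lra].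
    rewrite lee_fin le_eqVlt; apply/orP; left; apply/eqP.
    have hx : 2^-1 - x = (1 - s ^+ 2) / (2 * (1 + s ^+ 2)).
      by rewrite {1}xE; clear -sP; field; rewrite gt_eqF//; lra.
    have s21 : 0 < 1 - s ^+ 2 by nra.
    rewrite hx x1E /c0 /odds_weight; clear -s0 sP s21; field.
    have s2p : 0 < 1 + s ^+ 2 by lra.
    by rewrite !gt_eqF//; lra.
  apply: (@le_trans _ _ (\int[mu]_(y in A) (h y)%:E + \int[mu]_(y in B) (h y)%:E)%E).
    apply: ge0_integral_le2 => // y; rewrite /A /B/= !in_itv/= => yA yB.
    apply: hzero; apply/negP => /andP[ry y1].
    by have [yh|yh] := leP y 2^-1; [apply: yA; rewrite ry|apply: yB; rewrite ltW].
  apply: le_trans (leeD h1 h2) _; rewrite -EFinD lee_fin -/c0.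
  have e1 : 2^-1 <= c0 * (s / (1 + s)).
    rewrite mulrA c0s ler_pdivlMr; last lra.
    have := sqr_ge0 s; nra.
  have e2 : 0 <= c0 * (sigma / (sigma + 1) - 1 / (sigma + 1)).
    by clear -c0_gt0 s1; rewrite mulr_ge0 ?(ltW c0_gt0)// -mulrBl divr_ge0//; lra.
  move: e1 e2; move: (sigma / (sigma + 1)) (1 / (sigma + 1)) (s / (1 + s)).
  by move: (log_sigma sigma) => L u v w; nra.
have rh : 2^-1 <= r.
  by rewrite -odds_le ?half_odds ?or_//; [lra|rewrite ltW].
pose A : set R := `[r, 1]%classic.
have mA : measurable A by exact: measurable_itv.
have h1 : (rise sigma x <= (c0 / (sigma + 1))%:E)%E.
  rewrite /rise.
  apply: (@le_trans _ _ (\int[mu]_(y in A) ((1 - s) * kern x y)%:E)%E).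
    rewrite [leRHS]integral_mkcond; apply: ge0_le_integral => //.
    - by move=> y _; rewrite lee_fin rise_kern_ge0.
    - by apply/measurable_EFinP; exact: mh.
    - apply/(measurable_restrictT _ mA)/measurable_EFinP/measurable_funTS.
      by apply: measurable_funM => //; exact: measurable_kernr.
    move=> y _; rewrite patchE; case: ifPn => yA; first by rewrite lee_fin hle1.
    rewrite lee_fin -/(h y) hzero//; apply/negP => ry; move: yA.
    by rewrite notin_setE; apply; rewrite /A/= in_itv.
  rewrite /A integral_scaled_kern_itv ?subr_ge0//; [|exact: ltW|by right].
  have ssE : 1 + (sigma * s) ^+ 2 > 0 by rewrite ltr_wpDr ?sqr_ge0.
  have r01 : 0 <= r < 1 by rewrite ltW.
  have rxE : r - x = s ^+ 2 * (sigma ^+ 2 - 1) /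
      ((1 + s ^+ 2) * (1 + (sigma * s) ^+ 2)).
    rewrite {1}(oddsK r01) or_ {1}xE; clear -sP ssE; field.
    by rewrite !gt_eqF//; lra.
  have sg21 : 0 < sigma ^+ 2 - 1 by lra.
  rewrite lee_fin rxE x1E.
  have -> : (1 - s) * ((s ^+ 2 * (sigma ^+ 2 - 1) /
      ((1 + s ^+ 2) * (1 + (sigma * s) ^+ 2)))^-1 - (1 + s ^+ 2)^-1^-1) =
      c0 * ((1 - s) / (s * (sigma ^+ 2 - 1))).
    rewrite /c0 /odds_weight; clear -s0 sP ssE sg21; field.
    by rewrite !gt_eqF//; lra.
  rewrite ler_wpM2l ?(ltW c0_gt0)// ler_pdivrMr; last by rewrite mulr_gt0.
  have -> : (sigma + 1)^-1 * (s * (sigma ^+ 2 - 1)) = s * (sigma - 1).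
    by clear -s1; field; rewrite gt_eqF//; lra.
  by rewrite mulrBr mulr1 [s * _]mulrC; lra.
apply: le_trans h1 _; rewrite lee_fin -/c0.
(* Here no integral of [odds] produces a logarithm, so the one in the target is bounded below
   instead. *)
have lam : (sigma + 1)^-1 <= log_sigma sigma.
  have := @log_ratio_ge R sigma^-1.
  have -> : sigma^-1 / (1 + sigma^-1) = (sigma + 1)^-1.
    by clear -s1; field; apply/andP; split; rewrite gt_eqF//; lra.
  have -> : (1 + sigma^-1) / (1 - sigma^-1) = (sigma + 1) / (sigma - 1).
    by clear -s1; field; apply/andP; split; rewrite gt_eqF//; lra.
  by apply; rewrite invr_gt0 V0 invf_lt1.
have c2 : 2 <= c0.
  rewrite /c0 /odds_weight ler_pdivlMr//.
  have := sqr_ge0 (s - 1); have := sqr_ge0 (s ^+ 2); nra.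
have e1 : 2^-1 <= sigma / (sigma + 1) by clear -s1; rewrite ler_pdivlMr; lra.
have e2 : 0 <= c0 * (log_sigma sigma - (sigma + 1)^-1).
  by rewrite mulr_ge0 ?(ltW c0_gt0)// subr_ge0.
have e3 : 0 <= (c0 - 2) * (sigma / (sigma + 1) - 2^-1).
  by rewrite mulr_ge0// subr_ge0.
move: e1 e2 e3; move: (sigma / (sigma + 1)) (sigma + 1)^-1 => u v; nra.
Qed.

Lemma odds_weight_le s : 0 < s <= 1 -> odds_weight s <= 4 / s.
Proof.
move=> /andP[s0 s1]; rewrite /odds_weight ler_wpM2r ?invr_ge0 ?(ltW s0)//.
have : s ^+ 2 <= 1 by rewrite exprn_ile1// ltW.
by have := sqr_ge0 s; move: (s ^+ 2) => p; nra.
Qed.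

(* The logarithms, which blow up as [sigma] tends to 1, cancel. *)
Lemma rise_fall sigma x : 1 < sigma -> 0 < x < 1 ->
  (rise sigma x + 4^-1%:E <= fall sigma x)%E.
Proof.
move=> s1; wlog xh : x / x <= 2^-1 => [H x01|/andP[x0 x1]].
  have [xh|xh] := leP x 2^-1; first exact: H.
  rewrite -rise_onem -fall_onem; apply: H; first lra.
  by move: x01 => /andP[? ?]; apply/andP; split; lra.
have x0h : 0 < x <= 2^-1 by rewrite x0.
apply: le_trans (fall_ge s1 x0h); apply: (le_trans (leeD2r _ (rise_le s1 x0h))).
by rewrite -EFinD lee_fin; lra.
Qed.

(** [C] depends on the cut-off; the bound serves to make the integral against [rise] finite, so that
    it can be cancelled. *)
Lemma rise_bound sigma : 1 < sigma -> exists2 C, 0 <= C &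
  forall x, 0 < x < 1 -> (rise sigma x <= (C / barrier x)%:E)%E.
Proof.
move=> s1; pose L := log_sigma sigma + sigma / (sigma + 1).
exists (4 * `|L|) => [|x]; first by rewrite mulr_ge0.
wlog xh : x / x <= 2^-1 => [H x01|/andP[x0 x1]].
  have [xh|xh] := leP x 2^-1; first exact: H.
  rewrite -rise_onem -barrier_onem; apply: H; first lra.
  by move: x01 => /andP[? ?]; apply/andP; split; lra.
have x0h : 0 < x <= 2^-1 by rewrite x0.
apply: le_trans (rise_le s1 x0h) _; rewrite lee_fin -/L.
have px : barrier x = odds x by apply: barrier_left; apply/andP; split; lra.
have b0 : 0 < odds x <= 1.
  by rewrite -px barrier_le1 barrier_gt0//; apply/andP; split; lra.
have w0 : 0 <= odds_weight (odds x).
  by case/andP: b0 => b0 _; rewrite divr_ge0 ?exprn_ge0 ?addr_ge0 ?sqr_ge0 ?(ltW b0).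
rewrite px; have := odds_weight_le b0; move=> H.
have : odds_weight (odds x) * L <= 4 / odds x * `|L|.
  apply: (@le_trans _ _ (odds_weight (odds x) * `|L|)).
    by rewrite ler_wpM2l// ler_norm.
  by rewrite ler_wpM2r.
by rewrite mulrAC; lra.
Qed.

End supersolution.

(** * Truncation by the barrier *)

Section hardy.
Context {R : realType}.
Local Notation mu := (@lebesgue_measure R).
Implicit Types (x y : R) (w : R -> R).

Lemma energy_iterated w : measurable_fun setT w ->
  (energy w = \int[mu]_x \int[mu]_y ((w x - w y) ^+ 2 * kern x y)%:E)%E.
Proof.
move=> mw; rewrite /energy fubini_tonelli1//.
- exact: measurable_energy_integrand.
- by move=> p; rewrite lee_fin mulr_ge0 ?sqr_ge0 ?kern_ge0.
Qed.

(* The exterior of the interval contributes a multiple of [w x ^+ 2 / dist01 x]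
   to the energy, as [w] vanishes there. *)
Let exterior x : 0 < x < 1 -> exists2 B : set R, measurable B &
  (forall y, B y -> ~ `]0, 1[%classic y) /\
  (((2 * dist01 x)^-1)%:E <= \int[mu]_(y in B) (kern x y)%:E)%E.
Proof.
move=> /andP[x0 x1]; have [xh|xh] := leP x 2^-1.
  exists `[- x, 0]%classic; first exact: measurable_itv.
  split=> [y /=|]; first by rewrite !in_itv/= => /andP[_ y0] /andP[? _]; lra.
  rewrite integral_kern_itv; [|lra|by left].
  rewrite lee_fin dist01_left; last lra.
  rewrite le_eqVlt; apply/orP; left; apply/eqP; rewrite sub0r.
  by field; rewrite gt_eqF//= lt_eqF//; lra.
exists `[1, 2 - x]%classic; first exact: measurable_itv.
split=> [y /=|]; first by rewrite !in_itv/= => /andP[y0 _] /andP[_ ?]; lra.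
rewrite integral_kern_itv; [|lra|by right].
rewrite lee_fin -dist01_onem dist01_left; last lra.
rewrite le_eqVlt; apply/orP; left; apply/eqP.
by field; rewrite !gt_eqF//; lra.
Qed.

Lemma hardy w : measurable_fun setT w ->
  {ae mu, forall x, ~ `]0, 1[%classic x -> w x = 0} ->
  (\int[mu]_x (w x ^+ 2 / (2 * dist01 x))%:E <= energy w)%E.
Proof.
move=> mw w0; rewrite energy_iterated//.
have md : measurable_fun setT (@dist01 R) by rewrite /dist01; measure_tac.
have mF := measurable_energy_integrand mw.
have F0 (p : R * R) : (0 <= ((w p.1 - w p.2) ^+ 2 * kern p.1 p.2)%:E)%E.
  by rewrite lee_fin mulr_ge0 ?sqr_ge0 ?kern_ge0.
have d0 x : 0 <= dist01 x by case/andP: (dist01_bound x).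
apply: ge0_le_integral => //.
- by move=> x _; rewrite lee_fin divr_ge0 ?sqr_ge0// mulr_ge0.
- by apply/measurable_EFinP; measure_tac.
- exact: (@measurable_fun_fubini_tonelli_F _ _ _ _ R mu
    (fun p => ((w p.1 - w p.2) ^+ 2 * kern p.1 p.2)%:E)).
move=> x _; have [x01|x01] := boolP (0 < x < 1); last first.
  rewrite dist01_out// mulr0 invr0 mulr0.
  by apply: integral_ge0 => y _; exact: (F0 (x, y)).
have [B mB [Bout HB]] := exterior x01.
have mk D : measurable_fun D (fun y => (kern x y)%:E).
  by apply/measurable_EFinP/measurable_funTS; exact: measurable_kernr.
have mFx D : measurable_fun D (fun y => ((w x - w y) ^+ 2 * kern x y)%:E).
  apply/measurable_EFinP/measurable_funTS.
  by have ? := @measurable_kernr R x; measure_tac.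
rewrite EFinM.
apply: (@le_trans _ _ (\int[mu]_(y in B) ((w x ^+ 2) * kern x y)%:E)%E).
  under eq_integral do rewrite EFinM.
  rewrite ge0_integralZl_EFin ?sqr_ge0//; last exact: mk; last first.
    by move=> y _; rewrite lee_fin kern_ge0.
  by rewrite lee_wpmul2l ?lee_fin ?sqr_ge0.
apply: (@le_trans _ _ (\int[mu]_(y in B) ((w x - w y) ^+ 2 * kern x y)%:E)%E).
  apply: ae_ge0_le_integral => //.
  - by move=> y _; rewrite lee_fin mulr_ge0 ?sqr_ge0 ?kern_ge0.
  - apply/measurable_EFinP/measurable_funTS.
    by have ? := @measurable_kernr R x; measure_tac.
  - by move=> y _; exact: (F0 (x, y)).
  - exact: mFx.
  apply: ae_weaken w0 => y wy By.
  by rewrite lee_fin wy ?subr0//; exact: Bout.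
apply: ge0_subset_integral => //; first exact: mFx.
by move=> y _; exact: (F0 (x, y)).
Qed.

End hardy.

(** * Energies cut off near the diagonal *)

Section barrier_truncation.
Context {R : realType}.
Local Notation mu := (@lebesgue_measure R).
Implicit Types (sigma k x y : R) (v w : R -> R).

Lemma far_mono sigma sigma' x y : 0 <= sigma -> sigma <= sigma' ->
  far sigma' x y -> far sigma x y.
Proof.
move=> s0 ss; rewrite /far; have [/andP[]|//] := boolP ((0 < x < 1) && (0 < y < 1)).
move=> /andP[x0 x1] /andP[y0 y1] /=.
have ss2 : sigma ^+ 2 <= sigma' ^+ 2 by rewrite lerXn2r ?nnegrE// (le_trans s0).
have a0 : 0 <= x * (1 - y) by rewrite mulr_ge0//; lra.
have b0 : 0 <= y * (1 - x) by rewrite mulr_ge0//; lra.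
by move=> /orP[h|h]; apply/orP; [left|right]; apply: le_trans h;
  rewrite ler_wpM2r.
Qed.

Definition cutoff (n : nat) : R := 1 + n.+1%:R^-1.

Lemma cutoff_gt1 n : 1 < cutoff n.
Proof. by rewrite /cutoff ltrDl invr_gt0. Qed.

Lemma cutoff_decr m n : (m <= n)%N -> cutoff n <= cutoff m.
Proof. by move=> mn; rewrite /cutoff lerD2l lef_pV2 ?posrE// ler_nat ltnS. Qed.

Lemma far_cutoff x y : x != y -> \forall n \near \oo, far (cutoff n) x y.
Proof.
move=> xy; have [/andP[]|out] := boolP ((0 < x < 1) && (0 < y < 1)); last first.
  by near=> n; rewrite /far out.
move=> /andP[x0 x1] /andP[y0 y1].
(* For [h <= 1] one has [(1 + h) ^+ 2 <= 1 + 3 * h], and [y * (1 - x)] differs from [x * (1 - y)] by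
   exactly [y - x]; both products are at most 1, so [3 * h < |y - x|] suffices. *)
have e : 0 < `|y - x| / 3 by rewrite divr_gt0// normr_gt0 subr_eq0 eq_sym.
near=> n.
have : n.+1%:R^-1 < `|y - x| / 3 by near: n; exact: (near_infty_natSinv_lt (PosNum e)).
rewrite /far x0 x1 y0 y1/= /cutoff.
have : 0 < (n.+1%:R^-1 : R) by rewrite invr_gt0.
have : (n.+1%:R^-1 : R) <= 1 by rewrite invf_le1// ler1n.
set h := n.+1%:R^-1 => h1 h0 hs.
have b0 : 0 < x * (1 - y) <= 1 by apply/andP; split; nra.
have a0 : 0 < y * (1 - x) <= 1 by apply/andP; split; nra.
have hh : (1 + h) ^+ 2 <= 1 + 3 * h by nra.
have [yx|xy'] := leP x y.
  rewrite ger0_norm in hs; last lra.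
  apply/orP; left.
  have : (1 + h) ^+ 2 * (x * (1 - y)) <= (1 + 3 * h) * (x * (1 - y)).
    by rewrite ler_wpM2r//; case/andP: b0 => /ltW.
  move: b0 hs; set b := x * (1 - y) => b0 hs H; apply: le_trans H _.
  have -> : y * (1 - x) = b + (y - x) by rewrite /b; lra.
  nra.
rewrite ltr0_norm in hs; last lra.
apply/orP; right.
have : (1 + h) ^+ 2 * (y * (1 - x)) <= (1 + 3 * h) * (y * (1 - x)).
  by rewrite ler_wpM2r//; case/andP: a0 => /ltW.
move: a0 hs; set a := y * (1 - x) => a0 hs H; apply: le_trans H _.
have -> : x * (1 - y) = a + (x - y) by rewrite /a; lra.
nra.
Unshelve. all: by end_near. Qed.

Definition cut_energy sigma w : \bar R :=
  (\int[(mu \x mu)%E]_p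
     ((far sigma p.1 p.2)%:R * ((w p.1 - w p.2) ^+ 2 * kern p.1 p.2))%:E)%E.

Lemma measurable_cut_integrand sigma w : measurable_fun setT w ->
  measurable_fun setT (fun p : R * R =>
    ((far sigma p.1 p.2)%:R * ((w p.1 - w p.2) ^+ 2 * kern p.1 p.2))%:E).
Proof.
move=> mw; apply/measurable_EFinP; apply: measurable_funM.
  exact: measurable_far.
by have /measurable_EFinP := measurable_energy_integrand mw.
Qed.

Lemma cut_integrand_ge0 sigma w (p : R * R) :
  (0 <= ((far sigma p.1 p.2)%:R * ((w p.1 - w p.2) ^+ 2 * kern p.1 p.2))%:E)%E.
Proof. by rewrite lee_fin mulr_ge0// mulr_ge0 ?sqr_ge0 ?kern_ge0. Qed.

Lemma cut_energy_le sigma w : measurable_fun setT w ->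
  (cut_energy sigma w <= energy w)%E.
Proof.
move=> mw; apply: ge0_le_integral => //.
- by move=> p _; exact: cut_integrand_ge0.
- exact: measurable_cut_integrand.
- exact: measurable_energy_integrand.
move=> p _; rewrite lee_fin; case: (far _ _ _); rewrite ?mul1r// mul0r.
by rewrite mulr_ge0 ?sqr_ge0 ?kern_ge0.
Qed.

(** The regions [far (cutoff n)] increase and exhaust everything off the diagonal, where the kernel
    is 0 anyway; monotone convergence applies. *)
Lemma energy_le_cut w (M : \bar R) : measurable_fun setT w ->
  (forall n, cut_energy (cutoff n) w <= M)%E -> (energy w <= M)%E.
Proof.
move=> mw HM; rewrite /energy.
pose f n (p : R * R) :=
  ((far (cutoff n) p.1 p.2)%:R * ((w p.1 - w p.2) ^+ 2 * kern p.1 p.2))%:E.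
have mf n : measurable_fun setT (f n) by exact: measurable_cut_integrand.
have f0 n p : (0 <= f n p)%E by exact: cut_integrand_ge0.
have fd p : {homo f ^~ p : m n / (m <= n)%N >-> (m <= n)%E}.
  move=> m n mn; rewrite /f lee_fin ler_wpM2r//; first by rewrite mulr_ge0 ?sqr_ge0 ?kern_ge0.
  rewrite ler_nat; have [/far_mono H|//] := boolP (far (cutoff m) p.1 p.2).
  by rewrite H ?cutoff_decr// (le_trans ler01)// ltW// cutoff_gt1.
have -> : (\int[(mu \x mu)%E]_p ((w p.1 - w p.2) ^+ 2 * kern p.1 p.2)%:E =
    \int[(mu \x mu)%E]_p (limn (f ^~ p)))%E.
  apply: eq_integral => -[x y] _ /=; apply/esym/cvg_lim => //.
  have [->|xy] := eqVneq x y.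
    rewrite kern_xx mulr0 (_ : f ^~ _ = cst 0%E); first exact: cvg_cst.
    by apply/funext => n; rewrite /f/= kern_xx !mulr0.
  apply: cvg_near_cst; near=> n; rewrite /f/= (_ : far _ _ _) ?mul1r//.
  by near: n; exact: far_cutoff.
rewrite monotone_convergence//.
apply: lime_le; last by apply: nearW => n; exact: HM.
apply: ereal_nondecreasing_is_cvgn => m n mn; apply: ge0_le_integral => //.
- exact: mf.
- exact: mf.
- by move=> p _; exact: fd.
Unshelve. all: by end_near. Qed.

End barrier_truncation.

Section barrier_energy.
Context {R : realType}.
Local Notation mu := (@lebesgue_measure R).
Implicit Types (sigma k x y : R) (v w : R -> R).

Lemma measurable_rise_kern_swap sigma :
  measurable_fun setT (fun p : R * R => rise_kern sigma p.2 p.1).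
Proof.
rewrite (_ : (fun p => _) =
  (fun p : R * R => rise_kern sigma p.1 p.2) \o (fun p => (p.2, p.1)))//.
by apply: measurableT_comp; [exact: measurable_rise_kern|exact: measurable_swap].
Qed.

Lemma measurable_rise sigma : measurable_fun setT (rise sigma : R -> \bar R).
Proof.
apply: (@measurable_fun_fubini_tonelli_F _ _ _ _ R mu
  (fun p : R * R => (rise_kern sigma p.1 p.2)%:E)).
- by apply/measurable_EFinP; exact: measurable_rise_kern.
- by move=> p; rewrite lee_fin rise_kern_ge0.
Qed.

Lemma measurable_fall sigma : measurable_fun setT (fall sigma : R -> \bar R).
Proof.
apply: (@measurable_fun_fubini_tonelli_F _ _ _ _ R mu
  (fun p : R * R => (rise_kern sigma p.2 p.1)%:E)).
- by apply/measurable_EFinP; exact: measurable_rise_kern_swap.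
- by move=> p; rewrite lee_fin rise_kern_ge0.
Qed.

Lemma rise_ge0 sigma x : (0 <= rise sigma x)%E.
Proof. by apply: integral_ge0 => y _; rewrite lee_fin rise_kern_ge0. Qed.

Lemma fall_ge0 sigma x : (0 <= fall sigma x)%E.
Proof. by apply: integral_ge0 => y _; rewrite lee_fin rise_kern_ge0. Qed.

Section integrals.
Variables (sigma : R) (v : R -> R).
Hypotheses (mv : measurable_fun setT v) (v0 : forall x, 0 <= v x).

Let mv1 := measurable_comp_fst mv.
Let mv2 := measurable_comp_snd mv.
Let mr := measurable_rise_kern sigma.
Let ms := measurable_rise_kern_swap sigma.

Let scale_out x (h : R -> R) : measurable_fun setT h -> (forall y, 0 <= h y) ->
  (\int[mu]_y (v x * h y)%:E = (v x)%:E * \int[mu]_y (h y)%:E)%E.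
Proof. by move=> mh h0; rewrite integral_scaled. Qed.

Lemma integral_rise_fst : (\int[(mu \x mu)%E]_p
  (v p.1 * rise_kern sigma p.1 p.2)%:E = \int[mu]_x ((v x)%:E * rise sigma x))%E.
Proof.
rewrite fubini_tonelli1//=.
- apply: eq_integral => x _; rewrite /fubini_F/= scale_out//.
    exact: measurable_rise_kernr.
  by move=> y; exact: rise_kern_ge0.
- by apply/measurable_EFinP; apply: measurable_funM.
- by move=> p; rewrite lee_fin mulr_ge0 ?rise_kern_ge0.
Qed.

Lemma integral_rise_snd : (\int[(mu \x mu)%E]_p
  (v p.2 * rise_kern sigma p.2 p.1)%:E = \int[mu]_x ((v x)%:E * rise sigma x))%E.
Proof.
rewrite fubini_tonelli2//=.
- apply: eq_integral => x _; rewrite /fubini_G/= scale_out//.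
    exact: measurable_rise_kernr.
  by move=> y; exact: rise_kern_ge0.
- by apply/measurable_EFinP; apply: measurable_funM.
- by move=> p; rewrite lee_fin mulr_ge0 ?rise_kern_ge0.
Qed.

Lemma integral_fall_fst : (\int[(mu \x mu)%E]_p
  (v p.1 * rise_kern sigma p.2 p.1)%:E = \int[mu]_x ((v x)%:E * fall sigma x))%E.
Proof.
rewrite fubini_tonelli1//=.
- apply: eq_integral => x _; rewrite /fubini_F/= scale_out//.
    exact: measurable_rise_kernl.
  by move=> y; exact: rise_kern_ge0.
- by apply/measurable_EFinP; apply: measurable_funM.
- by move=> p; rewrite lee_fin mulr_ge0 ?rise_kern_ge0.
Qed.

Lemma integral_fall_snd : (\int[(mu \x mu)%E]_p
  (v p.2 * rise_kern sigma p.1 p.2)%:E = \int[mu]_x ((v x)%:E * fall sigma x))%E.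
Proof.
rewrite fubini_tonelli2//=.
- apply: eq_integral => x _; rewrite /fubini_G/= scale_out//.
    exact: measurable_rise_kernl.
  by move=> y; exact: rise_kern_ge0.
- by apply/measurable_EFinP; apply: measurable_funM.
- by move=> p; rewrite lee_fin mulr_ge0 ?rise_kern_ge0.
Qed.

End integrals.

Definition cap k w x : R := clamp (k * barrier x) (w x).

Lemma measurable_cap k w : measurable_fun setT w -> measurable_fun setT (cap k w).
Proof.
move=> mw; apply: measurable_clamp => //.
by apply: measurable_funM => //; exact: measurable_barrier.
Qed.

Let cap_bound_ge0 k x : 0 <= k -> 0 <= k * barrier x.
Proof. by move=> k0; rewrite mulr_ge0 ?barrier_ge0. Qed.

(** Where [w] is cut, [|w| >= k * barrier], hence [|w| / barrier <= w ^+ 2 / (k * barrier ^+ 2)]. As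
    [barrier ^+ 2] dominates the distance, Hardy's inequality bounds the integral by the energy. *)
Lemma rise_gap_lty sigma k w : 1 < sigma -> 0 < k -> measurable_fun setT w ->
  {ae mu, forall x, ~ `]0, 1[%classic x -> w x = 0} -> (energy w < +oo)%E ->
  (\int[mu]_x ((`|w x - cap k w x|)%:E * rise sigma x) < +oo)%E.
Proof.
move=> s1 k0 mw w0 ew; have [C C0 HC] := rise_bound s1.
have mc := measurable_cap k mw.
have md : measurable_fun setT (@dist01 R) by rewrite /dist01; measure_tac.
have mr := measurable_rise sigma.
have d0 x : 0 <= dist01 x by case/andP: (dist01_bound x).
have c0 : 0 <= 2 * C / k by rewrite divr_ge0 ?mulr_ge0// ltW.
have h0 x : 0 <= w x ^+ 2 / (2 * dist01 x).
  by rewrite divr_ge0 ?sqr_ge0// mulr_ge0.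
apply: (@le_lt_trans _ _
    (\int[mu]_x ((2 * C / k) * (w x ^+ 2 / (2 * dist01 x)))%:E)%E); last first.
  rewrite integral_scaled//; last by measure_tac.
  rewrite lte_mul_pinfty ?lee_fin//.
  by apply: le_lt_trans ew; exact: hardy.
apply: ae_ge0_le_integral => //.
- by move=> x _; rewrite mule_ge0 ?lee_fin ?rise_ge0.
- apply: emeasurable_funM => //; apply/measurable_EFinP; measure_tac.
- by move=> x _; rewrite lee_fin mulr_ge0.
- by apply/measurable_EFinP; measure_tac.
apply: ae_weaken w0 => x wx _; have [x01|x01] := boolP (0 < x < 1); last first.
  rewrite wx; last by rewrite /= in_itv/=; exact/negP.
  rewrite sub0r normrN.
  have := clamp_norm_le 0 (cap_bound_ge0 x (ltW k0)); rewrite normr0 => h.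
  rewrite (_ : `|cap k w x| = 0); last first.
    by apply/eqP; rewrite eq_le normr_ge0 andbT /cap wx//= in_itv/=; exact/negP.
  by rewrite mul0e expr0n/= mul0r mulr0.
have [b0 b2] := (barrier_gt0 x01, barrier_sqr_ge x).
have dx := dist01_gt0 x01.
have [] := clampP (w x) (cap_bound_ge0 x (ltW k0)) => -[wk wE].
2: rewrite /cap wE subrr normr0 mul0e lee_fin mulr_ge0//;
  by rewrite divr_ge0 ?mulr_ge0 ?sqr_ge0 ?(ltW k0).
all: have {}wk : k * barrier x <= `|w x| by rewrite ler_normr;
  apply/orP; first [by left; lra | by right; lra].
all: apply: (@le_trans _ _ ((`|w x|)%:E * (C / barrier x)%:E)%E);
  first by rewrite lee_pmul ?lee_fin ?rise_ge0 ?HC// soft_norm_le// cap_bound_ge0// ltW.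
all: rewrite -EFinM lee_fin.
all: have -> : 2 * C / k * (w x ^+ 2 / (2 * dist01 x)) =
    C * (`|w x| ^+ 2 / (k * dist01 x)) by
  rewrite real_normK ?num_real//; field; rewrite !gt_eqF.
all: rewrite mulrCA ler_wpM2l// ler_pdivrMr// -mulrAC ler_pdivlMr ?mulr_gt0//.
all: move: wk b2; move: (`|w x|) (normr_ge0 (w x)) => a a0 wk b2.
all: rewrite expr2 -!mulrA ler_wpM2l//.
all: nra.
Qed.

End barrier_energy.

Section barrier_truncation_energy.
Context {R : realType}.
Local Notation mu := (@lebesgue_measure R).
Implicit Types (sigma k x y : R) (v w : R -> R).

(* [clamp_pair] integrated over [far]; the integrals against [rise] and [fall]
   would diverge without the cut-off. *)
Lemma cut_energy_cap sigma k w : 0 <= k -> measurable_fun setT w ->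
  (cut_energy sigma (cap k w) + (2 * k)%:E *
     (\int[mu]_x ((`|w x - cap k w x|)%:E * fall sigma x) +
      \int[mu]_x ((`|w x - cap k w x|)%:E * fall sigma x)) <=
   cut_energy sigma w + (2 * k)%:E *
     (\int[mu]_x ((`|w x - cap k w x|)%:E * rise sigma x) +
      \int[mu]_x ((`|w x - cap k w x|)%:E * rise sigma x)))%E.
Proof.
move=> k0 mw.
set falls := (\int[mu]_x (_ * fall _ _))%E.
set rises := (\int[mu]_x (_ * rise _ _))%E.
have mc := measurable_cap k mw.
pose v x := `|w x - cap k w x|.
have mv : measurable_fun setT v by rewrite /v; measure_tac.
have v0 x : 0 <= v x by rewrite /v.
have k20 : 0 <= 2 * k by rewrite mulr_ge0.
pose rk (p : R * R) := rise_kern sigma p.1 p.2.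
pose sk (p : R * R) := rise_kern sigma p.2 p.1.
have rk0 p : 0 <= rk p by exact: rise_kern_ge0.
have sk0 p : 0 <= sk p by exact: rise_kern_ge0.
have mrk : measurable_fun setT rk by exact: measurable_rise_kern.
have msk : measurable_fun setT sk by exact: measurable_rise_kern_swap.
have mv1 := measurable_comp_fst mv; have mv2 := measurable_comp_snd mv.
(* Falls stay on the left and rises on the right, so that each side is the integral of one
   nonnegative function and no infinite quantities are subtracted. *)
have add (h1 h2 : R * R -> R) z (H1 H2 : \bar R) : measurable_fun setT z ->
    measurable_fun setT h1 -> measurable_fun setT h2 ->
    (forall p, 0 <= h1 p) -> (forall p, 0 <= h2 p) ->
    (\int[(mu \x mu)%E]_p (h1 p)%:E = H1)%E ->
    (\int[(mu \x mu)%E]_p (h2 p)%:E = H2)%E ->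
    (cut_energy sigma z + (2 * k)%:E * (H1 + H2) =
     \int[(mu \x mu)%E]_p ((far sigma p.1 p.2)%:R *
       ((z p.1 - z p.2) ^+ 2 * kern p.1 p.2) + 2 * k * (h1 p + h2 p))%:E)%E.
  move=> mz mh1 mh2 h10 h20 <- <-; under [RHS]eq_integral do rewrite EFinD.
  have mh : measurable_fun setT (fun p : R * R => (h1 p + h2 p)%:E).
    by apply/measurable_EFinP; apply: measurable_funD.
  rewrite ge0_integralD//.
  - congr (_ + _)%E.
    under [RHS]eq_integral do rewrite EFinM.
    rewrite ge0_integralZl_EFin//.
      congr (_ * _)%E; under [RHS]eq_integral do rewrite EFinD.
      rewrite ge0_integralD//; first by move=> p _; rewrite lee_fin.
        exact/measurable_EFinP.
        by move=> p _; rewrite lee_fin.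
        exact/measurable_EFinP.
    by move=> p _; rewrite lee_fin addr_ge0.
  - by move=> p _; exact: cut_integrand_ge0.
  - exact: measurable_cut_integrand.
  - by move=> p _; rewrite lee_fin mulr_ge0// addr_ge0.
  - by apply/measurable_EFinP; apply: measurable_funM => //; apply/measurable_EFinP.
have m1s : measurable_fun setT (fun p : R * R => v p.1 * sk p) by apply: measurable_funM.
have m2r : measurable_fun setT (fun p : R * R => v p.2 * rk p) by apply: measurable_funM.
have m1r : measurable_fun setT (fun p : R * R => v p.1 * rk p) by apply: measurable_funM.
have m2s : measurable_fun setT (fun p : R * R => v p.2 * sk p) by apply: measurable_funM.
have p1s p : 0 <= v p.1 * sk p by rewrite mulr_ge0.
have p2r p : 0 <= v p.2 * rk p by rewrite mulr_ge0.
have p1r p : 0 <= v p.1 * rk p by rewrite mulr_ge0.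
have p2s p : 0 <= v p.2 * sk p by rewrite mulr_ge0.
have -> := add _ _ _ _ _ mc m1s m2r p1s p2r (integral_fall_fst sigma mv v0)
  (integral_fall_snd sigma mv v0).
have -> := add _ _ _ _ _ mw m1r m2s p1r p2s (integral_rise_fst sigma mv v0)
  (integral_rise_snd sigma mv v0).
have mI (z : R -> R) (h1 h2 : R * R -> R) : measurable_fun setT z ->
    measurable_fun setT h1 -> measurable_fun setT h2 ->
    measurable_fun setT (fun p : R * R => ((far sigma p.1 p.2)%:R *
       ((z p.1 - z p.2) ^+ 2 * kern p.1 p.2) + 2 * k * (h1 p + h2 p))%:E).
  move=> mz mh1 mh2; apply/measurable_EFinP; apply: measurable_funD.
    by have /measurable_EFinP := measurable_cut_integrand sigma mz.
  by apply: measurable_funM => //; apply: measurable_funD.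
have I0 (z : R -> R) (h1 h2 : R * R -> R) (p : R * R) : 0 <= h1 p -> 0 <= h2 p ->
    (0 <= ((far sigma p.1 p.2)%:R *
       ((z p.1 - z p.2) ^+ 2 * kern p.1 p.2) + 2 * k * (h1 p + h2 p))%:E)%E.
  move=> h1_0 h2_0; rewrite EFinD adde_ge0 ?cut_integrand_ge0//.
  by rewrite lee_fin mulr_ge0// addr_ge0.
apply: ge0_le_integral => //.
- by move=> p _; exact: (I0 (cap k w) (fun p => v p.1 * sk p)
    (fun p => v p.2 * rk p) p (p1s p) (p2r p)).
- exact: (mI _ _ _ mc m1s m2r).
- exact: (mI _ _ _ mw m1r m2s).
move=> [x y] _ /=; rewrite lee_fin /rk /sk/= /rise_kern -(farC sigma x y) -(kernC x y).
have := clamp_pair (w x) (w y) (_ : 0 <= k * barrier x) (_ : 0 <= k * barrier y).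
rewrite -/(cap k w x) -/(cap k w y) -/(v x) -/(v y).
move=> /(_ (mulr_ge0 k0 (barrier_ge0 _)) (mulr_ge0 k0 (barrier_ge0 _))).
set F := ((far sigma x y)%:R : R); have F0 : 0 <= F by [].
have := kern_ge0 x y; move: (kern x y) F F0 => K F F0 K0.
move: (_ ^+ 2) (_ ^+ 2) => A B.
have -> : k * barrier x - k * barrier y =
    k * (Num.max 0 (barrier x - barrier y) - Num.max 0 (barrier y - barrier x)).
  rewrite -mulrBr; congr (_ * _).
  by have [?|?] := leP 0 (barrier x - barrier y);
    have [?|?] := leP 0 (barrier y - barrier x); lra.
have -> : k * barrier y - k * barrier x =
    k * (Num.max 0 (barrier y - barrier x) - Num.max 0 (barrier x - barrier y)).
  rewrite -mulrBr; congr (_ * _).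
  by have [?|?] := leP 0 (barrier x - barrier y);
    have [?|?] := leP 0 (barrier y - barrier x); lra.
move: (Num.max _ _) (Num.max _ _) => P Q H.
have := ler_wpM2l (mulr_ge0 K0 F0) H; lra.
Qed.

(** At each cut-off the falls exceed the rises by a quarter of the integral of the cut part; they
    occur twice with the factor [2 * k], which makes [k]. The finite rises cancel, and the resulting
    bound is uniform in the cut-off, which can then be removed. *)
Theorem energy_cap k w : 0 < k -> measurable_fun setT w ->
  {ae mu, forall x, ~ `]0, 1[%classic x -> w x = 0} -> (energy w < +oo)%E ->
  (energy (cap k w) + k%:E * \int[mu]_x (`|w x - cap k w x|)%:E <= energy w)%E.
Proof.
move=> k0 mw w0 ew.
have mc := measurable_cap k mw.
pose v x := `|w x - cap k w x|.
have mv : measurable_fun setT v by rewrite /v; measure_tac.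
have v0 x : 0 <= v x by rewrite /v.
(* [rise_fall] speaks of interior points; elsewhere the weight [v] has to vanish. *)
have vae : {ae mu, forall x, ~ `]0, 1[%classic x -> v x = 0}.
  apply: ae_weaken w0 => x wx xI; rewrite /v /cap wx//.
  have cb : 0 <= k * barrier x by rewrite mulr_ge0 ?barrier_ge0// ltW.
  have := clamp_norm_le 0 cb; rewrite normr0 normr_le0 => /eqP ->.
  by rewrite subrr normr0.
set V := (\int[mu]_x (v x)%:E)%E.
have V0 : (0 <= V)%E by apply: integral_ge0 => x _; rewrite lee_fin.
have key n : (cut_energy (cutoff n) (cap k w) + k%:E * V <= energy w)%E.
  have s1 := @cutoff_gt1 R n; move: (cutoff n) s1 => s s1.
  have := cut_energy_cap s (ltW k0) mw => /=.
  have := rise_gap_lty s1 k0 mw w0 ew.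
  rewrite -/v; set A := (\int[mu]_x (_ * rise _ _))%E.
  set B := (\int[mu]_x (_ * fall _ _))%E => Afin H.
  have mr := measurable_rise s; have mf := measurable_fall s.
  have mvr : measurable_fun setT (fun x => ((v x)%:E * rise s x)%E).
    by apply: emeasurable_funM => //; apply/measurable_EFinP.
  have A0 : (0 <= A)%E.
    by apply: integral_ge0 => x _; rewrite mule_ge0 ?lee_fin ?rise_ge0.
  have AB : (A + 4^-1%:E * V <= B)%E.
    have <- : (\int[mu]_x ((v x)%:E * rise s x + (4^-1 * v x)%:E) =
        A + 4^-1%:E * V)%E.
      rewrite ge0_integralD//.
      - by rewrite [X in (_ + X)%E]integral_scaled.
      - by move=> x _; rewrite mule_ge0 ?lee_fin ?rise_ge0.
      - by move=> x _; rewrite lee_fin mulr_ge0.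
      - by apply/measurable_EFinP; measure_tac.
    apply: ae_ge0_le_integral => //.
    - move=> x _; rewrite adde_ge0 ?mule_ge0 ?lee_fin ?rise_ge0//.
      by rewrite mulr_ge0.
    - by apply: emeasurable_funD => //; apply/measurable_EFinP; measure_tac.
    - by move=> x _; rewrite mule_ge0 ?lee_fin ?fall_ge0.
    - by apply: emeasurable_funM => //; apply/measurable_EFinP.
    apply: ae_weaken vae => x vx _; rewrite -/(v x).
    have [x01|x01] := boolP (0 < x < 1); last first.
      rewrite vx; last by rewrite /= in_itv/=; exact/negP.
      by rewrite !mul0e mulr0 adde0.
    rewrite mulrC EFinM -ge0_muleDr ?lee_fin ?rise_ge0//.
    by rewrite lee_wpmul2l ?lee_fin// rise_fall.
  have HE := cut_energy_le s mw.
  have : (cut_energy s (cap k w) + (2 * k)%:E * ((A + 4^-1%:E * V) + (A + 4^-1%:E * V))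
    <= cut_energy s w + (2 * k)%:E * (A + A))%E.
    apply: le_trans H; rewrite leeD2l// lee_wpmul2l ?lee_fin ?mulr_ge0 ?(ltW k0)//.
    by rewrite leeD.
  move: HE ew; rewrite -/V.
  have : (0 <= cut_energy s (cap k w))%E.
    by apply: integral_ge0 => p _; exact: cut_integrand_ge0.
  have : (0 <= cut_energy s w)%E.
    by apply: integral_ge0 => p _; exact: cut_integrand_ge0.
  move: (cut_energy s w) (cut_energy s (cap k w)) (energy w) => a b c.
  move: A A0 Afin {H AB B mvr} V V0 => A A0 Afin V V0.
  case: A A0 Afin => [A A0 _| |]//; case: a => [a| |]//; case: c => [c| |]//;
    case: b => [b| |]// a0 b0; rewrite ?lee_fin => ac _.
  - case: V V0 => [V V0| _|//].
      by rewrite /= !lee_fin; lra.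
    by rewrite gt0_muley ?lte_fin ?invr_gt0//= addeC/= gt0_muley ?lte_fin ?mulr_gt0.
  - case: V V0 => [V V0| _|//].
      by [].
    by rewrite gt0_muley ?lte_fin ?invr_gt0//= addeC/= gt0_muley ?lte_fin ?mulr_gt0.
have Vfin : (k%:E * V)%E \is a fin_num.
  rewrite ge0_fin_numE ?mule_ge0 ?lee_fin ?(ltW k0)//.
  apply: le_lt_trans ew; apply: le_trans (key 0%N); rewrite leeDr//.
  by apply: integral_ge0 => p _; exact: cut_integrand_ge0.
rewrite -leeBrDr//; apply: energy_le_cut => // n.
by rewrite leeBrDr.
Qed.

End barrier_truncation_energy.

Section barrier_Phi.
Context {R : realType}.
Local Notation mu := (@lebesgue_measure R).
Implicit Types (g w : R -> R) (k s : R).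

Lemma cap_norm_le k w x : 0 <= k -> `|cap k w x| <= `|w x|.
Proof. by move=> k0; rewrite clamp_norm_le// mulr_ge0 ?barrier_ge0. Qed.

Lemma cap_bound k w x : 0 <= k -> `|cap k w x| <= k * barrier x.
Proof. by move=> k0; rewrite clamp_bound// mulr_ge0 ?barrier_ge0. Qed.

(** The integral of [G] changes by at most [k / 2] times the integral of the cut part: exactly the
    half of the energy gain that [Phi] sees. *)
Theorem barrier_truncation g w k s : continuous g -> 0 < k ->
  (forall t, `|t| <= s -> `|g t| <= k / 2) ->
  measurable_fun setT w -> (forall x, `|w x| <= s) ->
  {ae mu, forall x, ~ `]0, 1[%classic x -> w x = 0} -> (energy w < +oo)%E ->
  Phi g (cap k w) <= Phi g w.
Proof.
move=> cg k0 gk mw ws w0 ew; have ener := energy_cap k0 mw w0 ew.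
have mc := measurable_cap k mw.
set V := (\int[mu]_x (`|w x - cap k w x|)%:E)%E in ener.
have V0 : (0 <= V)%E by apply: integral_ge0 => x _; rewrite lee_fin.
have Vfin : V \is a fin_num.
  rewrite ge0_fin_numE//; have : (k%:E * V < +oo)%E.
    apply: le_lt_trans ew; apply: le_trans ener; rewrite leeDr//.
    exact: energy_ge0.
  case: (V) V0 => [r _ _|_|] //; first by rewrite ltry.
  by rewrite gt0_muley.
apply: (@le_Phi R g (cap k w) w s (k / 2 * fine V)) => //.
- by move=> x; rewrite (le_trans (cap_norm_le _ _ (ltW k0))).
- apply: (@le_trans _ _ (\int[mu]_x (k / 2 * `|w x - cap k w x|)%:E)%E).
    rewrite integral_mkcond; apply: ge0_le_integral => //.
    + by move=> x _; rewrite patchE; case: ifPn.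
    + apply/(measurable_restrictT _ (measurable_itv _))/measurable_funTS.
      apply/measurable_EFinP/(measurableT_comp (@normr_measurable _ setT)).
      by apply: measurable_funB; exact: measurable_primitive_comp.
    + by apply/measurable_EFinP; measure_tac.
    move=> x _; rewrite patchE; case: ifPn => _; last first.
      by rewrite lee_fin mulr_ge0// divr_ge0// ltW.
    rewrite lee_fin /=; apply: (primitive_lip (continuous_integrable_itv cg)) => // t tz; apply: gk.
    apply: le_trans (ws x); have := cap_norm_le w x (ltW k0); move: tz.
    rewrite !ler_norml ge_min le_max => /andP[/orP t1 /orP t2] /andP[w1 w2].
    have := ler_norm (w x); have := ler_norm (- w x); rewrite normrN => ? ?.
    by apply/andP; split; [case: t1|case: t2]; lra.
  rewrite integral_scaled ?divr_ge0 ?(ltW k0)//; last by measure_tac.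
  by rewrite [in leRHS]EFinM fineK.
by rewrite (_ : 2 * (k / 2 * fine V) = k * fine V) ?EFinM ?fineK//; lra.
Qed.

End barrier_Phi.

(** * Regularization in the weighted space *)

Section steklov.
Context {R : realType}.
Local Notation mu := (@lebesgue_measure R).
Implicit Types (f q : R -> R) (h x y t L M : R).

Lemma bounded_integrable_itv f M : measurable_fun setT f ->
  (forall x, `|f x| <= M) -> forall a b, mu.-integrable `[a, b] (EFin \o f).
Proof.
move=> mf fM a b.
have mab : (mu (`[a, b]%classic : set R) < +oo)%E.
  by rewrite lebesgue_measure_itv/=; case: ifP => _; rewrite ?ltry// -EFinB ltry.
apply: measurable_bounded_integrable => //.
  exact: measurable_funTS.
exists M; split; first exact: num_real.
by move=> N MN x _; rewrite /= (le_trans (fM x))// ltW.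
Qed.

(** The mean of [f] over the window of radius [h]; in this form [primitive_lip] yields both its sup
    bound and its Lipschitz continuity. *)
Definition steklov f h x := (2 * h)^-1 * (primitive f (x + h) - primitive f (x - h)).

Lemma integral_itv_shift (F : R -> \bar R) a b x : measurable_fun setT F ->
  (forall y, 0 <= F y)%E ->
  (\int[mu]_(y in `[(a + x)%R, (b + x)%R]) F y =
   \int[mu]_(t in `[a, b]) F (t + x)%R)%E.
Proof.
move=> mF F0; rewrite integral_mkcond [RHS]integral_mkcond.
rewrite -(@ge0_integral_shift _ _ x).
- apply: eq_integral => t _; rewrite !patchE; congr (if _ then _ else _).
  by rewrite !mem_setE !in_itv/= !lerD2r.
- by apply/(measurable_restrictT _ (measurable_itv _))/measurable_funTS.
- by move=> y; rewrite patchE; case: ifP.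
Qed.

Lemma Rintegral_itv_shift f a b x : measurable_fun setT f ->
  \int[mu]_(y in `[a + x, b + x]) f y = \int[mu]_(t in `[a, b]) f (t + x).
Proof.
move=> mf; rewrite /Rintegral integralE [in RHS]integralE; congr (fine (_ - _)).
  have := @integral_itv_shift (EFin \o f)^\+%E a b x; rewrite unlock; apply.
    by apply/measurable_maxe => //; exact/measurable_EFinP.
  by move=> y; rewrite le_max lexx orbT.
have := @integral_itv_shift (EFin \o f)^\-%E a b x; rewrite unlock; apply.
  apply/measurable_maxe => //; apply: measurableT_comp => //.
  exact/measurable_EFinP.
by move=> y; rewrite le_max lexx orbT.
Qed.

(** With [a] the mean of [q], integrate [(q - a) ^+ 2 >= 0] over the window. *)
Lemma average_sqr_le q h M : 0 < h -> measurable_fun setT q ->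
  (forall t, `|q t| <= M) ->
  ((((2 * h)^-1 * \int[mu]_(t in `[(- h), h]) q t) ^+ 2)%:E <=
   (2 * h)^-1%:E * \int[mu]_(t in `[(- h)%R, h]) (q t ^+ 2)%:E)%E.
Proof.
move=> h0 mq qM; have iq := bounded_integrable_itv mq qM (- h) h.
have q2M t : `|q t ^+ 2| <= M ^+ 2.
  by rewrite normrX lerXn2r ?nnegrE ?(le_trans _ (qM t)).
have mq2 : measurable_fun setT (fun t => q t ^+ 2) by measure_tac.
have iq2 := bounded_integrable_itv mq2 q2M (- h) h.
have i1 (c : R) : mu.-integrable `[(- h), h] (EFin \o (fun=> c)).
  by apply: (@bounded_integrable_itv _ `|c|).
have h20 : 0 < 2 * h by rewrite mulr_gt0.
set a := _^-1 * _.
have aE : \int[mu]_(t in `[(- h), h]) q t = 2 * h * a.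
  by rewrite /a mulrA divff ?mul1r// gt_eqF.
rewrite -(@fineK _ (\int[mu]_(t in _) _)%E); last exact: integrable_fin_num iq2.
rewrite -EFinM lee_fin ler_pdivlMl//.
have : \int[mu]_(t in `[(- h), h]) (2 * a * q t - a ^+ 2 * 1) <=
    \int[mu]_(t in `[(- h), h]) (q t ^+ 2).
  have iZ : mu.-integrable `[(- h), h] (EFin \o (fun t => 2 * a * q t)).
    by apply: (integrableZl _ (2 * a) iq).
  apply: le_Rintegral => //; first exact: (integrableB _ iZ (i1 (a ^+ 2 * 1))).
  by move=> t _; rewrite mulr1; have := sqr_ge0 (q t - a); nra.
rewrite RintegralB//; last exact: (integrableZl _ (2 * a) iq).
rewrite RintegralZl// Rintegral_cst//= mulr1.
rewrite lebesgue_measure_itv/= lte_fin ifT/= => [|]; last lra.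
rewrite aE /Rintegral; move: (fine _) => J; nra.
Qed.

Section bounded.
Variables (f : R -> R) (M : R).
Hypotheses (mf : measurable_fun setT f) (fM : forall x, `|f x| <= M).

Let fi := bounded_integrable_itv mf fM.

Lemma steklovE h x : 0 < h ->
  steklov f h x = (2 * h)^-1 * \int[mu]_(t in `[(- h), h]) f (t + x).
Proof.
move=> h0; rewrite /steklov (primitive_sub fi); last lra.
by rewrite -Rintegral_itv_shift// ![_ + x]addrC.
Qed.

Lemma steklov_norm_le h x L : 0 < h ->
  (forall y, `|y - x| <= h -> `|f y| <= L) -> `|steklov f h x| <= L.
Proof.
move=> h0 fL; have h20 : 0 < 2 * h by rewrite mulr_gt0.
rewrite /steklov normrM gtr0_norm ?invr_gt0// ler_pdivrMl//.
have := @primitive_lip R f (x + h) (x - h) L fi.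
have -> : `|x + h - (x - h)| = 2 * h by rewrite gtr0_norm; lra.
rewrite [L * _]mulrC; apply => t; rewrite (min_idPr _) ?(max_idPl _); try lra.
by move=> /andP[t1 t2]; apply: fL; rewrite ler_norml; apply/andP; split; lra.
Qed.

Lemma steklov_lip h x y : 0 < h ->
  `|steklov f h x - steklov f h y| <= M / h * `|x - y|.
Proof.
move=> h0; have h20 : 0 < 2 * h by rewrite mulr_gt0.
rewrite /steklov -mulrBr normrM gtr0_norm ?invr_gt0// ler_pdivrMl//.
have -> : 2 * h * (M / h * `|x - y|) = M * `|x - y| + M * `|x - y|.
  by field; rewrite gt_eqF.
have l1 := @primitive_lip R f (x + h) (y + h) M fi (fun t _ => fM t).
have l2 := @primitive_lip R f (x - h) (y - h) M fi (fun t _ => fM t).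
have e1 : x + h - (y + h) = x - y by lra.
have e2 : x - h - (y - h) = x - y by lra.
rewrite e1 in l1; rewrite e2 in l2; apply: le_trans (lerD l1 l2).
rewrite (le_trans _ (ler_normB _ _))//.
have e (a b c d : R) : a - b - (c - d) = a - c - (b - d) by ring.
by rewrite e.
Qed.

Lemma continuous_steklov h : 0 < h -> continuous (steklov f h).
Proof.
move=> h0 x; have M0 : 0 <= M by apply: le_trans (fM 0).
have p0 : 0 < M / h + 1 by rewrite ltr_wpDl// divr_ge0// ltW.
apply/cvgrPdist_le => e e0; near=> y.
apply: (le_trans (steklov_lip x y h0)).
apply: (@le_trans _ _ ((M / h + 1) * `|x - y|)); first by rewrite ler_wpM2r// lerDl.
rewrite mulrC -ler_pdivlMr//.
near: y; apply: cvgr_dist_le; first exact: cvg_id.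
by rewrite divr_gt0.
Unshelve. all: end_near. Qed.

Lemma measurable_steklov h : 0 < h -> measurable_fun setT (steklov f h).
Proof. by move=> h0; exact: (continuous_measurable_fun (continuous_steklov h0)). Qed.

Lemma steklov_sqr_le h x y : 0 < h ->
  (((steklov f h x - steklov f h y) ^+ 2)%:E <=
   (2 * h)^-1%:E * \int[mu]_(t in `[(- h)%R, h])
      ((f (t + x)%R - f (t + y)%R) ^+ 2)%:E)%E.
Proof.
move=> h0; rewrite !steklovE// -mulrBr -RintegralB//.
- apply: (@average_sqr_le (fun t => f (t + x) - f (t + y)) h (M + M)) => //.
    apply: measurable_funB; apply: (measurableT_comp mf); exact: measurable_funD.
  by move=> t; rewrite (le_trans (ler_normB _ _))// lerD.
- apply: (@bounded_integrable_itv _ M) => //.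
  by apply: (measurableT_comp mf); exact: measurable_funD.
- apply: (@bounded_integrable_itv _ M) => //.
  by apply: (measurableT_comp mf); exact: measurable_funD.
Qed.

End bounded.

End steklov.

Section steklov_energy.
Context {R : realType}.
Local Notation mu := (@lebesgue_measure R).
Implicit Types (f : R -> R) (h x y t M : R).

Let energy_density f x : \bar R :=
  (\int[mu]_y ((f x - f y) ^+ 2 * kern x y)%:E)%E.

Let measurable_energy_density f : measurable_fun setT f ->
  measurable_fun setT (energy_density f).
Proof.
move=> mf; apply: (@measurable_fun_fubini_tonelli_F _ _ _ _ R mu
  (fun p : R * R => ((f p.1 - f p.2) ^+ 2 * kern p.1 p.2)%:E)).
- exact: measurable_energy_integrand.
- by move=> p; rewrite lee_fin mulr_ge0 ?sqr_ge0 ?kern_ge0.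
Qed.

Let energy_density_ge0 f x : (0 <= energy_density f x)%E.
Proof. by apply: integral_ge0 => y _; rewrite lee_fin mulr_ge0 ?sqr_ge0 ?kern_ge0. Qed.

Let energy_density_shift f x t : measurable_fun setT f ->
  (\int[mu]_y ((f (t + x)%R - f (t + y)%R) ^+ 2 * kern x y)%:E =
   energy_density f (t + x)%R)%E.
Proof.
move=> mf; rewrite /energy_density -[RHS](@ge0_integral_shift _ _ t).
- apply: eq_integral => y _; rewrite [(y + t)%R]addrC; congr ((_ * _)%:E).
  by rewrite /kern; congr (`|_| ^+ 2)^-1; lra.
- apply/measurable_EFinP; have ? := @measurable_kernr R (t + x).
  by measure_tac.
- by move=> y; rewrite lee_fin mulr_ge0 ?sqr_ge0 ?kern_ge0.
Qed.

(* Jensen's inequality, and the invariance of the energy under translations. *)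
Lemma energy_steklov f h M : 0 < h -> measurable_fun setT f ->
  (forall x, `|f x| <= M) -> (energy (steklov f h) <= energy f)%E.
Proof.
move=> h0 mf fM; have mz := measurable_steklov mf fM h0.
have c0 : 0 < (2 * h)^-1 by rewrite invr_gt0 mulr_gt0.
pose I : set R := `[(- h), h]%classic.
have mI : measurable I by exact: measurable_itv.
pose c t : R := (2 * h)^-1 * \1_I t.
have mc : measurable_fun setT c.
  by apply: measurable_funM => //; exact: measurable_indic.
have c_ge0 t : 0 <= c t by rewrite mulr_ge0// ltW.
have ft : measurable_fun setT (fun p : R * R => f (p.1 + p.2)).
  by apply: (measurableT_comp mf); exact: measurable_funD.
have intc : (\int[mu]_t (c t)%:E = 1)%E.
  rewrite integral_scaled_indic ?(ltW c0)// lebesgue_measure_itv/= lte_fin.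
  rewrite ifT; last lra.
  by rewrite -EFinB -EFinM; congr EFin; field; rewrite gt_eqF.
(* The energy density of the translate by [t], weighted by the averaging kernel; its integral in [x]
   is [c t] times the energy of [f]. *)
pose F (p : R * R) := ((c p.2)%:E * energy_density f (p.2 + p.1)%R)%E.
have mG := measurable_energy_density mf.
have mGp : measurable_fun setT (fun p : R * R => energy_density f (p.2 + p.1)%R).
  apply: (measurableT_comp mG); exact: measurable_funD.
have mF : measurable_fun setT F.
  apply: emeasurable_funM => //; apply/measurable_EFinP.
  exact: (measurable_comp_snd mc).
have F0 p : (0 <= F p)%E by rewrite mule_ge0 ?lee_fin ?energy_density_ge0.
rewrite energy_iterated//.
apply: (@le_trans _ _ (\int[mu]_x \int[mu]_t F (x, t))%E); last first.
  rewrite (@fubini_tonelli _ _ _ _ _ mu mu F)//=.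
  have -> : (\int[mu]_t \int[mu]_x F (x, t) =
      \int[mu]_t ((c t)%:E * energy f))%E.
    apply: eq_integral => t _; rewrite /F/=.
    rewrite ge0_integralZl_EFin//; last first.
      by apply: (measurableT_comp mG); exact: measurable_funD.
    congr (_ * _)%E; rewrite (energy_iterated mf) -/(energy_density f).
    have <- := ge0_integral_shift t mG (@energy_density_ge0 f).
    by apply: eq_integral => x _; rewrite addrC.
  rewrite ge0_integralZr ?energy_ge0//.
  - by rewrite intc mul1e.
  - exact/measurable_EFinP.
  - by move=> t _; rewrite lee_fin.
apply: ge0_le_integral => //.
- by move=> x _; apply: integral_ge0 => y _; rewrite lee_fin mulr_ge0 ?sqr_ge0 ?kern_ge0.
- apply: (@measurable_fun_fubini_tonelli_F _ _ _ _ R mu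
    (fun p : R * R => ((steklov f h p.1 - steklov f h p.2) ^+ 2 * kern p.1 p.2)%:E)).
  + exact: measurable_energy_integrand.
  + by move=> p; rewrite lee_fin mulr_ge0 ?sqr_ge0 ?kern_ge0.
- exact: (@measurable_fun_fubini_tonelli_F _ _ _ _ R mu F).
move=> x _.
pose H (p : R * R) := (c p.2 * ((f (p.2 + x) - f (p.2 + p.1)) ^+ 2 * kern x p.1))%:E.
have mk := measurable_comp_fst (@measurable_kernr R x).
have mc2 := measurable_comp_snd mc.
have mfx : measurable_fun setT (fun p : R * R => f (p.2 + x)).
  by apply: (measurableT_comp mf); exact: measurable_funD.
have mfy : measurable_fun setT (fun p : R * R => f (p.2 + p.1)).
  by apply: (measurableT_comp mf); exact: measurable_funD.
have mH : measurable_fun setT H by apply/measurable_EFinP; measure_tac.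
have H0 p : (0 <= H p)%E.
  by rewrite lee_fin mulr_ge0// mulr_ge0 ?sqr_ge0 ?kern_ge0.
apply: (@le_trans _ _ (\int[mu]_y \int[mu]_t H (y, t))%E); last first.
  rewrite (@fubini_tonelli _ _ _ _ _ mu mu H)//=.
  rewrite le_eqVlt; apply/orP; left; apply/eqP; apply: eq_integral => t _.
  rewrite /H /F/= integral_scaled//; first by rewrite energy_density_shift.
    have ? := @measurable_kernr R x.
    have ? : measurable_fun setT (fun y => f (t + y)).
      by apply: (measurableT_comp mf); exact: measurable_funD.
    by measure_tac.
  by move=> y; rewrite mulr_ge0 ?sqr_ge0 ?kern_ge0.
apply: ge0_le_integral => //.
- by move=> y _; rewrite lee_fin mulr_ge0 ?sqr_ge0 ?kern_ge0.
- apply/measurable_EFinP; have ? := @measurable_kernr R x; measure_tac.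
- exact: (@measurable_fun_fubini_tonelli_F _ _ _ _ R mu H).
move=> y _; rewrite EFinM.
have := steklov_sqr_le mf fM x y h0.
move=> /(fun H => lee_wpmul2r (_ : (0 <= (kern x y)%:E)%E) H).
rewrite lee_fin kern_ge0 => /(_ isT)/le_trans; apply.
set q := (fun t : R => (f (t + x) - f (t + y)) ^+ 2).
have mq : measurable_fun setT q.
  apply: measurable_funX; apply: measurable_funB; apply: (measurableT_comp mf);
    exact: measurable_funD.
have -> : (\int[mu]_(t in `[(- h)%R, h]) (q t)%:E = \int[mu]_t (\1_I t * q t)%:E)%E.
  rewrite integral_mkcond; apply: eq_integral => t _.
  by rewrite patchE indicE -/I; case: (t \in I); rewrite ?mul1r ?mul0r.
have m1 : measurable_fun setT (\1_I : R -> R) by exact: measurable_indic.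
rewrite -integral_scaled ?(ltW c0)//; last 2 first.
- exact: measurable_funM.
- by move=> t; rewrite mulr_ge0 ?sqr_ge0.
rewrite muleC -integral_scaled ?kern_ge0//; last 2 first.
- by apply: measurable_funM => //; exact: measurable_funM.
- by move=> t; rewrite mulr_ge0 ?(ltW c0)// mulr_ge0 ?sqr_ge0.
rewrite le_eqVlt; apply/orP; left; apply/eqP; apply: eq_integral => t _.
by rewrite /H /c/= /q; congr EFin; ring.
Qed.

End steklov_energy.

(** * Thresholded averages in the weighted space *)

Section approximation.
Context {R : realType}.
Local Notation mu := (@lebesgue_measure R).
Implicit Types (f u : R -> R) (h x y t L M theta eta K : R).

(** Separates two errors: [f] will be a soft threshold of [u] that varies with the parameter, while
    [davg] concerns the fixed [u], whose Lebesgue points do not vary. *)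
Lemma steklov_davg f u h x M theta : 0 < h ->
  measurable_fun setT f -> (forall y, `|f y| <= M) ->
  measurable_fun setT u -> (forall y, `|u y| <= M) ->
  (forall y, `|f y - u y| <= theta) ->
  ((`|steklov f h x - u x|)%:E <= theta%:E + davg u x h)%E.
Proof.
move=> h0 mf fM mu_ uM fu; have h20 : 0 < 2 * h by rewrite mulr_gt0.
pose I : interval R := `[x - h, x + h].
have M0 : 0 <= M := le_trans (normr_ge0 _) (uM 0).
have fi : mu.-integrable [set` I] (EFin \o f) := bounded_integrable_itv mf fM _ _.
have ib (q : R -> R) : measurable_fun setT q ->
    (forall y, `|q y| <= M + M) -> mu.-integrable [set` I] (EFin \o q).
  by move=> mq qM; exact: (bounded_integrable_itv mq qM).
have ci (c : R) : mu.-integrable [set` I] (EFin \o (fun=> c)).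
  by apply: (@bounded_integrable_itv _ _ `|c|).
have cI (c : R) : \int[mu]_(y in [set` I]) c = 2 * h * c.
  rewrite Rintegral_cst//= lebesgue_measure_itv/= lte_fin ifT /=; last lra.
  by lra.
have mD : measurable_fun setT (fun y => u y - u x) by measure_tac.
have iD : mu.-integrable [set` I] (EFin \o (fun y => `|u y - u x|)).
  apply: ib => [|y]; first by measure_tac.
  by rewrite normr_id (le_trans (ler_normB _ _))// lerD.
have -> : davg u x h =
    ((2 * h)^-1 * \int[mu]_(y in [set` I]) `|u y - u x|)%:E.
  have h2n : h *+ 2 = 2 * h by rewrite mulr_natl.
  rewrite /davg /iavg lebesgue_measure_ball ?(ltW h0)// h2n inver gt_eqF//.
  rewrite EFinM; congr (_ * _)%E.
  rewrite [X in integral _ X _](_ : _ = `]x - h, x + h[%classic); last exact: ball_itv.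
  rewrite /Rintegral fineK; last exact: integrable_fin_num iD.
  have mn : measurable_fun setT (fun y => (`|u y - u x|)%:E).
    by apply/measurable_EFinP; measure_tac.
  rewrite -integral_itv_obnd_cbnd; last exact: measurable_funTS.
  rewrite -integral_itv_bndo_bndc; last exact: measurable_funTS.
  by [].
rewrite -EFinD lee_fin.
have -> : theta = (2 * h)^-1 * \int[mu]_(y in [set` I]) theta.
  by rewrite cI mulKf// gt_eqF.
rewrite -mulrDr -RintegralD//.
rewrite /steklov (primitive_sub (bounded_integrable_itv mf fM)); last lra.
rewrite [X in _ - X](_ : u x = (2 * h)^-1 * \int[mu]_(y in [set` I]) u x); last first.
  by rewrite cI mulKf// gt_eqF.
rewrite -mulrBr normrM gtr0_norm ?invr_gt0// ler_wpM2l ?invr_ge0 ?(ltW h20)//.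
rewrite -RintegralB//.
have ifx : mu.-integrable [set` I] (EFin \o (fun y => f y - u x)).
  apply: ib => [|y]; first by measure_tac.
  by rewrite (le_trans (ler_normB _ _))// lerD.
apply: (le_trans (le_normr_Rintegral _ ifx)) => //.
apply: le_Rintegral => //; first exact: integrable_norm.
  apply: (@bounded_integrable_itv _ _ (`|theta| + (M + M))) => [|y].
    by measure_tac.
  by rewrite (le_trans (ler_normD _ _))// lerD// normr_id
    (le_trans (ler_normB _ _))// lerD.
move=> y _; have := ler_normD (f y - u y) (u y - u x).
by rewrite addrA subrK => /le_trans; apply; rewrite lerD2r.
Qed.

Lemma soft_norm_le_max (c r : R) : 0 <= c -> `|r - clamp c r| <= Num.max 0 (`|r| - c).
Proof.
move=> c0; rewrite le_max; have [] := clampP r c0 => -[H ->].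
- by apply/orP; right; rewrite !ltr0_norm; lra.
- by rewrite subrr normr0 lexx.
- by apply/orP; right; rewrite !gtr0_norm; lra.
Qed.

Lemma mul_sqrt_dist01_le K x : 0 < K -> K * Num.sqrt (dist01 x) <= K.
Proof.
move=> K0; rewrite ger_pMr// -[leRHS]sqrtr1 ler_wsqrtr//.
by have /andP[_] := dist01_bound x; lra.
Qed.

(* The soft threshold vanishes at distance at most [eta] from the boundary, and
   it lowers the bound [K * sqrt dist01] by as much as the average over a window
   of radius [eta / 2] can raise it. *)
Definition regularize K eta u : R -> R :=
  steklov (fun x => u x - clamp (K * Num.sqrt eta) (u x)) (eta / 2).

Lemma deltaE x : 0 < x < 1 -> delta x = dist01 x.
Proof.
move=> /andP[x0 x1]; have x01 : 0 < x < 1 by rewrite x0.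
have dE : dist01 x = Num.min x (1 - x).
  by rewrite /dist01; apply/max_idPr; rewrite le_min; apply/andP; split; lra.
apply/eqP; rewrite eq_le; apply/andP; split.
  have lb : has_lbound [set `|x - y| | y in ~` `]0, 1[%classic].
    by exists 0 => _ [y _ <-].
  rewrite dE le_min; apply/andP; split.
    apply: ge_inf => //; exists 0; last by rewrite subr0 gtr0_norm.
    by rewrite /= in_itv/= ltxx.
  apply: ge_inf => //; exists 1; last by rewrite distrC gtr0_norm//; lra.
  by rewrite /= in_itv/= ltxx andbF.
apply: lb_le_inf.
  by exists `|x - 0|, 0 => //=; rewrite in_itv/= ltxx.
move=> _ [y /= yI <-]; rewrite dE ge_min; move: yI; rewrite in_itv/= => /negP.
rewrite negb_and -!leNgt => /orP[y0|y1]; apply/orP; [left|right].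
  by rewrite ger0_norm; lra.
by rewrite ler0_norm; lra.
Qed.

Section regularize.
Variables (u : R -> R) (K eta : R).
Hypotheses (mu_ : measurable_fun setT u) (K0 : 0 < K) (eta0 : 0 < eta).
Hypothesis uK : forall x, `|u x| <= K * Num.sqrt (dist01 x).

Let theta := K * Num.sqrt eta.
Let soft x := u x - clamp theta (u x).

Let theta0 : 0 <= theta.
Proof. by rewrite mulr_ge0 ?sqrtr_ge0 ?(ltW K0). Qed.

Let d0 x : 0 <= dist01 x.
Proof. by case/andP: (dist01_bound x). Qed.

Let dK x : K * Num.sqrt (dist01 x) <= K.
Proof. exact: mul_sqrt_dist01_le. Qed.

Let msoft : measurable_fun setT soft.
Proof.
by apply: measurable_funB => //; apply: (@measurable_clamp _ u (fun=> theta)).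
Qed.

Let softK x : `|soft x| <= K.
Proof. exact: le_trans (soft_norm_le _ theta0) (le_trans (uK x) (dK x)). Qed.

Let soft0 x : dist01 x <= eta -> `|soft x| <= 0.
Proof.
move=> deta; apply: (le_trans (soft_norm_le_max _ theta0)).
rewrite ge_max lexx/= subr_le0 (le_trans (uK x))// ler_wpM2l ?(ltW K0)//.
exact: ler_wsqrtr.
Qed.

Let eta20 : 0 < eta / 2.
Proof. by rewrite divr_gt0. Qed.

Lemma regularize_out x : dist01 x <= eta / 2 -> regularize K eta u x = 0.
Proof.
move=> dx; apply/eqP; rewrite -normr_le0.
apply: (steklov_norm_le msoft softK eta20) => y yx; apply: soft0.
by have := dist01_lip y x; have := ler_norm (dist01 y - dist01 x); lra.
Qed.

Lemma regularize_le x : `|regularize K eta u x| <= K * Num.sqrt (dist01 x).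
Proof.
apply: (steklov_norm_le msoft softK eta20) => y yx.
apply: (le_trans (soft_norm_le_max _ theta0)).
rewrite ge_max mulr_ge0 ?sqrtr_ge0 ?(ltW K0)//=.
rewrite lerBlDr (le_trans (uK y))// -mulrDr ler_wpM2l ?(ltW K0)//.
have s1 := sqrtr_ge0 (dist01 x); have s2 := sqrtr_ge0 eta.
have dyx : dist01 y <= dist01 x + eta / 2.
  by have := dist01_lip y x; have := ler_norm (dist01 y - dist01 x); lra.
rewrite -ler_sqr ?nnegrE ?sqrtr_ge0 ?addr_ge0// sqrrD !sqr_sqrtr ?(ltW eta0)//.
have P0 : 0 <= Num.sqrt (dist01 x) * Num.sqrt eta by rewrite mulr_ge0.
by move: eta0; lra.
Qed.

Lemma regularize_bound x : `|regularize K eta u x| <= K.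
Proof. exact: le_trans (regularize_le x) (dK x). Qed.

Lemma continuous_regularize : continuous (regularize K eta u).
Proof. exact: (continuous_steklov msoft softK eta20). Qed.

Lemma measurable_regularize : measurable_fun setT (regularize K eta u).
Proof. exact: (measurable_steklov msoft softK eta20). Qed.

Lemma energy_regularize : (energy (regularize K eta u) <= energy u)%E.
Proof.
apply: (le_trans (energy_steklov eta20 msoft softK)).
by apply: le_energy => // x y; exact: soft_lip.
Qed.

Lemma regularize_X : (energy u < +oo)%E -> X (regularize K eta u).
Proof.
move=> eu; apply: (bounded_X measurable_regularize regularize_bound).
  apply: aeW => x xI; apply: regularize_out; rewrite dist01_out ?(ltW eta20)//.
  by apply/negP; move: xI; rewrite /= in_itv.
exact: le_lt_trans energy_regularize eu.
Qed.

Lemma regularize_C0delta : C0delta (regularize K eta u).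
Proof.
split; first by apply: continuous_subspaceT; exact: continuous_regularize.
(* This maximum removes the zeros of the denominator and alters the quotient only where [regularize]
   vanishes. *)
pose d x : R := Num.max (eta / 2) (dist01 x).
have dgt0 x : 0 < d x by rewrite lt_max eta20.
exists (fun x => regularize K eta u x / Num.sqrt (d x)).
  apply: continuous_subspaceT => x; apply: cvgM; first exact: continuous_regularize.
  apply: cvgV; first by rewrite gt_eqF// sqrtr_gt0.
  apply: (@continuous_comp _ _ _ d (@Num.sqrt R)); last exact: sqrt_continuous.
  apply: continuous_max; first exact: cvg_cst.
  apply/cvgrPdist_le => e e0; near=> y; apply: (le_trans (dist01_lip x y)).
  by near: y; apply: cvgr_dist_le => //; exact: cvg_id.
move=> x; rewrite in_itv/= => x01; rewrite deltaE// /d.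
have [h|h] := leP (dist01 x) (eta / 2); last by [].
by rewrite regularize_out// !mul0r.
Unshelve. all: end_near. Qed.

Lemma norm0delta_regularize : (norm0delta (regularize K eta u) <= K%:E)%E.
Proof.
(* The branch closed at once is the default value 0 of the norm over a null space. *)
rewrite /norm0delta unlock; case: ifP => _; last by rewrite lee_fin ltW.
apply/ess_supP; exists (~` `]0, 1[%classic); split.
- by apply: measurableC; exact: measurable_itv.
- have : mu (~` `]0%R, 1%R[%classic `&` `]0%R, 1%R[%classic : set R) = 0%E.
    by rewrite setICl measure0.
  by [].
move=> x /= xn; apply: contra_not xn => x01.
have {}x01 : 0 < x < 1 by move: x01; rewrite in_itv.
rewrite lee_fin deltaE// normrM normfV [`|Num.sqrt _|]ger0_norm ?sqrtr_ge0//.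
by rewrite ler_pdivrMr ?sqrtr_gt0 ?dist01_gt0//; exact: regularize_le.
Qed.

End regularize.

End approximation.

Section regularization.
Context {R : realType}.
Local Notation mu := (@lebesgue_measure R).
Implicit Types (g u : R -> R) (x K : R).

Lemma regularize_cvg u K : measurable_fun setT u -> 0 < K ->
  (forall x, `|u x| <= K * Num.sqrt (dist01 x)) ->
  {ae mu, forall x, regularize K n.+1%:R^-1 u x @[n --> \oo] --> u x}.
Proof.
move=> mu_ K0 uK.
have u1 x : `|u x| <= K by rewrite (le_trans (uK x))// mul_sqrt_dist01_le.
have liu : locally_integrable setT u.
  apply: open_integrable_locally; first exact: openT.
  apply/integrableP; split; first exact/measurable_EFinP.
  apply: (@le_lt_trans _ _ (\int[mu]_x (K * \1_`[0%R, 1%R] x)%:E)%E).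
    apply: ge0_le_integral => //.
    - by apply/measurable_EFinP; measure_tac.
    - by apply/measurable_EFinP/measurable_funM.
    move=> x _; rewrite lee_fin indicE; case: (boolP (x \in _)) => [_|xI].
      by rewrite mulr1.
    rewrite mulr0 (le_trans (uK x))// dist01_out ?sqrtr0 ?mulr0//.
    apply: contra xI => /andP[x0 x1]; apply/mem_set.
    by rewrite /= in_itv/= !ltW.
  rewrite integral_scaled_indic ?(ltW K0)//= lebesgue_measure_itv/= lte_fin ltr01.
  by rewrite -EFinB -EFinM ltry.
apply: ae_weaken (lebesgue_differentiation liu) => x.
rewrite /lebesgue_pt => lebx.
pose eta n : R := n.+1%:R^-1.
have eta0 n : 0 < eta n by rewrite invr_gt0.
have eta_cvg : eta n @[n --> \oo] --> (0 : R) by exact: cvg_harmonic.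
have eta2_cvg : eta n / 2 @[n --> \oo] --> (0 : R).
  by rewrite -(mul0r 2^-1); apply: cvgM => //; exact: cvg_cst.
have davg_cvg : davg u x (eta n / 2) @[n --> \oo] --> (0%E : \bar R).
  move/cvge_at_rightP : lebx; apply; split => // n.
  by rewrite divr_gt0.
have theta_cvg : K * Num.sqrt (eta n) @[n --> \oo] --> (0 : R).
  rewrite -(mulr0 K) -(@sqrtr0 R); apply: cvgM; first exact: cvg_cst.
  apply: (@cvg_comp _ _ _ eta (@Num.sqrt R)); first exact: eta_cvg.
  exact: sqrt_continuous.
apply/cvgrPdist_lt => e e0.
have theta_near : \forall n \near \oo, K * Num.sqrt (eta n) < e / 2.
  have := cvgr_lt (0 : R) theta_cvg (e / 2); apply; lra.
have davg_near : \forall n \near \oo, (davg u x (eta n / 2) < (e / 2)%:E)%E.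
  apply: (davg_cvg [set y | (y < (e / 2)%:E)%E]); apply: open_nbhs_nbhs; split.
    exact: open_ereal_lt_ereal.
  by rewrite /= lte_fin divr_gt0.
near=> n; rewrite distrC -lte_fin.
have theta0 : 0 <= K * Num.sqrt (eta n) by rewrite mulr_ge0 ?sqrtr_ge0// ltW.
have msoft : measurable_fun setT (fun y => u y - clamp (K * Num.sqrt (eta n)) (u y)).
  by apply: measurable_funB => //; apply: (@measurable_clamp _ u (fun=> K * Num.sqrt (eta n))).
apply: le_lt_trans (steklov_davg (f := fun y => u y - clamp (K * Num.sqrt (eta n)) (u y))
  (h := eta n / 2) (M := K) (theta := K * Num.sqrt (eta n)) x _ msoft _ mu_ u1 _) _.
- by rewrite divr_gt0.
- by move=> y; rewrite (le_trans (soft_norm_le _ theta0)).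
- by move=> y; rewrite addrAC subrr add0r normrN clamp_bound.
rewrite (_ : e = e / 2 + e / 2); last lra.
rewrite EFinD lteD// ?lte_fin.
  by near: n; exact: theta_near.
by near: n; exact: davg_near.
Unshelve. all: end_near. Qed.

(** Only the integral of [G] passes to the limit, by dominated convergence; for the quadratic part
    it suffices that regularization does not increase the energy. *)
Theorem Phi_ge0_of_C0delta g u K : continuous g -> 0 < K ->
  (forall z, X z -> C0delta z -> (norm0delta z <= K%:E)%E -> 0 <= Phi g z) ->
  measurable_fun setT u -> (forall x, `|u x| <= K * Num.sqrt (dist01 x)) ->
  (energy u < +oo)%E -> 0 <= Phi g u.
Proof.
move=> cg K0 H mu_ uK eu.
have u1 x : `|u x| <= K by rewrite (le_trans (uK x))// mul_sqrt_dist01_le.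
have eta0 n : 0 < n.+1%:R^-1 :> R by rewrite invr_gt0.
pose z n := regularize K n.+1%:R^-1 u.
have mz n : measurable_fun setT (z n) by exact: measurable_regularize.
have z1 n x : `|z n x| <= K by exact: regularize_bound.
have [M M0 GM] := bounded_on_itv (- K) K (continuous_primitive cg).
have GK t : `|t| <= K -> `|primitive g t| <= M by rewrite ler_norml; exact: GM.
have Hz n : \int[mu]_(x in `[0, 1]) primitive g (z n x) <= 2^-1 * normX u ^+ 2.
  have : 0 <= Phi g (z n).
    by apply: H; [exact: regularize_X|exact: regularize_C0delta|exact: norm0delta_regularize].
  have ez : (energy (z n) <= energy u)%E by exact: energy_regularize.
  have ezf : (energy (z n) < +oo)%E by exact: le_lt_trans eu.
  have : normX (z n) ^+ 2 <= normX u ^+ 2.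
    by rewrite -lee_fin -(energy_normX ezf) -(energy_normX eu).
  rewrite /Phi; move: (normX _ ^+ 2) (normX _ ^+ 2) (\int[mu]_(x in _) _) => a b c; lra.
have iu := integrable_primitive_bounded cg mu_ u1.
have [|||||_ _ cvgI] := @dominated_convergence _ _ R mu `[0%R, 1%R]%classic (measurable_itv _)
  (fun n x => (primitive g (z n x))%:E) (fun x => (primitive g (u x))%:E) (cst M%:E).
- by move=> n; apply/measurable_EFinP/measurable_funTS; exact: measurable_primitive_comp.
- by apply/measurable_EFinP/measurable_funTS; exact: measurable_primitive_comp.
- apply: ae_weaken (regularize_cvg mu_ K0 uK) => x zx _.
  apply: cvg_EFin; first exact: nearW.
  by apply: (@cvg_comp _ _ _ (fun n => z n x) (primitive g) _ _ _ zx); exact: continuous_primitive.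
- by apply: (@bounded_integrable_itv _ (fun=> M) `|M|).
- by apply: aeW => x n _; rewrite /= lee_fin GK.
rewrite /Phi subr_ge0 -lee_fin /Rintegral fineK; last exact: integrable_fin_num iu.
apply: cvge_le cvgI; apply: nearW => n.
rewrite -[leLHS]fineK ?lee_fin; first exact: Hz.
have iz := integrable_primitive_bounded cg (mz n) (z1 n).
exact: integrable_fin_num iz.
Qed.

End regularization.

(** * The condition [g 0 = 0] *)

Section vanishing_at_zero.
Context {R : realType}.
Local Notation mu := (@lebesgue_measure R).
Implicit Types (g u v z : R -> R) (a c k p q t x e K : R).

Lemma primitive_near g p a e : continuous g ->
  (forall t, `|t| <= `|p| -> `|g t - a| <= e) ->
  `|primitive g p - a * p| <= e * `|p|.
Proof.
move=> cg gL; have gi := continuous_integrable_itv cg.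
have ci : continuous (fun t : R => g t - a).
  by move=> t; apply: cvgB; [exact: cg|exact: cvg_cst].
have c1 (c : R) : continuous (fun _ : R => c) by move=> t; exact: cvg_cst.
have key (q r : R) : q <= r -> (forall t, q <= t <= r -> `|g t - a| <= e) ->
    `|primitive g r - primitive g q - a * (r - q)| <= e * (r - q).
  move=> qr gqr; rewrite primitive_sub//.
  have cE (c : R) : c * (r - q) = \int[mu]_(x in `[q, r]) c.
    rewrite Rintegral_cst//= lebesgue_measure_itv/= lte_fin.
    by move: qr; rewrite le_eqVlt => /predU1P[->|->//]; rewrite ltxx/= subrr.
  rewrite !cE -RintegralB//; last exact: (continuous_integrable_itv (c1 a)).
  have gi' := continuous_integrable_itv ci q r.
  apply: (le_trans (le_normr_Rintegral _ gi')) => //.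
  apply: le_Rintegral => //.
  - exact: integrable_norm.
  - exact: (continuous_integrable_itv (c1 e)).
have [p0|p0] := leP 0 p.
  have := key 0 p p0; rewrite primitive0 !subr0 (ger0_norm p0); apply.
  by move=> t /andP[t0 tp]; apply: gL; rewrite !ger0_norm.
have := key p 0 (ltW p0); rewrite primitive0 !sub0r (ltr0_norm p0).
have -> : - primitive g p - a * - p = - (primitive g p - a * p) by ring.
rewrite normrN; apply => t /andP[tp t0]; apply: gL.
by rewrite ler0_norm// ltr0_norm// lerN2.
Qed.

Lemma energy_scale c v : measurable_fun setT v ->
  (energy (fun x => c * v x)%R = (c ^+ 2)%:E * energy v)%E.
Proof.
move=> mv; rewrite /energy -ge0_integralZl_EFin ?sqr_ge0//.
- by apply: eq_integral => p _; rewrite -EFinM mulrA -exprMn mulrBr.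
- by move=> p _; rewrite lee_fin mulr_ge0 ?sqr_ge0 ?kern_ge0.
- exact: measurable_energy_integrand.
Qed.

Lemma cap_eq0 k z x : 0 < k -> 0 < x < 1 -> cap k z x = 0 -> z x = 0.
Proof.
move=> k0 x01; have c0 : 0 < k * barrier x by rewrite mulr_gt0 ?barrier_gt0.
by rewrite /cap; have [] := clampP (z x) (ltW c0) => -[? ->]; lra.
Qed.

Lemma barrier_le_sqrt x : barrier x <= 2 * Num.sqrt (dist01 x).
Proof.
have /andP[d0 _] := dist01_bound x; have s0 := sqrtr_ge0 (dist01 x).
rewrite -ler_sqr ?nnegrE ?barrier_ge0 ?mulr_ge0//.
rewrite [leRHS]exprMn (sqr_sqrtr d0).
by apply: (le_trans (barrier_sqr_le x)); lra.
Qed.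

Lemma cap_le_sqrt k z x : 0 <= k ->
  `|cap k z x| <= 2 * k * Num.sqrt (dist01 x).
Proof.
move=> k0; apply: (le_trans (cap_bound z x k0)).
by rewrite [2 * k]mulrC -mulrA ler_wpM2l// barrier_le_sqrt.
Qed.

Lemma energy_cap_lty k z : 0 < k -> measurable_fun setT z ->
  {ae mu, forall x, ~ `]0, 1[%classic x -> z x = 0} -> (energy z < +oo)%E ->
  (energy (cap k z) < +oo)%E.
Proof.
move=> k0 mz z0 ez; apply: le_lt_trans (ez); apply: le_trans (energy_cap k0 mz z0 ez).
by rewrite leeDl// mule_ge0 ?lee_fin ?(ltW k0)// integral_ge0.
Qed.

Lemma continuous_near0 g e : continuous g -> 0 < e ->
  exists2 d : R, 0 < d & forall t, `|t| <= d -> `|g t - g 0| <= e.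
Proof.
move=> cg e0; have := cg 0 => /cvgrPdist_le/(_ _ e0)/nbhs_ballP[d /= d0 gd].
exists (d / 2); first by rewrite divr_gt0.
move=> t td; rewrite distrC; apply: gd.
by rewrite -ball_normE/= sub0r normrN (le_lt_trans td)// ltr_pdivrMr// ltr_pMr ?ltr1n.
Qed.

(** Turns any nonzero element of [X] into a nonzero competitor below the barrier: capping at a
    positive height creates no new zeros. *)
Lemma integral_cap_gt0 k z : 0 < k -> X z -> ~ {ae mu, forall x, z x = 0} ->
  0 < \int[mu]_(x in `[0, 1]) `|cap k z x|.
Proof.
move=> k0 Xz nz; have mc := measurable_cap k (X_measurable Xz).
have ck x : `|cap k z x| <= k.
  by rewrite (le_trans (cap_bound z x (ltW k0)))// ger_pMr// barrier_le1.
have mv : measurable_fun setT (fun x => `|cap k z x|) by measure_tac.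
have vk x : `| `|cap k z x| | <= k by rewrite normr_id.
have iv := bounded_integrable_itv mv vk 0 1.
rewrite lt_neqAle Rintegral_ge0// andbT eq_sym; apply/eqP => J0; apply: nz.
have : (\int[mu]_(x in `[0%R, 1%R]) `|(cap k z x)%:E| = 0)%E.
  rewrite -[LHS]fineK; first by congr EFin; exact: J0.
  exact: integrable_fin_num iv.
move/(ae_eq_integral_abs mu (measurable_itv _)) => H.
have {}H : ae_eq mu `[0%R, 1%R]%classic (fun x => (cap k z x)%:E) (cst 0%E).
  by apply: H; apply/measurable_EFinP; exact: measurable_funTS.
apply: (@filterS2 _ _ (ae_filter_ringOfSetsType mu) _ _ _ _ H (X_ae0 Xz)) => x Hx Ox.
have [x01|x01] := boolP (0 < x < 1); last first.
  by apply: Ox; rewrite /= in_itv/=; exact/negP.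
apply: (cap_eq0 k0 x01); have [x0 x1] := andP x01.
have : `[0%R, 1%R]%classic x by rewrite /= in_itv/= !ltW.
by move=> /Hx[].
Qed.

(** If [g 0] were nonzero, a small multiple [t] of [|cap k z|], with the sign of [g 0], would lower
    the integral term of [Phi] linearly in [t], while its energy is only quadratic. The absolute
    value makes the linear term proportional to [J > 0]. *)
Lemma g0_eq0 g K z : continuous g -> 0 < K ->
  (forall u, X u -> C0delta u -> (norm0delta u <= K%:E)%E -> 0 <= Phi g u) ->
  X z -> ~ {ae mu, forall x, z x = 0} -> g 0 = 0.
Proof.
move=> cg K0 H Xz nz; apply: contrapT => /eqP g00.
pose k := K / 2; have k0 : 0 < k by rewrite divr_gt0.
have kK : 2 * k = K by rewrite /k; lra.
pose v x := `|cap k z x|.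
have mc := measurable_cap k (X_measurable Xz).
have mv : measurable_fun setT v by rewrite /v; measure_tac.
have vK x : `|v x| <= K * Num.sqrt (dist01 x).
  by rewrite normr_id -kK cap_le_sqrt// ltW.
have v0 x : 0 <= v x by rewrite /v.
have v1 x : `|v x| <= K by rewrite (le_trans (vK x))// mul_sqrt_dist01_le.
have ev : (energy v < +oo)%E.
  have ez : (energy z < +oo)%E by rewrite (X_energy Xz) ltry.
  apply: le_lt_trans (energy_cap_lty k0 (X_measurable Xz) (X_ae0 Xz) ez).
  apply: le_energy => // x y.
  exact: ler_dist_dist.
set J := \int[mu]_(x in `[0, 1]) v x.
have J0 : 0 < J by exact: integral_cap_gt0.
pose a := `|g 0|; have a0 : 0 < a by rewrite normr_gt0.
have a20 : 0 < a / 2 by rewrite divr_gt0.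
have [d d0 gd] := continuous_near0 cg a20.
pose N := normX v ^+ 2; have N0 : 0 <= N by rewrite sqr_ge0.
have small t : 0 < t -> t <= 1 -> t * K <= d -> a * J <= t * N.
  move=> t0 t1 tKd; pose c := Num.sg (g 0) * t.
  have cn : `|c| = t by rewrite normrM normr_sg g00 mul1r gtr0_norm.
  have gc : g 0 * c = a * t by rewrite mulrA /a [`|g 0|]normrEsg [g 0 * _]mulrC.
  pose u x := c * v x.
  have mu_ : measurable_fun setT u by rewrite /u; measure_tac.
  have uv x : `|u x| = t * v x by rewrite normrM cn (ger0_norm (v0 x)).
  have uK x : `|u x| <= K * Num.sqrt (dist01 x).
    rewrite uv; apply: le_trans (vK x); rewrite (ger0_norm (v0 x)).
    by rewrite ler_piMl.
  have eu : energy u = (c ^+ 2 * N)%:E.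
    by rewrite energy_scale// (energy_normX ev) -EFinM.
  have euf : (energy u < +oo)%E by rewrite eu ltry.
  have : 0 <= Phi g u by exact: (Phi_ge0_of_C0delta cg K0 H mu_ uK euf).
  have nu : normX u ^+ 2 = t ^+ 2 * N.
    have := energy_normX euf; rewrite eu => -[<-].
    by rewrite -cn real_normK// num_real.
  have u1 x : `|u x| <= K.
    rewrite uv; apply: le_trans (v1 x); rewrite (ger0_norm (v0 x)).
    by rewrite ler_piMl.
  have iG := integrable_primitive_bounded cg mu_ u1.
  have iv := bounded_integrable_itv mv v1 0 1.
  have Ge : a / 2 * t * J <= \int[mu]_(x in `[0, 1]) primitive g (u x).
    rewrite /J -RintegralZl//; apply: le_Rintegral => //.
    - by apply: (integrableZl _ (a / 2 * t) iv).
    move=> x _.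
    have := @primitive_near g (u x) (g 0) (a / 2) cg.
    have -> : g 0 * u x = a * t * v x by rewrite /u mulrA gc.
    rewrite uv => /(_ _); rewrite ler_distl => P.
    have /andP[+ _] : a * t * v x - a / 2 * (t * v x) <= primitive g (u x) <=
        a * t * v x + a / 2 * (t * v x).
      apply: P => r rt; apply: gd; apply: (le_trans rt); apply: le_trans tKd.
      by rewrite ler_wpM2l ?(ltW t0)// -(ger0_norm (v0 x)).
    by apply: le_trans; lra.
  rewrite /Phi nu; move: Ge; move: (\int[mu]_(x in _) primitive g (u x)) => I0 Ge.
  rewrite subr_ge0 => /(le_trans Ge).
  rewrite (_ : a / 2 * t * J = (t / 2) * (a * J)); last lra.
  rewrite (_ : 2^-1 * (t ^+ 2 * N) = (t / 2) * (t * N)); last lra.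
  by rewrite ler_pM2l// divr_gt0.
(* The last entry makes [t0 * N] at most half of [a * J], against [small]; [N + 1] guards against
   [N = 0]. *)
pose t0 := Num.min 1 (Num.min (d / K) (a * J / (2 * (N + 1)))).
have N1 : 0 < 2 * (N + 1) by lra.
have aJ : 0 < a * J by rewrite mulr_gt0.
have t00 : 0 < t0 by rewrite !lt_min ltr01/= !divr_gt0.
have : a * J <= t0 * N.
  apply: small => //; first by rewrite ge_min lexx.
  by rewrite -ler_pdivlMr// /t0 !ge_min lexx orbT.
have : t0 * N <= a * J / (2 * (N + 1)) * N.
  by rewrite ler_wpM2r// /t0 !ge_min lexx !orbT.
have : a * J / (2 * (N + 1)) * N <= a * J / 2.
  rewrite (_ : _ * N = a * J / 2 * (N / (N + 1))); last first.
    by field; rewrite gt_eqF//; lra.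
  by rewrite ler_piMr ?divr_ge0 ?(ltW aJ)// ler_pdivrMr; lra.
lra.
Qed.

End vanishing_at_zero.

Section ae_zero.
Context {R : realType}.
Local Notation mu := (@lebesgue_measure R).

Lemma Phi_ae0_ge0 (g z : R -> R) : continuous g -> measurable_fun setT z ->
  {ae mu, forall x, z x = 0} -> 0 <= Phi g z.
Proof.
move=> cg mz z0; rewrite /Phi [X in _ - X](_ : _ = 0) ?subr0.
  by rewrite mulr_ge0 ?invr_ge0// sqr_ge0.
rewrite /Rintegral (_ : (\int[mu]_(x in _) _)%E = 0%E)//.
rewrite -(integral0 mu `[0%R, 1%R]%classic); apply: ae_eq_integral => //.
  apply/measurable_EFinP/measurable_funTS; exact: measurable_primitive_comp.
by apply: ae_weaken z0 => x zx _; rewrite zx primitive0.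
Qed.

End ae_zero.

Theorem theorem4 (R : realType) (g : R -> R) :
  continuous g ->
  subcritical g \/ critical g ->
  (exists2 r1 : R, 0 < r1 &
     forall z : R -> R, X z -> C0delta z -> (norm0delta z <= r1%:E)%E ->
       Phi g (fun=> 0) <= Phi g z) ->
  exists2 r2 : R, 0 < r2 &
    forall z : R -> R, X z -> normX z <= r2 ->
      Phi g (fun=> 0) <= Phi g z.
Proof.
move=> cg grow [r1 r10]; rewrite Phi_cst0 => H.
(* A nonzero element of [X] is the test function for [g 0 = 0]; if there were none, [Phi] would
   reduce to its nonnegative quadratic part. *)
have [[z0 [Xz0 nz0]]|triv] := pselect (exists z : R -> R, X z /\
    ~ {ae (@lebesgue_measure R), forall x, z x = 0}); last first.
  exists 1 => // z Xz _; apply: Phi_ae0_ge0 => //; first exact: X_measurable.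
  by apply: contrapT => nz; apply: triv; exists z.
have g0 := g0_eq0 cg r10 H Xz0 nz0.
(* The barrier is at most [2 * sqrt d], so capping at [k * barrier] lands below [r1 * sqrt d]. Then
   [s] comes from [k] by continuity of [g] at 0, and [E] from [s]. *)
pose k := r1 / 2; have k0 : 0 < k by rewrite divr_gt0.
have k20 : 0 < k / 2 by rewrite divr_gt0.
have [s s0 gs] := continuous_near0 cg k20; rewrite g0 in gs.
have {}gs t : `|t| <= s -> `|g t| <= k / 2 by rewrite -[g t]subr0; exact: gs.
have [E E0 truncE] := constant_truncation cg grow s0.
exists (Num.sqrt E); first by rewrite sqrtr_gt0.
move=> z Xz zE; have mz := X_measurable Xz; have z_out := X_ae0 Xz.
have eE : (energy z <= E%:E)%E.
  rewrite (X_energy Xz) lee_fin -[leRHS]sqr_sqrtr ?(ltW E0)//.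
  by rewrite lerXn2r// nnegrE sqrtr_ge0.
pose w := clamp s \o z.
have mw : measurable_fun setT w by apply: (@measurable_clamp _ z (fun=> s)).
have ws x : `|w x| <= s by rewrite clamp_bound// ltW.
have w_out : {ae (@lebesgue_measure R), forall x, ~ `]0, 1[%classic x -> w x = 0}.
  apply: ae_weaken z_out => x zx /zx zx0.
  have := clamp_norm_le 0 (ltW s0).
  by rewrite /w/= zx0 normr0 normr_le0 => /eqP.
have ew : (energy w < +oo)%E.
  apply: le_lt_trans (ltry E); apply: le_trans eE; apply: le_energy => // x y.
  by rewrite clamp_lip// ltW.
apply: le_trans (truncE z mz z_out eE).
apply: le_trans (barrier_truncation cg k0 gs mw ws w_out ew).
have ec := energy_cap_lty k0 mw w_out ew.
apply: (Phi_ge0_of_C0delta cg r10 H (measurable_cap k mw) _ ec) => x.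
by rewrite (_ : r1 = 2 * k) ?cap_le_sqrt ?(ltW k0)// /k; lra.
Qed.
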